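(* Let $L$ be an even lattice of signature $(2,2)$ with $L\otimes\mathbb{R}=L^+\oplus L^-$ a decomposition into isotropic subspaces of dimension 2, and let $\alpha\in L$. Then $$\dim\widetilde P^{0,0}(\alpha)\ \ge\ p\big(-(\alpha,\alpha)/2\big),$$ where $p(n)$ denotes the number of integer partitions of $n$ ($p(0)=1$, $p(n)=0$ for $n<0$).
   Context: $V_{r,s}=\{v\in V_{NS}:L_0v=rv,\ J_0v=sv\}$; $P^{0,0}=\{v\in V_{NS}:L_0v=0,\ J_0v=0,\ G^\pm_{n-1/2}v=J_nv=0\text{ for all }n>0\}$; $\widetilde P^{0,0}=P^{0,0}/\big((G^+_{-1/2}V_{-1/2,-1}+G^-_{-1/2}V_{-1/2,1})\cap P^{0,0}\big)$. $\widetilde P^{0,0}(\alpha)$ is the image of $P^{0,0}(\alpha)=P^{0,0}\cap(S(\widehat h^-)\otimes F\otimes e^\alpha)$. Space. Let $h=L\otimes\mathbb{C}$, $\widehat h^-=h\otimes t^{-1}\mathbb{C}[t^{-1}]$, $x(n)=x\otimes t^n$, $V_L=S(\widehat h^-)\otimes\mathbb{C}\{L\}$, where $\mathbb{C}\{L\}$ has basis $e^\lambda$ ($\lambda\in L$) and product $e^\lambda e^\mu=\epsilon(\lambda,\mu)e^{\lambda+\mu}$, $\epsilon$ a $\{\pm1\}$-valued 2-cocycle with $\epsilon(\lambda,\mu)=(-1)^{(\lambda,\mu)}\epsilon(\mu,\lambda)$, $\epsilon(\lambda,-\lambda)=(-1)^{(\lambda,\lambda)/2}$, $\epsilon(0,\lambda)=\epsilon(\lambda,0)=1$.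 The operators $x(n)$ satisfy $[x(m),y(n)]=m(x,y)\delta_{m+n,0}$, $x(n)e^\lambda=0$ for $n>0$, and $x(0)$ acts on $S(\widehat h^-)\otimes e^\lambda$ as $(x,\lambda)$. Let $F$ be the exterior algebra on $a_i(-r),a_i^*(-r)$ ($i=1,2$, $r\in\frac12+\mathbb{Z}_{\ge0}$), with operators $a_i(r),a_i^*(r)$ ($r\in\frac12+\mathbb{Z}$) satisfying $\{a_i(r),a_j^*(s)\}=\delta_{ij}\delta_{r+s,0}$, $\{a_i(r),a_j(s)\}=\{a_i^*(r),a_j^*(s)\}=0$, those with $r>0$ killing $1$. $V_{NS}=V_L\otimes F$ is a vertex operator superalgebra with $Y(x(-1),z)=\sum_nx(n)z^{-n-1}$, $Y(a(-\frac12),z)=\sum_ra(r)z^{-r-1/2}$ and $Y(e^\lambda,z)=\exp(\sum_{n>0}\frac{\lambda(-n)}nz^n)e^\lambda z^{\lambda(0)}\exp(-\sum_{n>0}\frac{\lambda(n)}nz^{-n})$. $N=2$ structure. Choose bases $h_i^\pm$ of $L^\pm$ with $(h_i^+,h_j^-)=\delta_{ij}$ and put $\omega=\sum_ih_i^+(-1)h_i^-(-1)+\frac12\sum_i\big(a_i(-\frac32)a_i^*(-\frac12)+a_i^*(-\frac32)a_i(-\frac12)\big)$, $\tau^+=\sum_ih_i^+(-1)a_i(-\frac12)$, $\tau^-=\sum_ih_i^-(-1)a_i^*(-\frac12)$, $j=\sum_ia_i(-\frac12)\wedge a_i^*(-\frac12)$; $Y(\omega,z)=\sum L_nz^{-n-2}$,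 $Y(\tau^\pm,z)=\sum_nG^\pm_{n+1/2}z^{-n-2}$, $Y(j,z)=\sum J_nz^{-n-1}$. *)

(* Defs.v *)
From HB Require Import structures.
From mathcomp Require Import all_boot all_order all_algebra.
From mathcomp Require Import finmap multiset complex generic_quotient ring_quotient.
From mathcomp Require Import boolp classical_sets fsbigop reals.
From mathcomp Require Import monalg.
Set Implicit Arguments.
Unset Strict Implicit.
Unset Printing Implicit Defensive.
Import Order.TTheory GRing.Theory Num.Theory.
Local Open Scope classical_set_scope.
Local Open Scope ring_scope.

(* A lattice of rank 4 is Z^4 together with a symmetric integral Gram matrix;
   L (x) K is then 'rV[K]_4, with the form given by the same matrix. *)
Notation lattice := 'rV[int]_4.

Definition hform (K : pzRingType) (G : 'M[int]_4) (x y : 'rV[K]_4) : K :=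
  (x *m map_mx intr G *m y^T) 0 0.

Definition lform (G : 'M[int]_4) (x y : lattice) : int := (x *m G *m y^T) 0 0.

Definition even_lattice (G : 'M[int]_4) : Prop :=
  G^T = G /\ forall x : lattice, (2%:Z %| lform G x x)%Z.

Definition signature22 (R : realType) (G : 'M[int]_4) : Prop :=
  exists2 T : 'M[R]_4, T \in unitmx &
    T *m map_mx intr G *m T^T = diag_mx (\row_j (-1) ^+ (1 < j)%N).

Definition isotropic (R : realType) (G : 'M[int]_4) (U : {vspace 'rV[R]_4}) :
  Prop := forall x y, x \in U -> y \in U -> hform G x y = 0.

Record cocycle (G : 'M[int]_4) (eps : lattice -> lattice -> int) : Prop := {
  eps_sign : forall l m, eps l m = 1 \/ eps l m = -1;
  eps_cocycle : forall l m n,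
    eps l m * eps (l + m) n = eps l (m + n) * eps m n;
  eps_comm : forall l m, eps l m = (-1) ^ lform G l m * eps m l;
  eps_opp : forall l, eps l (- l) = (-1) ^ (lform G l l %/ 2)%Z;
  eps_zero : forall l, eps 0 l = 1 /\ eps l 0 = 1 }.

(* (i, k) stands for e_i(-(k+1)), where e_i is the i-th basis vector of L. *)
Notation bmode := ('I_4 * nat)%type.

(* (false, i, k) stands for a_i(-(k+1/2)) and (true, i, k) for
   a_i^*(-(k+1/2)); the lexicographic order fixes the order of the factors in
   the wedge monomials that form the basis of F. *)
Notation fmode := ((bool *l 'I_2) *l nat)%type.

(* (l, m, D) stands for (product of m) (x) (ordered wedge of D) (x) e^l. *)
Notation fock := (lattice * {mset bmode}%mset * {fset fmode})%type.

Section Fock.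
Variables (C : numFieldType) (G : 'M[int]_4) (eps : lattice -> lattice -> int).

Definition VNS := {malg C[fock]}.
HB.instance Definition _ := GRing.Lmodule.on VNS.

Definition vac : VNS := << (0, mset0, fset0) >>.

Definition lext (f : fock -> VNS) (v : VNS) : VNS :=
  \sum_(k <- msupp v) v@_k *: f k.

Lemma lextE f v (D : {fset fock}) :
  (msupp v `<=` D)%fset -> lext f v = \sum_(k <- D) v@_k *: f k.
Proof.
move=> vD; rewrite /lext (big_fset_incl _ vD) // => k _ kv.
by rewrite mcoeff_outdom // scale0r.
Qed.

Lemma lext_linear f : linear (lext f).
Proof.
move=> a u v; pose D := (msupp u `|` msupp v `|` msupp (a *: u + v))%fset.
rewrite !(@lextE _ _ D); first last.
- by apply/fsubsetP=> k; rewrite !inE => ->; rewrite orbT.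
- by apply/fsubsetP=> k; rewrite !inE => ->.
- by apply/fsubsetP=> k; rewrite !inE => ->; rewrite orbT.
rewrite scaler_sumr -big_split; apply: eq_bigr => k _ /=.
by rewrite mcoeffD mcoeffZ scalerDl scalerA.
Qed.

Definition hbase (i : 'I_4) : 'rV[C]_4 := delta_mx 0 i.
Definition hlat (l : lattice) : 'rV[C]_4 := map_mx intr l.

(* The operator x(n): x(-n) multiplies by the variable, and x(n) is the
   derivation n (x, e_i) d/d(e_i(-n)). *)
Definition bos (x : 'rV[C]_4) (n : int) : VNS -> VNS :=
  lext (fun k => let: (l, m, D) := k in
    match n with
    | Negz p => \sum_i x 0 i *: << (l, msetD (msetn 1 (i, p)) m, D) >>
    | Posz 0 => hform G x (hlat l) *: << (l, m, D) >>
    | Posz p.+1 =>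
        \sum_i (p.+1%:R * hform G x (hbase i) * (m (i, p))%:R)
          *: << (l, msetB m (msetn 1 (i, p)), D) >>
    end).

Definition wedge_sign (s : fmode) (D : {fset fmode}) : C :=
  (-1) ^+ count (fun t => (t < s)%O) (enum_fset D).

(* ferm false i n is a_i(n+1/2) and ferm true i n is a_i^*(n+1/2), so that n is
   the index for which Y(a,z) = sum_n a_n z^(-n-1). *)
Definition ferm (b : bool) (i : 'I_2) (n : int) : VNS -> VNS :=
  lext (fun k => let: (l, m, D) := k in
    match n with
    | Negz p => let s : fmode := (b, i, p) in
        if s \in D then 0
        else wedge_sign s D *: << (l, m, fsetU [fset s]%fset D) >>
    | Posz p => let s : fmode := (~~ b, i, p) in
        if s \in D then wedge_sign s D *: << (l, m, fsetD D [fset s]%fset) >>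
        else 0
    end).

(* e^l as an operator on the twisted group algebra. *)
Definition eshift (l : lattice) : VNS -> VNS :=
  lext (fun k => let: (l', m, D) := k in
    (eps l l')%:~R *: << (l + l', m, D) >>).

(* A field sum_n A_n z^(-n-1) is given by its modes n |-> A_n. *)
Definition field := int -> VNS -> VNS.

Definition deriv_field (A : field) : field :=
  fun n v => (- n)%:~R *: A (n - 1) v.

Definition divderiv (p : nat) (A : field) : field :=
  fun n v => (p`!%:R)^-1 *: iter p deriv_field A n v.

(* Normally ordered product :A(z)B(z):, with sg = true iff A and B are both odd.
   On each basis vector only finitely many terms are nonzero. *)
Definition nop (sg : bool) (A B : field) : field :=
  fun n => lext (fun k =>
    \sum_(j \in [set: nat]) A (Negz j) (B (n + j%:Z) << k >>) +
    (-1) ^+ sg *: \sum_(j \in [set: nat]) B (n - j%:Z - 1) (A j%:Z << k >>)).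

(* Coefficient of z^p in (sum_(n > 0) b_n z^n)^j, then in its exponential. *)
Fixpoint pow_coef (b : nat -> VNS -> VNS) (j p : nat) (v : VNS) : VNS :=
  if j is j'.+1 then \sum_(1 <= n < p.+1) b n (pow_coef b j' (p - n) v)
  else if p == 0%N then v else 0.

Definition exp_coef (b : nat -> VNS -> VNS) (p : nat) (v : VNS) : VNS :=
  \sum_(j < p.+1) (j`!%:R)^-1 *: pow_coef b j p v.

Definition expminus (l : lattice) : nat -> VNS -> VNS :=
  exp_coef (fun n v => n%:R^-1 *: bos (hlat l) (- n%:Z) v).

(* Coefficient of z^(-p) in exp(- sum_(n > 0) l(n)/n z^(-n)). *)
Definition expplus (l : lattice) : nat -> VNS -> VNS :=
  exp_coef (fun n v => - (n%:R^-1 *: bos (hlat l) n%:Z v)).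

Definition Yexp (l : lattice) : field :=
  fun n => lext (fun k => \sum_(j \in [set: nat])
    match j%:Z - n - 1 - lform G l k.1.1 with
    | Posz p => expminus l p (eshift l (expplus l j << k >>))
    | Negz _ => 0
    end).

(* The vertex operators of the basis vectors, from the ones of the generators
   by Y(a_(-p-1) b, z) = :(d^p/p!) Y(a,z) Y(b,z): . *)
Fixpoint Yferm (l : lattice) (s : seq fmode) : field :=
  if s is (b, i, p) :: s'
  then nop (odd (size s')) (divderiv p (ferm b i)) (Yferm l s')
  else Yexp l.

Fixpoint Ybos (B : field) (s : seq bmode) : field :=
  if s is (i, p) :: s' then nop false (divderiv p (bos (hbase i))) (Ybos B s')
  else B.

Definition Ybasis (k : fock) : field :=
  let: (l, m, D) := k in
  Ybos (Yferm l (sort <=%O (enum_fset D))) (enum_mset m).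

(* Y v n is the coefficient of z^(-n-1) in Y(v,z). *)
Definition Y (v : VNS) : field :=
  fun n u => \sum_(k <- msupp v) v@_k *: Ybasis k n u.

Lemma Ybasis_linear k n : linear (Ybasis k n).
Proof.
case: k => [[l m] D] /=; case: (enum_mset m) => [|[i p] s] /=; last first.
  exact: lext_linear.
by case: (sort _ _) => [|[[b i] p] s]; exact: lext_linear.
Qed.

Lemma Y_linear v n : linear (Y v n).
Proof.
move=> a u w; rewrite /Y scaler_sumr -big_split; apply: eq_bigr => k _ /=.
by rewrite Ybasis_linear scalerDr !scalerA mulrC.
Qed.

Section N2.
Variables hp hm : 2.-tuple 'rV[C]_4.

Definition omega : VNS :=
  \sum_(i < 2) bos (tnth hp i) (-1) (bos (tnth hm i) (-1) vac) +
  2%:R^-1 *: \sum_(i < 2) (ferm false i (-2) (ferm true i (-1) vac) +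
                           ferm true i (-2) (ferm false i (-1) vac)).
Definition tau_plus : VNS :=
  \sum_(i < 2) bos (tnth hp i) (-1) (ferm false i (-1) vac).
Definition tau_minus : VNS :=
  \sum_(i < 2) bos (tnth hm i) (-1) (ferm true i (-1) vac).
Definition jcur : VNS := \sum_(i < 2) ferm false i (-1) (ferm true i (-1) vac).

Definition Lop (n : int) : VNS -> VNS := Y omega (n + 1).
Definition Jop (n : int) : VNS -> VNS := Y jcur n.
(* Gplus n is G^+_{n+1/2}. *)
Definition Gplus (n : int) : VNS -> VNS := Y tau_plus (n + 1).
Definition Gminus (n : int) : VNS -> VNS := Y tau_minus (n + 1).

Definition Vrs (r s : C) : set VNS :=
  [set v | Lop 0 v = r *: v /\ Jop 0 v = s *: v].

Definition P00 : set VNS :=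
  [set v | [/\ Lop 0 v = 0, Jop 0 v = 0 &
    forall n : nat, (0 < n)%N ->
      [/\ Gplus (n%:Z - 1) v = 0, Gminus (n%:Z - 1) v = 0 & Jop n%:Z v = 0]]].

Definition exact00 : set VNS :=
  [set u + w | u in Gplus (-1) @` Vrs (- 2%:R^-1) (-1) &
               w in Gminus (-1) @` Vrs (- 2%:R^-1) 1].

Definition sector (a : lattice) : set VNS :=
  [set v | forall k, k \in msupp v -> k.1.1 = a].

Definition P00_ (a : lattice) : set VNS := P00 `&` sector a.

Definition exactP00 : {pred VNS} := fun v => `[< (exact00 `&` P00) v >].

Lemma Lop_linear n : linear (Lop n). Proof. exact: Y_linear. Qed.
Lemma Jop_linear n : linear (Jop n). Proof. exact: Y_linear. Qed.
Lemma Gplus_linear n : linear (Gplus n). Proof. exact: Y_linear. Qed.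
Lemma Gminus_linear n : linear (Gminus n). Proof. exact: Y_linear. Qed.

Lemma linear_at0 (f : VNS -> VNS) : linear f -> f 0 = 0.
Proof.
move=> fL; have := fL (-1) 0 0; rewrite scaler0 addr0 => ->.
by rewrite scaleN1r addNr.
Qed.

Lemma Vrs_lin r s a u v : Vrs r s u -> Vrs r s v -> Vrs r s (a *: u + v).
Proof.
move=> [Lu Ju] [Lv Jv]; split; rewrite (Lop_linear, Jop_linear).
  by rewrite Lu Lv scalerDr !scalerA (mulrC a).
by rewrite Ju Jv scalerDr !scalerA (mulrC a).
Qed.

Lemma Vrs0 r s : Vrs r s 0.
Proof.
by split; rewrite scaler0 linear_at0 //; [exact: Lop_linear | exact: Jop_linear].
Qed.

Lemma P00_lin a u v : P00 u -> P00 v -> P00 (a *: u + v).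
Proof.
move=> [Lu Ju Gu] [Lv Jv Gv]; split=> [||n n0].
- by rewrite Lop_linear Lu Lv scaler0 addr0.
- by rewrite Jop_linear Ju Jv scaler0 addr0.
have [Gu1 Gu2 Gu3] := Gu n n0; have [Gv1 Gv2 Gv3] := Gv n n0; split.
- by rewrite Gplus_linear Gu1 Gv1 scaler0 addr0.
- by rewrite Gminus_linear Gu2 Gv2 scaler0 addr0.
- by rewrite Jop_linear Gu3 Gv3 scaler0 addr0.
Qed.

Lemma exact00_lin a u v : exact00 u -> exact00 v -> exact00 (a *: u + v).
Proof.
move=> [_ [x xV <-]] [_ [y yV <-]] <- [_ [x' xV' <-]] [_ [y' yV' <-]] <-.
exists (Gplus (-1) (a *: x + x')).
  by exists (a *: x + x'); [exact: Vrs_lin | reflexivity].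
exists (Gminus (-1) (a *: y + y')).
  by exists (a *: y + y'); [exact: Vrs_lin | reflexivity].
by rewrite Gplus_linear Gminus_linear scalerDr addrACA.
Qed.

Lemma exactP00_submod : submod_closed exactP00.
Proof.
have L0 n := linear_at0 (Lop_linear n); have J0 n := linear_at0 (Jop_linear n).
have Gp0 n := linear_at0 (Gplus_linear n).
have Gm0 n := linear_at0 (Gminus_linear n).
split.
  apply/asboolP; split; last by split=> [||n _]; rewrite ?L0 ?J0 ?Gp0 ?Gm0.
  exists 0; first by exists 0; [exact: Vrs0 | exact: Gp0].
  by exists 0; [exists 0; [exact: Vrs0 | exact: Gm0] | rewrite addr0].
move=> a u v /asboolP[uE uP] /asboolP[vE vP].
by apply/asboolP; split; [exact: exact00_lin | exact: P00_lin].
Qed.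

End N2.
End Fock.

Section Quotient.
Variables (K : fieldType) (V : lmodType K) (W : {pred V}).
Hypothesis Wsub : submod_closed W.

Lemma submod_zmod_closed : zmod_closed W.
Proof. exact: GRing.submod_closedB Wsub. Qed.

Definition zmodW : zmodClosed V :=
  HB.pack W (GRing.isZmodClosed.Build V W submod_zmod_closed).

Definition lquot := Quotient.quot zmodW.
HB.instance Definition _ := GRing.Zmodule.on lquot.

Definition lquot_pi (v : V) : lquot := (\pi_(Quotient.quot zmodW) v)%qT.

Lemma lquot_pi_eq u v : (lquot_pi u == lquot_pi v) = (u - v \in W).
Proof. by rewrite -[RHS]/(u - v \in zmodW) Quotient.idealrBE. Qed.

Definition lquot_scale (a : K) (x : lquot) : lquot :=
  lquot_pi (a *: (repr x : V)).

Lemma lquot_piK x : lquot_pi (repr x) = x.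
Proof. exact: reprK. Qed.

Lemma lquot_piD u v : lquot_pi (u + v) = lquot_pi u + lquot_pi v.
Proof. by rewrite /lquot_pi raddfD. Qed.

Lemma lquot_piZ a v : lquot_scale a (lquot_pi v) = lquot_pi (a *: v).
Proof.
apply/eqP; rewrite lquot_pi_eq -scalerBr -[_ *: _]addr0.
apply: Wsub.2 Wsub.1; rewrite -lquot_pi_eq; apply/eqP; exact: lquot_piK.
Qed.

Lemma lquot_scaleA a b x :
  lquot_scale a (lquot_scale b x) = lquot_scale (a * b) x.
Proof. by rewrite -[x]lquot_piK !lquot_piZ scalerA. Qed.

Lemma lquot_scale1 : left_id 1 lquot_scale.
Proof. by move=> x; rewrite -[x]lquot_piK lquot_piZ scale1r. Qed.

Lemma lquot_scaleDr : right_distributive lquot_scale +%R.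
Proof.
move=> a x y; rewrite -[x]lquot_piK -[y]lquot_piK -lquot_piD !lquot_piZ.
by rewrite scalerDr lquot_piD.
Qed.

Lemma lquot_scaleDl x : {morph lquot_scale^~ x : a b / a + b}.
Proof.
by move=> a b; rewrite -[x]lquot_piK !lquot_piZ scalerDl lquot_piD.
Qed.

HB.instance Definition _ := GRing.Zmodule_isLmodule.Build K lquot
  lquot_scaleA lquot_scale1 lquot_scaleDr lquot_scaleDl.

End Quotient.

Definition lin_indep (K : fieldType) (U : lmodType K) (d : nat) (u : 'I_d -> U) :
  Prop := forall c : 'I_d -> K, \sum_i c i *: u i = 0 -> forall i, c i = 0.

Definition dim_ge (K : fieldType) (U : lmodType K) (E : set U) (d : nat) : Prop :=
  exists2 u : 'I_d -> U, (forall i, E (u i)) & lin_indep u.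

Section Ptilde.
Variables (C : numFieldType) (G : 'M[int]_4) (eps : lattice -> lattice -> int).
Variables hp hm : 2.-tuple 'rV[C]_4.

(* P^{0,0} / ((G^+_{-1/2} V + G^-_{-1/2} V) n P^{0,0}) sits inside the quotient
   of the whole V_NS by the same subspace. *)
Definition Pquot := lquot (exactP00_submod G eps hp hm).
HB.instance Definition _ := GRing.Lmodule.on Pquot.

Definition Pproj : VNS C -> Pquot := @lquot_pi _ _ _ _.

Definition Ptilde00 : set Pquot := Pproj @` P00 G eps hp hm.

Definition Ptilde00_ (a : lattice) : set Pquot := Pproj @` P00_ G eps hp hm a.
End Ptilde.

(* Partitions of n, padded by zeros to n nonincreasing parts. *)
Definition npart (n : nat) : nat :=
  #|[set t : n.-tuple 'I_n.+1 | sorted geq [seq val i | i <- t] &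
       (\sum_(i <- t) val i == n)%N]|.

Definition part (z : int) : nat := if z is Posz n then npart n else 0%N.

(* Main.v *)
Require Import Defs.
From HB Require Import structures.
From mathcomp Require Import all_boot all_order all_algebra.
From mathcomp Require Import finmap multiset complex.
From mathcomp Require Import boolp classical_sets fsbigop reals.
From mathcomp Require Import monalg.
From mathcomp Require Import ring zify.
Set Implicit Arguments.
Unset Strict Implicit.
Unset Printing Implicit Defensive.
Import Order.TTheory GRing.Theory Num.Theory.
Local Open Scope ring_scope.

(** Put N = - (alpha, alpha) / 2. Only N >= 0 matters, and for every partition
    of N a state of P^{0,0}(alpha) is constructed; linear functionals then
    separate these states modulo the images of G^+_{-1/2} and G^-_{-1/2}.

    States. Let beta^+ = sum f_i h_i^+ and beta^- = sum g_i h_i^- with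
    sum f_i g_i = 0, (beta^+, alpha) = kap and (beta^-, alpha) = -1 - kap. All
    modes of beta^+(z), beta^-(z), b(z) = sum g_i a_i(z) and
    c(z) = sum f_i a_i^*(z) then supercommute, so that
    e(z) = exp(n sum_{k>0} (beta^+ + beta^-)(-k) z^k / k) makes sense. Let P_n be
    the coefficient of z^n in
      (n sum_{k>=0} beta^+(-k) z^k + n^2 z b(z) c(z)) e(z),
    where b(z) and c(z) stand for their creation parts. Both supercharges send
    e(z) to fermions times e(z); the bilinear term cancels this for G^+
    (Gplus_state), and for G^- what remains is a total derivative, which drops
    out because the zero modes of beta^+ and beta^- add up to -1 (Gminus_state).
    P_n raises L_0 by n and L_0 e^alpha = - N e^alpha, so the states
    v_s = P_{n_1} ... P_{n_l} e^alpha with n_1 + ... + n_l = N belong to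
    P^{0,0}(alpha) (physical_states).

    Functionals. Choose h^+ = sum r_i h_i^+ and h^- = sum s_i h_i^-, both
    orthogonal to alpha, with (h^+, h^-) = 1. A polynomial u gives a linear map
    chi from Fock space to polynomials: it kills the fermions and sends the
    variable x(-k-1) to (x, h^-) times the k-th divided derivative of u. This
    choice intertwines the modes of h^- with differentiation (chi_deriv). From
    the coefficients of chi applied to h^+(k) v and to products of modes of
    sum s_i a_i and sum r_i a_i^* applied to v one forms a functional Psi which
    vanishes on the images of both supercharges: for G^+ by telescoping
    (Psi_Gp), for G^- by the intertwining property (Psi_Gm).

    Evaluation. On v_s the functional equals, up to a nonzero factor that
    depends on s only,
      N prod_j (n_j S_{n_j})(0) + kap * (a term without kap)
    with S_n a Schur polynomial in the divided derivatives of u (psi_foldr).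
    The numbers n S_n(0) can be prescribed freely (exists_weights); with the
    i-th powers of the n-th prime for the i-th functional, the leading matrix is
    a Vandermonde matrix whose nodes are distinct by unique factorization
    (exists_independent_weights). Its determinant survives the correction for
    all but finitely many kap (exists_regular_shift), and for such a kap the
    states are independent. For N = 0 the single state e^alpha is detected by
    chi with u = 0 (dim_ge_light). *)

(** * Linear maps as functions *)

Section RawLinear.
Variables (C : numFieldType) (U V W : lmodType C).
Implicit Types (f g : U -> V) (h : V -> W).

(** The operators on Fock space are unbundled functions, so linearity is used
    through the following lemmas on functions. *)
Lemma lin0 f : linear f -> f 0 = 0.
Proof. by move=> fL; have := fL (-1) 0 0; rewrite scaler0 addr0 scaleN1r addNr. Qed.

Lemma linD f : linear f -> {morph f : u v / u + v}.
Proof. by move=> fL u v; rewrite -[u]scale1r fL !scale1r. Qed.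

Lemma linZ f : linear f -> forall c u, f (c *: u) = c *: f u.
Proof. by move=> fL c u; rewrite -[_ *: u]addr0 fL (lin0 fL) addr0. Qed.

Lemma linN f : linear f -> {morph f : u / - u}.
Proof. by move=> fL u; rewrite -scaleN1r (linZ fL) scaleN1r. Qed.

Lemma lin_sum f (I : Type) (r : seq I) (P : pred I) (F : I -> U) : linear f ->
  f (\sum_(i <- r | P i) F i) = \sum_(i <- r | P i) f (F i).
Proof. by move=> fL; apply: (big_morph f (linD fL) (lin0 fL)). Qed.

Lemma is_linear_comp h f : linear h -> linear f -> linear (fun u => h (f u)).
Proof. by move=> hL fL c u v; rewrite fL hL. Qed.

Lemma is_linear_add f g : linear f -> linear g -> linear (fun u => f u + g u).
Proof. by move=> fL gL c u v; rewrite fL gL scalerDr addrACA. Qed.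

Lemma is_linear_opp f : linear f -> linear (fun u => - f u).
Proof. by move=> fL c u v; rewrite fL opprD scalerN. Qed.

Lemma is_linear_scale c f : linear f -> linear (fun u => c *: f u).
Proof. by move=> fL a u v; rewrite fL scalerDr !scalerA mulrC. Qed.

Lemma is_linear_sum (I : Type) (r : seq I) (F : I -> U -> V) :
  (forall i, linear (F i)) -> linear (fun u => \sum_(i <- r) F i u).
Proof.
move=> FL c u v; rewrite scaler_sumr -big_split.
by apply: eq_bigr => i _; exact: FL.
Qed.
End RawLinear.

(** Commutators are bilinear: relations between elementary operators extend to
    the modes of arbitrary vectors. *)
Lemma sum_commutator (C : numFieldType) (V : lmodType C) (I : finType)
    (a c : I -> C) (z : I -> I -> C) (A B : I -> V -> V) v :
  (forall i, linear (A i)) -> (forall j, linear (B j)) ->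
  (forall i j v, A i (B j v) = B j (A i v) + z i j *: v) ->
  \sum_i a i *: A i (\sum_j c j *: B j v) =
  \sum_j c j *: B j (\sum_i a i *: A i v) + (\sum_i \sum_j a i * c j * z i j) *: v.
Proof.
move=> AL BL AB.
have -> : \sum_i a i *: A i (\sum_j c j *: B j v) = \sum_i \sum_j
    ((c j * a i) *: B j (A i v) + (a i * c j * z i j) *: v).
  apply: eq_bigr => i _; rewrite (lin_sum _ _ _ (AL i)) scaler_sumr.
  apply: eq_bigr => j _.
  by rewrite (linZ (AL i)) AB !scalerDr !scalerA [c j * a i]mulrC.
under eq_bigr => i _ do rewrite big_split /=.
rewrite big_split exchange_big; congr (_ + _).
  apply: eq_bigr => j _; rewrite (lin_sum _ _ _ (BL j)) scaler_sumr.
  by apply: eq_bigr => i _; rewrite (linZ (BL j)) !scalerA.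
by rewrite scaler_suml; apply: eq_bigr => i _; rewrite scaler_suml.
Qed.

Section MonoidAlgebra.
Variables (C : numFieldType) (K : choiceType).

Lemma malg_kets (v : {malg C[K]}) : v = \sum_(k <- msupp v) v@_k *: << k >>.
Proof.
rewrite {1}(monalgE v); apply: eq_bigr => k _.
by apply/malgP => k'; rewrite mcoeffZ !mcoeffU mulrnAr mulr1.
Qed.

Lemma sum_ket (W : lmodType C) (f : K -> W) k :
  \sum_(j <- msupp (<< k >> : {malg C[K]})) (<< k >> : {malg C[K]})@_j *: f j = f k.
Proof.
by rewrite (_ : msupp _ = [fset k]%fset) ?msuppU ?oner_eq0 // big_seq_fset1 mcoeffUU scale1r.
Qed.

Lemma eq_on_kets (W : lmodType C) (f g : {malg C[K]} -> W) :
  linear f -> linear g -> (forall k, f << k >> = g << k >>) -> f =1 g.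
Proof.
move=> fL gL fg v; rewrite (malg_kets v) !lin_sum //; apply: eq_bigr => k _.
by rewrite (linZ fL) (linZ gL) fg.
Qed.
End MonoidAlgebra.

(** * Elementary creation and annihilation operators *)

(** Locked, because unification would otherwise compare basis vectors by
    unfolding them to finitely supported functions; the same holds for the
    elementary operators below. *)
HB.lock Definition ket (C : numFieldType) (l : lattice) (m : {mset bmode}%mset) (D : {fset fmode}) :
  VNS C := << (l, m, D) >>.
Arguments ket {C}.

Section KetExtension.
Variable C : numFieldType.
Local Notation V := (VNS C).

Lemma lext_ket (f : fock -> V) l m D : lext f (ket l m D) = f (l, m, D).
Proof. by rewrite unlock; exact: sum_ket. Qed.

Lemma eq_on_ket (W : lmodType C) (f g : V -> W) : linear f -> linear g ->
  (forall l m D, f (ket l m D) = g (ket l m D)) -> f =1 g.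
Proof.
move=> fL gL fg; apply: eq_on_kets => // -[[l m] D].
by have := fg l m D; rewrite unlock.
Qed.

End KetExtension.

(** The elementary operators: multiplication by a bosonic variable (upB), the
    derivation dual to it (dnB), wedge product with a fermionic generator (upF)
    and contraction with it (dnF). All modes but the x(0) are combinations of
    them, and their relations are checked on basis vectors. *)
HB.lock Definition upB (C : numFieldType) (a : bmode) :
    VNS C -> VNS C :=
  lext (fun k => let: (l, m, D) := k in
    ket l (msetD (msetn 1 a) m) D).
Arguments upB {C}.
Lemma upB_linear (C : numFieldType) (a : bmode) :
  linear (@upB C a).
Proof. by rewrite unlock; exact: lext_linear. Qed.

HB.lock Definition dnB (C : numFieldType) (a : bmode) :
    VNS C -> VNS C :=
  lext (fun k => let: (l, m, D) := k in
    (m a)%:R *: ket l (msetB m (msetn 1 a)) D).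
Arguments dnB {C}.
Lemma dnB_linear (C : numFieldType) (a : bmode) :
  linear (@dnB C a).
Proof. by rewrite unlock; exact: lext_linear. Qed.

HB.lock Definition upF (C : numFieldType) (s : fmode) :
    VNS C -> VNS C :=
  lext (fun k => let: (l, m, D) := k in
    if s \in D then 0 else wedge_sign C s D *: ket l m (s |` D)%fset).
Arguments upF {C}.
Lemma upF_linear (C : numFieldType) (a : fmode) :
  linear (@upF C a).
Proof. by rewrite unlock; exact: lext_linear. Qed.

HB.lock Definition dnF (C : numFieldType) (s : fmode) :
    VNS C -> VNS C :=
  lext (fun k => let: (l, m, D) := k in
    if s \in D then wedge_sign C s D *: ket l m (D `\ s)%fset else 0).
Arguments dnF {C}.
Lemma dnF_linear (C : numFieldType) (a : fmode) :
  linear (@dnF C a).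
Proof. by rewrite unlock; exact: lext_linear. Qed.

Section Oscillators.
Variable C : numFieldType.
Local Notation V := (VNS C).
Implicit Types (a b : bmode) (s t : fmode) (v w : V).

Lemma upB_ket a l m D : upB a (ket l m D : V) = ket l (msetD (msetn 1 a) m) D.
Proof. by rewrite unlock lext_ket. Qed.

Lemma dnB_ket a l m D :
  dnB a (ket l m D : V) = (m a)%:R *: ket l (msetB m (msetn 1 a)) D.
Proof. by rewrite unlock lext_ket. Qed.

Lemma upF_ket s l m D : upF s (ket l m D : V) =
  if s \in D then 0 else wedge_sign C s D *: ket l m (s |` D)%fset.
Proof. by rewrite unlock lext_ket. Qed.

Lemma dnF_ket s l m D : dnF s (ket l m D : V) =
  if s \in D then wedge_sign C s D *: ket l m (D `\ s)%fset else 0.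
Proof. by rewrite unlock lext_ket. Qed.

Let upBL := @upB_linear C.
Let dnBL := @dnB_linear C.
Let upFL := @upF_linear C.
Let dnFL := @dnF_linear C.

Let linE := (fun a => linZ (upBL a), fun a => linZ (dnBL a),
  fun s => linZ (upFL s), fun s => linZ (dnFL s)).
Let lin0E := (fun a => lin0 (upBL a), fun a => lin0 (dnBL a),
  fun s => lin0 (upFL s), fun s => lin0 (dnFL s)).

Let eq_scale (x y : C) v : x = y -> x *: v = y *: v.
Proof. by move=> ->. Qed.

Lemma upB_upB a b v : upB a (upB b v) = upB b (upB a v).
Proof.
move: v; apply: eq_on_ket; [exact: is_linear_comp|exact: is_linear_comp|] => l m D.
by rewrite !upB_ket msetDCA.
Qed.

Lemma dnB_dnB a b v : dnB a (dnB b v) = dnB b (dnB a v).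
Proof.
move: v; apply: eq_on_ket; [exact: is_linear_comp|exact: is_linear_comp|] => l m D.
rewrite !dnB_ket !linE !dnB_ket !scalerA !msetB1E.
have -> : (m `\ b `\ a = m `\ a `\ b)%mset.
  by apply/msetP => c; rewrite !msetB1E subnAC.
rewrite -!natrM.
have -> : (m b * (m a - (a == b)) = m a * (m b - (b == a)))%N.
  by rewrite eq_sym; case: eqVneq => [->|]; rewrite ?subn0 1?mulnC.
by [].
Qed.

Lemma dnB_upB a b v : dnB a (upB b v) = upB b (dnB a v) + (a == b)%:R *: v.
Proof.
move: v; apply: eq_on_ket; first exact: is_linear_comp.
  by apply: is_linear_add; [exact: is_linear_comp|exact: is_linear_scale].
move=> l m D; rewrite upB_ket !dnB_ket linE upB_ket mset1DE.
case: eqVneq => [->|ab] /=; last first.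
  rewrite scale0r addr0 add0n; have [->|m0] := eqVneq (m a) 0%N.
    by rewrite !scale0r.
  congr (_ *: ket _ _ _); apply/msetP => c.
  rewrite !(msetB1E, mset1DE).
  have [->|cb] := eqVneq c b; last by rewrite !add0n.
  by rewrite eq_sym (negPf ab) !subn0.
have <- : (m b)%:R *: ket l m D = (m b)%:R *: ket l (b +` (m `\ b))%mset D :> V.
  have [->|m0] := eqVneq (m b) 0%N; first by rewrite !scale0r.
  congr (_ *: ket _ _ _); apply/msetP => c; rewrite mset1DE msetB1E.
  have [->|cb] := eqVneq c b; last by rewrite add0n subn0.
  by rewrite subnKC // lt0n.
have -> : ((b +` m) `\ b = m)%mset.
  by apply/msetP => c; rewrite msetB1E mset1DE addKn.
by rewrite add1n -natr1 scalerDl.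
Qed.

Lemma upB_upF a s v : upB a (upF s v) = upF s (upB a v).
Proof.
move: v; apply: eq_on_ket; [exact: is_linear_comp|exact: is_linear_comp|] => l m D.
rewrite upB_ket !upF_ket; have [_|_] := boolP (s \in D); first by rewrite lin0E.
by rewrite linE upB_ket.
Qed.

Lemma upB_dnF a s v : upB a (dnF s v) = dnF s (upB a v).
Proof.
move: v; apply: eq_on_ket; [exact: is_linear_comp|exact: is_linear_comp|] => l m D.
rewrite upB_ket !dnF_ket; have [_|_] := boolP (s \in D); last by rewrite lin0E.
by rewrite linE upB_ket.
Qed.

Lemma dnB_upF a s v : dnB a (upF s v) = upF s (dnB a v).
Proof.
move: v; apply: eq_on_ket; [exact: is_linear_comp|exact: is_linear_comp|] => l m D.
rewrite dnB_ket linE !upF_ket; have [_|_] := boolP (s \in D); first by rewrite lin0E scaler0.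
by rewrite linE dnB_ket !scalerA mulrC.
Qed.

Lemma dnB_dnF a s v : dnB a (dnF s v) = dnF s (dnB a v).
Proof.
move: v; apply: eq_on_ket; [exact: is_linear_comp|exact: is_linear_comp|] => l m D.
rewrite dnB_ket linE !dnF_ket; have [_|_] := boolP (s \in D); last by rewrite lin0E scaler0.
by rewrite linE dnB_ket !scalerA mulrC.
Qed.

Lemma wedge_signU s t (D : {fset fmode}) : t \notin D ->
  wedge_sign C s (t |` D)%fset = (-1) ^+ (t < s)%O * wedge_sign C s D.
Proof.
move=> tD; rewrite /wedge_sign -exprD; congr (_ ^+ _).
have /permP -> : perm_eq (enum_fset (t |` D)%fset) (t :: enum_fset D).
  apply: uniq_perm; rewrite ?fset_uniq //= ?tD ?fset_uniq //.
  by move=> x; rewrite in_fset1U inE.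
by [].
Qed.

Lemma wedge_signD s t (D : {fset fmode}) : t \in D ->
  wedge_sign C s (D `\ t)%fset = (-1) ^+ (t < s)%O * wedge_sign C s D.
Proof.
move=> tD; rewrite -{2}(fsetD1K tD) wedge_signU ?in_fsetD1 ?eqxx //.
by rewrite mulrA -expr2 sqrr_sign mul1r.
Qed.

Lemma wedge_sign_sq s (D : {fset fmode}) : wedge_sign C s D * wedge_sign C s D = 1.
Proof. by rewrite -expr2 sqrr_sign. Qed.

Lemma sign_lt_sym s t : s != t ->
  (-1) ^+ (t < s)%O = - (-1) ^+ (s < t)%O :> C.
Proof.
by rewrite neq_lt => /orP[] st; rewrite st lt_gtF //= opprK.
Qed.

Lemma upF_upF s t v : upF s (upF t v) = - upF t (upF s v).
Proof.
move: v; apply: eq_on_ket; first exact: is_linear_comp.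
  by apply: is_linear_opp; exact: is_linear_comp.
move=> l m D; rewrite !upF_ket.
have [sD|sD] := boolP (s \in D); have [tD|tD] := boolP (t \in D).
- by rewrite !lin0E oppr0.
- by rewrite lin0E linE upF_ket in_fset1U sD orbT scaler0 oppr0.
- by rewrite lin0E linE upF_ket in_fset1U tD orbT scaler0 oppr0.
rewrite !linE !upF_ket !in_fset1U (negPf sD) (negPf tD) !orbF eq_sym.
case: eqVneq => [|ts]; first by rewrite !scaler0 oppr0.
rewrite !wedge_signU // !scalerA -scaleNr fsetUCA.
rewrite (sign_lt_sym ts).
by apply: eq_scale; rewrite mulNr !mulrN opprK mulrCA [RHS]mulrCA; congr (_ * _); exact: mulrC.
Qed.

Lemma dnF_dnF s t v : dnF s (dnF t v) = - dnF t (dnF s v).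
Proof.
move: v; apply: eq_on_ket; first exact: is_linear_comp.
  by apply: is_linear_opp; exact: is_linear_comp.
move=> l m D; rewrite !dnF_ket.
have [sD|sD] := boolP (s \in D); have [tD|tD] := boolP (t \in D).
- rewrite !linE !dnF_ket !in_fsetD1 sD tD !andbT eq_sym.
  case: eqVneq => [|ts]; first by rewrite !scaler0 oppr0.
  rewrite !wedge_signD // !scalerA -scaleNr.
  rewrite (sign_lt_sym ts).
  have -> : (D `\ t `\ s = D `\ s `\ t)%fset by rewrite !fsetDDl fsetUC.
  by apply: eq_scale; rewrite mulNr !mulrN opprK mulrCA [RHS]mulrCA; congr (_ * _); exact: mulrC.
- by rewrite lin0E linE dnF_ket in_fsetD1 (negPf tD) andbF scaler0 oppr0.
- by rewrite lin0E linE dnF_ket in_fsetD1 (negPf sD) andbF scaler0 oppr0.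
- by rewrite !lin0E oppr0.
Qed.

Lemma dnF_upF s t v : dnF s (upF t v) = - upF t (dnF s v) + (s == t)%:R *: v.
Proof.
move: v; apply: eq_on_ket; first exact: is_linear_comp.
  apply: is_linear_add; last exact: is_linear_scale.
  by apply: is_linear_opp; exact: is_linear_comp.
move=> l m D; rewrite upF_ket dnF_ket; have [<-|st] := eqVneq s t.
  rewrite scale1r; have [sD|sD] := boolP (s \in D).
    rewrite linE upF_ket in_fsetD1 eqxx /= lin0E fsetD1K //.
    by rewrite wedge_signD // ltxx mul1r scalerA wedge_sign_sq scale1r addNr.
  rewrite lin0E oppr0 add0r linE dnF_ket in_fset1U eqxx /=.
  by rewrite wedge_signU // ltxx mul1r scalerA wedge_sign_sq scale1r fsetU1K.
rewrite scale0r addr0.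
have [sD|sD] := boolP (s \in D); have [tD|tD] := boolP (t \in D).
- by rewrite lin0E linE upF_ket in_fsetD1 tD eq_sym st /= scaler0 oppr0.
- rewrite !linE upF_ket dnF_ket in_fsetD1 in_fset1U sD (negPf tD) orbT andbF.
  rewrite wedge_signD // wedge_signU // !scalerA -scaleNr.
  rewrite (sign_lt_sym st).
  have -> : ((t |` D) `\ s = t |` (D `\ s))%fset.
    apply/fsetP => x; rewrite !(in_fsetD1, in_fset1U).
    by case: (eqVneq x t) => [->|] //=; rewrite eq_sym st.
  by apply: eq_scale; move: ((-1) ^+ _) (wedge_sign _ s D) (wedge_sign _ t D) => x y z; ring.
- by rewrite !lin0E oppr0.
- by rewrite lin0E oppr0 linE dnF_ket in_fset1U (negPf st) (negPf sD) scaler0.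
Qed.
End Oscillators.

(** * Bosonic and fermionic modes *)

Section Modes.
Variables (C : numFieldType) (G : 'M[int]_4).
Local Notation V := (VNS C).
Local Notation bos := (@bos C G).
Local Notation ferm := (@ferm C).
Implicit Types (v w : V) (x y : 'rV[C]_4).

Lemma bos_linear x n : linear (bos x n).
Proof. exact: lext_linear. Qed.

Lemma ferm_linear b i n : linear (ferm b i n).
Proof. exact: lext_linear. Qed.

Lemma bos_neg x p v : bos x (Negz p) v = \sum_i x 0 i *: upB (i, p) v.
Proof.
move: v; apply: eq_on_ket; first exact: bos_linear.
  by apply: is_linear_sum => i; apply: is_linear_scale; exact: upB_linear.
move=> l m D; rewrite [LHS]lext_ket.
by apply: eq_bigr => i _; rewrite upB_ket unlock.
Qed.

Lemma bos_pos x p v : bos x (Posz p.+1) v =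
  \sum_i (p.+1%:R * hform G x (hbase C i)) *: dnB (i, p) v.
Proof.
move: v; apply: eq_on_ket; first exact: bos_linear.
  by apply: is_linear_sum => i; apply: is_linear_scale; exact: dnB_linear.
move=> l m D; rewrite [LHS]lext_ket.
by apply: eq_bigr => i _; rewrite dnB_ket scalerA unlock.
Qed.

Lemma bos_zero x l m D :
  bos x 0 (ket l m D) = hform G x (hlat C l) *: ket l m D.
Proof. by rewrite /Defs.bos lext_ket ket.unlock. Qed.

Lemma ferm_neg b i p v : ferm b i (Negz p) v = upF (b, i, p) v.
Proof.
move: v; apply: eq_on_ket; [exact: ferm_linear|exact: upF_linear|] => l m D.
by rewrite /Defs.ferm lext_ket upF_ket ket.unlock.
Qed.

Lemma ferm_pos b i p v : ferm b i (Posz p) v = dnF (~~ b, i, p) v.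
Proof.
move: v; apply: eq_on_ket; [exact: ferm_linear|exact: dnF_linear|] => l m D.
by rewrite /Defs.ferm lext_ket dnF_ket ket.unlock.
Qed.

Lemma hformE (K : pzRingType) (x y : 'rV[K]_4) :
  hform G x y = \sum_i \sum_j x 0 i * (G i j)%:~R * y 0 j.
Proof.
rewrite /hform mxE exchange_big; apply: eq_bigr => j _; rewrite mxE mulr_suml.
by apply: eq_bigr => i _; rewrite !mxE.
Qed.

Lemma hform_base x y : hform G x y = \sum_i hform G x (hbase C i) * y 0 i.
Proof.
rewrite hformE exchange_big; apply: eq_bigr => j _; rewrite hformE mulr_suml.
apply: eq_bigr => i _; rewrite (bigD1 j) //= big1 ?addr0 ?mxE ?eqxx ?mulr1 //.
by move=> k kj; rewrite mxE eqxx (negPf kj) mulr0.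
Qed.

Lemma hform_sym : G^T = G -> forall (K : comPzRingType) (x y : 'rV[K]_4),
  hform G x y = hform G y x.
Proof.
move=> GT K x y; rewrite !hformE exchange_big; apply: eq_bigr => i _.
apply: eq_bigr => j _; have -> : G j i = G i j by rewrite -[in LHS]GT mxE.
by rewrite mulrC [x 0 j * _]mulrC mulrA.
Qed.

Lemma bos_pos_neg x y p q v : bos x (Posz p.+1) (bos y (Negz q) v) =
  bos y (Negz q) (bos x (Posz p.+1) v) +
  ((p == q)%:R * p.+1%:R * hform G x y) *: v.
Proof.
rewrite (bos_neg y q v) (bos_pos x p v) (bos_neg y q _) (bos_pos x p _).
have -> : (p == q)%:R * p.+1%:R * hform G x y = \sum_i \sum_j
    p.+1%:R * hform G x (hbase C i) * y 0 j * ((i, p) == (j, q))%:R.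
  rewrite hform_base mulr_sumr; apply: eq_bigr => i _.
  rewrite (bigD1 i) //= big1 => [|j ji]; last first.
    by rewrite xpair_eqE eq_sym (negPf ji) mulr0.
  rewrite xpair_eqE eqxx andTb addr0; move: (_ == _)%:R => d; ring.
exact: (sum_commutator _ _ v (fun i => @dnB_linear C (i, p))
  (fun j => @upB_linear C (j, q)) (fun i j => dnB_upB (i, p) (j, q))).
Qed.

(** x(0) acts by a scalar that depends on the lattice component only, so it
    commutes with every operator that preserves this component. *)
Lemma bos0_comm (f : V -> V) x : linear f ->
  (forall l m D, exists c m' D', f (ket l m D) = c *: ket l m' D') ->
  forall v, bos x 0 (f v) = f (bos x 0 v).
Proof.
move=> fL fr; apply: eq_on_ket.
- by apply: is_linear_comp => //; exact: bos_linear.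
- by apply: is_linear_comp => //; exact: bos_linear.
move=> l m D; rewrite bos_zero (linZ fL); have [c [m' [D' ->]]] := fr l m D.
by rewrite (linZ (bos_linear _ _)) bos_zero !scalerA mulrC.
Qed.

Lemma bos0_upB x a v : bos x 0 (upB a v) = upB a (bos x 0 v).
Proof.
apply: bos0_comm => [|l m D]; first exact: upB_linear.
by exists 1; do 2 eexists; rewrite upB_ket scale1r.
Qed.

Lemma bos0_dnB x a v : bos x 0 (dnB a v) = dnB a (bos x 0 v).
Proof.
apply: bos0_comm => [|l m D]; first exact: dnB_linear.
by do 3 eexists; exact: dnB_ket.
Qed.

Lemma bos0_upF x s v : bos x 0 (upF s v) = upF s (bos x 0 v).
Proof.
apply: bos0_comm => [|l m D]; first exact: upF_linear.
rewrite upF_ket; have [_|_] := boolP (s \in D); last by do 3 eexists.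
by exists 0, m, D; rewrite scale0r.
Qed.

Lemma bos0_dnF x s v : bos x 0 (dnF s v) = dnF s (bos x 0 v).
Proof.
apply: bos0_comm => [|l m D]; first exact: dnF_linear.
rewrite dnF_ket; have [_|_] := boolP (s \in D); first by do 3 eexists.
by exists 0, m, D; rewrite scale0r.
Qed.

Lemma sum_comm (I : finType) (c : I -> C) (A : I -> V -> V) (f : V -> V) v :
  linear f -> (forall i v, A i (f v) = f (A i v)) ->
  \sum_i c i *: A i (f v) = f (\sum_i c i *: A i v).
Proof.
move=> fL Af; rewrite (lin_sum _ _ _ fL).
by apply: eq_bigr => i _; rewrite Af (linZ fL).
Qed.

Lemma bos0_bos x y n v : bos x 0 (bos y n v) = bos y n (bos x 0 v).
Proof.
case: n => [[|p]|p].
- move: v; apply: eq_on_ket => [||l m D].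
  + by apply: is_linear_comp; exact: bos_linear.
  + by apply: is_linear_comp; exact: bos_linear.
  + rewrite !bos_zero !(linZ (bos_linear _ _)) !bos_zero !scalerA.
    by rewrite mulrC.
- rewrite (bos_pos y p v) (bos_pos y p _); symmetry.
  by apply: (@sum_comm _ _ (fun i => dnB (i, p)) (bos x 0)) => [|i w];
    [exact: bos_linear|rewrite bos0_dnB].
- rewrite (bos_neg y p v) (bos_neg y p _); symmetry.
  by apply: (@sum_comm _ _ (fun i => upB (i, p)) (bos x 0)) => [|i w];
    [exact: bos_linear|rewrite bos0_upB].
Qed.

Lemma sum_comm0 (a c : 'I_4 -> C) (A B : 'I_4 -> V -> V) v :
  (forall i, linear (A i)) -> (forall j, linear (B j)) ->
  (forall i j v, A i (B j v) = B j (A i v)) ->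
  \sum_i a i *: A i (\sum_j c j *: B j v) =
  \sum_j c j *: B j (\sum_i a i *: A i v).
Proof.
move=> AL BL AB.
have AB0 i j w : A i (B j w) = B j (A i w) + 0 *: w.
  by rewrite AB scale0r addr0.
have := sum_commutator a c v AL BL AB0.
rewrite [X in _ + X *: _]big1 ?scale0r ?addr0 // => i _.
by apply: big1 => j _; rewrite mulr0.
Qed.

Lemma bos_bos : G^T = G -> forall x y n m v, bos x n (bos y m v) =
  bos y m (bos x n v) + ((m == - n)%:R * n%:~R * hform G x y) *: v.
Proof.
move=> GT x y [[|p]|p] [[|q]|q] v; rewrite ?oppr0.
- by rewrite bos0_bos mulr0 mul0r scale0r addr0.
- by rewrite bos0_bos mulr0 mul0r scale0r addr0.
- by rewrite bos0_bos mulr0 mul0r scale0r addr0.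
- by rewrite bos0_bos (_ : _ == _ = false) // !mul0r scale0r addr0.
- rewrite (_ : _ == _ = false) // !mul0r scale0r addr0.
  rewrite (bos_pos x p v) (bos_pos y q v) (bos_pos x p _) (bos_pos y q _).
  by apply: (@sum_comm0 _ _ (fun i => dnB (i, p)) (fun i => dnB (i, q))) => [i|i|i j w];
    [exact: dnB_linear|exact: dnB_linear|exact: dnB_dnB].
- rewrite (_ : (_ == _) = (p == q)); first exact: bos_pos_neg.
  by apply/eqP/eqP => [[]|->].
- by rewrite bos0_bos (_ : _ == _ = false) // !mul0r scale0r addr0.
- rewrite (bos_pos_neg y x q p v) -addrA -scalerDl.
  rewrite (_ : (_ == _) = (q == p)); last by apply/eqP/eqP => [[]|->].
  rewrite (hform_sym GT x y) NegzE mulrNz pmulrn mulrN mulNr.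
  case: eqP => [->|_]; first by rewrite addrN scale0r addr0.
  by rewrite !mul0r oppr0 addr0 scale0r addr0.
- rewrite (_ : _ == _ = false) // !mul0r scale0r addr0.
  rewrite (bos_neg x p v) (bos_neg y q v) (bos_neg x p _) (bos_neg y q _).
  by apply: (@sum_comm0 _ _ (fun i => upB (i, p)) (fun i => upB (i, q))) => [i|i|i j w];
    [exact: upB_linear|exact: upB_linear|exact: upB_upB].
Qed.

Lemma bos_ferm x n b i m v : bos x n (ferm b i m v) = ferm b i m (bos x n v).
Proof.
case: m => m; rewrite ?ferm_pos ?ferm_neg; case: n => [[|p]|p].
- by rewrite bos0_dnF.
- rewrite (bos_pos x p v) (bos_pos x p _).
  by apply: (@sum_comm _ _ (fun j => dnB (j, p)) (dnF (~~ b, i, m))) => [|j w];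
    [exact: dnF_linear|exact: dnB_dnF].
- rewrite (bos_neg x p v) (bos_neg x p _).
  by apply: (@sum_comm _ _ (fun j => upB (j, p)) (dnF (~~ b, i, m))) => [|j w];
    [exact: dnF_linear|exact: upB_dnF].
- by rewrite bos0_upF.
- rewrite (bos_pos x p v) (bos_pos x p _).
  by apply: (@sum_comm _ _ (fun j => dnB (j, p)) (upF (b, i, m))) => [|j w];
    [exact: upF_linear|exact: dnB_upF].
- rewrite (bos_neg x p v) (bos_neg x p _).
  by apply: (@sum_comm _ _ (fun j => upB (j, p)) (upF (b, i, m))) => [|j w];
    [exact: upF_linear|exact: upB_upF].
Qed.

Lemma ferm_ferm b i n b' j m v : ferm b i n (ferm b' j m v) =
  - ferm b' j m (ferm b i n v) +
  [&& b' == ~~ b, i == j & m == - 1 - n]%:R *: v.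
Proof.
have [p np] : exists p, n = Posz p \/ n = Negz p by case: n => p; exists p; [left|right].
have [q mq] : exists q, m = Posz q \/ m = Negz q by case: m => q; exists q; [left|right].
case: np => ->; case: mq => ->; rewrite ?(ferm_pos, ferm_neg).
- rewrite (_ : (Posz q == - 1 - Posz p) = false); last by lia.
  by rewrite dnF_dnF !andbF scale0r addr0.
- have := dnF_upF (~~ b, i, p) (b', j, q) v.
  have -> : ((~~ b, i, p) == (b', j, q) :> fmode) =
      [&& b' == ~~ b, i == j & Negz q == - 1 - Posz p]; last by [].
  have -> : (Negz q == - 1 - Posz p) = (p == q) by lia.
  by apply/eqP/and3P => [[<- <- <-]|[/eqP-> /eqP-> /eqP->]].
- have := dnF_upF (~~ b', j, q) (b, i, p) v.
  have -> : ((~~ b', j, q) == (b, i, p) :> fmode) =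
      [&& b' == ~~ b, i == j & Posz q == - 1 - Negz p].
    have -> : (Posz q == - 1 - Negz p) = (q == p) by lia.
    by apply/eqP/and3P => [[<- <- <-]|[/eqP-> /eqP-> /eqP->]]; rewrite negbK.
  by move=> ->; rewrite opprD opprK -addrA addNr addr0.
- rewrite (_ : (Negz q == - 1 - Negz p) = false); last by lia.
  by rewrite upF_upF !andbF scale0r addr0.
Qed.
End Modes.

(** * Truncated normally ordered products *)

Section ModeSums.
Variables (C : numFieldType) (V : lmodType C).
Implicit Types (A B : int -> V -> V) (X : V -> V) (F : int -> V) (v w : V).

(** The normally ordered product with each of its two sums cut after K terms;
    on a given vector it is the whole product as soon as K is large. *)
Definition modesum (sg : bool) A B (n : int) (K : nat) v : V :=
  \sum_(0 <= j < K) A (Negz j) (B (n + j%:Z) v) +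
  (-1) ^+ sg *: \sum_(0 <= j < K) B (n - j%:Z - 1) (A j%:Z v).

Lemma sum_pick_nat (F : nat -> V) a K : (a < K)%N ->
  \sum_(0 <= j < K) (j == a)%:R *: F j = F a.
Proof.
move=> aK; rewrite (bigD1_seq a) ?mem_index_iota ?iota_uniq //= eqxx scale1r.
by rewrite big1 ?addr0 // => j /negPf ->; rewrite scale0r.
Qed.

(** A contraction occurs at a single integer index, and the two sums of a
    normally ordered product run over the negative and the nonnegative
    integers. *)
Lemma sum_pick_int F q K : (`|q| < K)%N ->
  \sum_(0 <= j < K) (Negz j == q)%:R *: F (Negz j) +
  \sum_(0 <= j < K) (Posz j == q)%:R *: F (Posz j) = F q.
Proof.
case: q => q qK.
  rewrite big1 ?add0r => [|j _]; last by rewrite scale0r.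
  exact: (sum_pick_nat (fun j => F (Posz j))).
rewrite [X in _ + X]big1 ?addr0 => [|j _]; last by rewrite scale0r.
by apply: (sum_pick_nat (fun j => F (Negz j))); lia.
Qed.

Lemma modesum_linear sg A B n K : (forall p, linear (A p)) ->
  (forall p, linear (B p)) -> linear (modesum sg A B n K).
Proof.
move=> AL BL; apply: is_linear_add; last apply: is_linear_scale.
  by apply: is_linear_sum => j; exact: is_linear_comp.
by apply: is_linear_sum => j; exact: is_linear_comp.
Qed.

(** Moving X through A and B leaves one contraction with each of them, which
    falls in the first or in the second sum according to the sign of its index.
    The last alternatives say that a contraction vanishes or carries the same
    sign in both sums, so that one formula covers all indices. *)
Lemma modesum_comm (sg : bool) A B X n K (sA sB ca cb : C) (pa pb : int) w :
  (forall p, linear (A p)) -> (forall p, linear (B p)) -> linear X ->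
  (forall p v, A p (X v) = sA *: X (A p v) + ((p == pa)%:R * ca) *: v) ->
  (forall p v, B p (X v) = sB *: X (B p v) + ((p == pb)%:R * cb) *: v) ->
  cb = 0 \/ (-1) ^+ sg * sA = 1 -> ca = 0 \/ sB = (-1) ^+ sg ->
  (`|n| + `|pa| + `|pb| + 1 < K)%N ->
  modesum sg A B n K (X w) = (sA * sB) *: X (modesum sg A B n K w) +
    cb *: A (n - 1 - pb) w + ((-1) ^+ sg * ca) *: B (n - 1 - pa) w.
Proof.
move=> AL BL XL AX BX hcb hca nK; rewrite /modesum.
pose e : C := (-1) ^+ sg.
have e1 j : A (Negz j) (B (n + j%:Z) (X w)) =
    (sA * sB) *: X (A (Negz j) (B (n + j%:Z) w)) +
    ((Negz j == pa)%:R *: (sB * ca *: B (n - 1 - Negz j) w) +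
     (Negz j == n - 1 - pb)%:R *: (cb *: A (Negz j) w)).
  rewrite BX (linD (AL _)) !(linZ (AL _)) AX scalerDr !scalerA -addrA.
  rewrite (mulrC sB sA) (_ : n - 1 - Negz j = n + j%:Z); last by lia.
  rewrite (_ : (n + j%:Z == pb) = (Negz j == n - 1 - pb)); last by lia.
  by congr (_ + (_ *: _ + _)); rewrite mulrCA.
have e2 j : e *: B (n - j%:Z - 1) (A j%:Z (X w)) =
    (sA * sB) *: (e *: X (B (n - j%:Z - 1) (A j%:Z w))) +
    ((Posz j == pa)%:R *: (e * ca *: B (n - 1 - j%:Z) w) +
     (Posz j == n - 1 - pb)%:R *: (e * sA * cb *: A j%:Z w)).
  rewrite AX (linD (BL _)) !(linZ (BL _)) BX scalerDr !scalerDr !scalerA -addrA.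
  rewrite (_ : n - 1 - j%:Z = n - j%:Z - 1); last by lia.
  rewrite (_ : (n - j%:Z - 1 == pb) = (Posz j == n - 1 - pb)); last by lia.
  rewrite -addrA [X in _ + X = _]addrC.
  by congr (_ *: _ + (_ *: _ + _ *: _)); ring.
rewrite scaler_sumr (eq_bigr _ (fun j _ => e1 j)) (eq_bigr _ (fun j _ => e2 j)).
rewrite !big_split /= (linD XL) (linZ XL) !(lin_sum _ _ _ XL).
rewrite scalerDr !scaler_sumr -/e -[RHS]addrA.
have reorder (a b c a' b' c' : V) :
    a + (b + c) + (a' + (b' + c')) = a + a' + (c + c' + (b + b')).
  by rewrite addrACA; congr (_ + _); rewrite addrACA addrC.
rewrite {}reorder; congr (_ + _).
have -> : \sum_(0 <= j < K) (Posz j == n - 1 - pb)%:R *: (e * sA * cb *: A j w) =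
    \sum_(0 <= j < K) (Posz j == n - 1 - pb)%:R *: (cb *: A j w).
  by case: hcb => [->|esA]; rewrite ?mulr0 // /e esA mul1r.
have -> : \sum_(0 <= j < K) (Negz j == pa)%:R *: (sB * ca *: B (n - 1 - Negz j) w) =
    \sum_(0 <= j < K) (Negz j == pa)%:R *: (e * ca *: B (n - 1 - Negz j) w).
  by case: hca => ->; rewrite ?mulr0.
congr (_ + _).
  by apply: (sum_pick_int (fun q => cb *: A q w)); lia.
by apply: (sum_pick_int (fun q => e * ca *: B (n - 1 - q) w)); lia.
Qed.
End ModeSums.

Section NormalOrder.
Variables (C : numFieldType) (G : 'M[int]_4).
Local Notation V := (VNS C).
Local Notation bos := (@bos C G).
Local Notation ferm := (@ferm C).
Implicit Types (v w : V) (A B : int -> V -> V).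

Definition truncated A := forall v, exists K, forall n : nat, (K <= n)%N -> A n v = 0.

Lemma ket_span (P : V -> Prop) : P 0 ->
  (forall c l m D v, P v -> P (c *: ket l m D + v)) -> forall v, P v.
Proof.
move=> P0 PD v; rewrite (malg_kets v); elim: (enum_fset _) => [|[[l m] D] r IH].
  by rewrite big_nil.
by rewrite big_cons; have := PD v@_(l, m, D) l m D _ IH; rewrite ket.unlock.
Qed.

Lemma truncated_ket A : (forall n, linear (A n)) ->
  (forall l m D, exists K, forall n : nat, (K <= n)%N -> A n (ket l m D) = 0) ->
  truncated A.
Proof.
move=> AL Ak; apply: ket_span => [|c l m D v [K vK]].
  by exists 0%N => n _; rewrite (lin0 (AL _)).
have [K' kK'] := Ak l m D; exists (maxn K K') => n; rewrite geq_max => /andP[Kn Kn'].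
by rewrite (linD (AL _)) (linZ (AL _)) kK' // vK // scaler0 addr0.
Qed.

Lemma bos_truncated x : truncated (bos x).
Proof.
apply: truncated_ket => [n|l m D]; first exact: bos_linear.
exists (\max_(a <- enum_fset (finsupp m)) a.2.+2).+1%N => -[//|p] mp.
rewrite bos_pos big1 // => i _; rewrite dnB_ket.
suff -> : m (i, p) = 0%N by rewrite scale0r scaler0.
apply/eqP; rewrite mset_eq0 -msuppE; apply/negP => ipm.
have := @leq_bigmax_seq _ (enum_fset (finsupp m)) (fun=> true) (fun a : bmode => a.2.+2) (i, p) ipm isT.
by move=> h; have := leq_ltn_trans h mp => /=; lia.
Qed.

Lemma ferm_truncated b i : truncated (ferm b i).
Proof.
apply: truncated_ket => [n|l m D]; first exact: ferm_linear.
exists (\max_(s <- enum_fset D) s.2.+1)%N => p mp.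
rewrite (ferm_pos b i p) dnF_ket; have [sD|//] := boolP (_ \in D).
have := @leq_bigmax_seq _ (enum_fset D) (fun=> true) (fun s : fmode => s.2.+1) _ sD isT.
by move=> h; have := leq_trans h mp => /=; lia.
Qed.

Lemma fsbig_nat (F : nat -> V) K : (forall j, (K <= j)%N -> F j = 0) ->
  \sum_(j \in [set: nat]%classic) F j = \sum_(0 <= j < K) F j.
Proof.
move=> FK; rewrite (@fsbigTE _ _ _ _ [fset j in index_iota 0 K]%fset).
  apply: perm_big; apply: uniq_perm; rewrite ?fset_uniq ?iota_uniq //.
  by move=> j; rewrite inE.
by move=> j; rewrite inE mem_index_iota /= -leqNgt; exact: FK.
Qed.

Lemma nop_linear sg A B n : linear (nop sg A B n).
Proof. exact: lext_linear. Qed.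

(** The infinite sums in a normally ordered product are finite on each basis
    vector; a vector involves finitely many basis vectors, hence a common
    bound. *)
Lemma nopE sg A B n v : (forall p, linear (A p)) -> (forall p, linear (B p)) ->
  truncated A -> truncated B ->
  exists K0, forall K, (K0 <= K)%N -> nop sg A B n v = modesum sg A B n K v.
Proof.
move=> AL BL At Bt; move: v; apply: ket_span => [|c l m D v [K0 vK]].
  exists 0%N => K _; rewrite (lin0 (nop_linear _ _ _ _)).
  by rewrite (lin0 (modesum_linear sg n K AL BL)).
have [K1 AK] := At (ket l m D); have [K2 BK] := Bt (ket l m D).
exists (maxn K0 (K1 + (K2 + `|n|))) => K; rewrite geq_max => /andP[K0K KK].
rewrite (linD (nop_linear _ _ _ _)) (linZ (nop_linear _ _ _ _)) (vK K) //.
have -> : nop sg A B n (ket l m D) = modesum sg A B n K (ket l m D).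
  rewrite /nop lext_ket (_ : << _ >> = ket l m D); last by rewrite ket.unlock.
  rewrite /modesum; congr (_ + _ *: _); apply: fsbig_nat => j Kj.
    have -> : n + j%:Z = Posz `|n + j%:Z| by lia.
    by rewrite BK ?(lin0 (AL _)) //; lia.
  by rewrite AK ?(lin0 (BL _)) //; lia.
by rewrite (linD (modesum_linear sg n K AL BL)) (linZ (modesum_linear sg n K AL BL)).
Qed.

(** The constant field, which is the vertex operator of the vacuum. *)
Definition idfield : int -> V -> V := fun n v => if n == -1 then v else 0.

Lemma nop_idfield A : (forall p, linear (A p)) -> truncated A ->
  nop false A idfield = A.
Proof.
move=> AL At; apply/funext => n; apply/funext.
have IL p : linear (idfield p).
  by move=> c u v; rewrite /idfield; case: eqP; rewrite ?scaler0 ?addr0.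
have It : truncated idfield by move=> v; exists 0%N.
move=> v; have [K0 /(_ (maxn K0 `|n|.+1) (leq_maxl _ _)) ->] := nopE false n v AL IL At It.
set K := maxn _ _; rewrite /modesum expr0 scale1r.
rewrite -(sum_pick_int (fun q => A q v) (_ : (`|n| < K)%N)); last exact: leq_maxr.
congr (_ + _); apply: eq_bigr => j _; rewrite /idfield.
  rewrite (_ : (n + j%:Z == -1) = (Negz j == n)); last by lia.
  by case: eqP; rewrite ?scale1r // scale0r (lin0 (AL _)).
rewrite (_ : (n - j%:Z - 1 == -1) = (Posz j == n)); last by lia.
by case: eqP; rewrite ?scale1r // scale0r.
Qed.
End NormalOrder.

(** * Vertex operators of the N = 2 generators *)

Section Generators.
Variables (C : numFieldType) (G : 'M[int]_4).
Variable eps : lattice -> lattice -> int.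
Hypothesis eps0 : forall l, eps 0 l = 1.
Local Notation V := (VNS C).
Local Notation bos := (@bos C G).
Local Notation ferm := (@ferm C).
Implicit Types (v w : V).

Lemma exp_coef_zero (b : nat -> V -> V) p v : (forall n v, b n v = 0) ->
  exp_coef b p v = if p == 0%N then v else 0.
Proof.
move=> b0; rewrite /exp_coef big_ord_recl /= big1 ?addr0 => [|i _].
  by rewrite fact0 invr1 scale1r.
by rewrite big1 ?scaler0.
Qed.

Lemma bos0 n v : bos 0 n v = 0.
Proof.
have h0 y : hform G 0 y = 0 :> C.
  by rewrite hformE big1 // => i _; rewrite big1 // => j _; rewrite mxE !mul0r.
case: n => [[|p]|p].
- move: v; apply: (@eq_on_ket _ _ (bos 0 0) (fun=> 0)) => [||l m D].
  + exact: bos_linear.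
  + by move=> c u v; rewrite scaler0 addr0.
  + by rewrite bos_zero h0 scale0r.
- by rewrite (bos_pos G 0 p v) big1 // => i _; rewrite h0 mulr0 scale0r.
- by rewrite (bos_neg G 0 p v) big1 // => i _; rewrite mxE scale0r.
Qed.

Lemma hlat0 : hlat C 0 = 0.
Proof. exact: map_mx0. Qed.

(** For the weight 0 all modes of the exponents vanish and the shift is trivial,
    so both exponentials reduce to their constant term. *)
Lemma Yexp_zero n v : Yexp G eps 0 n v = idfield n v.
Proof.
move: v; apply: (@eq_on_ket C _ _ (idfield n)) => [||l m D].
- exact: lext_linear.
- by move=> c u v; rewrite /idfield; case: (n == -1); rewrite ?scaler0 ?addr0.
rewrite /Yexp lext_ket (fsbig_nat (K := 1)) => [|j j1]; last first.
  case: (_ - _) => // p; rewrite {1}/expplus exp_coef_zero => [|a w]; last first.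
    by rewrite hlat0 bos0 scaler0 oppr0.
  rewrite eqn0Ngt j1 /= /eshift (lin0 (@lext_linear C _)).
  rewrite /expminus exp_coef_zero; first by case: eqP.
  by move=> a w; rewrite hlat0 bos0 scaler0.
rewrite big_nat1 (_ : << _ >> = ket l m D); last by rewrite ket.unlock.
have -> : lform G 0 (l, m, D).1.1 = 0 by rewrite /lform !mul0mx mxE.
rewrite /expplus exp_coef_zero /= => [|a w]; last by rewrite hlat0 bos0 scaler0 oppr0.
have -> : eshift eps 0 (ket l m D) = ket l m D :> V.
  by rewrite /eshift lext_ket eps0 scale1r add0r ket.unlock.
rewrite subr0 sub0r /idfield.
case e: (- n - 1) => [[|p]|p]; last by rewrite (_ : (n == -1) = false) //; lia.
  rewrite /expminus exp_coef_zero => [|a w]; last by rewrite hlat0 bos0 scaler0.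
  by rewrite (_ : n == -1) //; lia.
rewrite /expminus exp_coef_zero => [|a w]; last by rewrite hlat0 bos0 scaler0.
by rewrite (_ : (n == -1) = false) //; lia.
Qed.

Lemma Y_ket l m D n v : Y G eps (ket l m D) n v = Ybasis G eps (l, m, D) n v.
Proof. by rewrite ket.unlock /Y; exact: (sum_ket (fun k => Ybasis G eps k n v)). Qed.

Lemma Y_linearl n v : linear (fun u => Y G eps u n v).
Proof. exact: (@lext_linear C (fun k => Ybasis G eps k n v)). Qed.
End Generators.

Section Fields.
Variables (C : numFieldType) (G : 'M[int]_4).
Variable eps : lattice -> lattice -> int.
Hypothesis eps0 : forall l, eps 0 l = 1.
Local Notation V := (VNS C).
Local Notation bos := (@bos C G).
Local Notation ferm := (@ferm C).
Implicit Types (v w : V) (A B : int -> V -> V).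

Lemma vacE : vac C = ket 0 mset0 fset0.
Proof. by rewrite ket.unlock. Qed.

Lemma wedge_sign0 s : wedge_sign C s fset0 = 1.
Proof. by rewrite /wedge_sign (_ : enum_fset fset0 = [::]) //. Qed.

Lemma wedge_sign1 s t : wedge_sign C s [fset t]%fset = (-1) ^+ (t < s)%O.
Proof. by rewrite -(fsetU0 [fset t]%fset) wedge_signU ?in_fset0 // wedge_sign0 mulr1. Qed.

Lemma upF_vac s l m : upF s (ket l m fset0 : V) = ket l m [fset s]%fset.
Proof. by rewrite upF_ket in_fset0 wedge_sign0 scale1r fsetU0. Qed.

Lemma bos_neg_ket x p l m D : bos x (Negz p) (ket l m D) =
  \sum_j x 0 j *: ket l ((j, p) +` m)%mset D.
Proof.
by rewrite (bos_neg G x p _); apply: eq_bigr => j _; rewrite upB_ket.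
Qed.

Lemma divderiv0 A : divderiv 0 A = A.
Proof.
by apply/funext => n; apply/funext => v; rewrite /divderiv /= invr1 scale1r.
Qed.

Definition dfield A : int -> V -> V := fun n v => (- n)%:~R *: A (n - 1) v.

Lemma divderiv1 A : divderiv 1 A = dfield A.
Proof.
by apply/funext => n; apply/funext => v; rewrite /divderiv /= invr1 scale1r.
Qed.

Lemma dfield_linear A : (forall n, linear (A n)) -> forall n, linear (dfield A n).
Proof. by move=> AL n; apply: is_linear_scale; exact: AL. Qed.

Lemma dfield_truncated A : truncated A -> truncated (dfield A).
Proof.
move=> At v; have [K vK] := At v; exists K.+1 => n Kn.
rewrite /dfield (_ : n%:Z - 1 = n.-1%:Z); last by lia.
by rewrite vK ?scaler0 //; lia.
Qed.

Lemma Yexp0 : Yexp G eps 0 = @idfield C.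
Proof. by apply/funext => n; apply/funext => v; exact: Yexp_zero. Qed.

Let bosL x := @bos_linear C G x.
Let bosT x := @bos_truncated C G x.
Let fermL b i := @ferm_linear C b i.
Let fermT b i := @ferm_truncated C b i.

Lemma enum_mset1 (a : bmode) : enum_mset (a +` mset0)%mset = [:: a].
Proof.
apply: perm_small_eq => //; rewrite msetD0 -[[:: a]]/([:: a]).
apply: perm_trans (perm_eq_seq_mset [:: a]).
rewrite (_ : seq_mset [:: a] = msetn 1 a) //; apply/msetP => b.
by rewrite mset_seqE msetnE /= addn0 eq_sym; case: eqP.
Qed.

(** The enumeration of a multiset comes in an unspecified order. *)
Lemma enum_mset2 (a b : bmode) :
  enum_mset (a +` (b +` mset0))%mset = [:: a; b] \/
  enum_mset (a +` (b +` mset0))%mset = [:: b; a].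
Proof.
have : perm_eq (enum_mset (a +` (b +` mset0))%mset) [:: a; b].
  apply: perm_trans (perm_eq_seq_mset [:: a; b]).
  rewrite (_ : seq_mset [:: a; b] = (a +` (b +` mset0))%mset) //; apply/msetP => c.
  by rewrite mset_seqE !mset1DE mset0E /= !addn0 !(eq_sym c).
case: (enum_mset _) => [|x [|y [|z s]]] /[dup] /perm_size //= _ p.
have := perm_mem p x; rewrite !inE eqxx /= => /esym/orP[] /eqP e; subst x; [left|right].
  by move: p; rewrite perm_cons => /perm_small_eq -> //.
have p' : perm_eq [:: b; y] [:: b; a] by rewrite (perm_trans p) // -[[:: a; b]]/([:: a] ++ [:: b]) perm_catC.
by move: p'; rewrite perm_cons => /perm_small_eq -> //.
Qed.

Lemma sort1 (s : fmode) : sort <=%O (enum_fset [fset s]%fset) = [:: s].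
Proof.
apply: perm_small_eq => //; rewrite perm_sort.
apply: uniq_perm => [||t]; rewrite ?fset_uniq //.
by rewrite in_fset1 inE.
Qed.

Lemma sort2 (s t : fmode) : (s < t)%O ->
  sort <=%O (enum_fset (s |` [fset t])%fset) = [:: s; t].
Proof.
move=> st; apply: (sorted_eq (leT := <=%O)).
- exact: le_trans.
- exact: le_anti.
- exact: sort_le_sorted.
- by rewrite /= andbT ltW.
rewrite perm_sort; apply: uniq_perm => [||u]; rewrite ?fset_uniq //=.
  by rewrite inE lt_eqF.
by rewrite in_fset1U in_fset1 !inE.
Qed.

(** The fields below are computed by naming the enumerations explicitly and then
    unfolding the recursions one step at a time. *)
Lemma YbasisE l (m : {mset bmode}%mset) (D : {fset fmode}) (s : seq fmode) (t : seq bmode) :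
  sort <=%O (enum_fset D) = s -> enum_mset m = t ->
  @Ybasis C G eps (l, m, D) = Ybos G (Yferm G eps l s) t.
Proof. by move=> <- <-. Qed.

Lemma Ybos_cons A i p s :
  Ybos G A ((i, p) :: s) = nop false (divderiv p (bos (hbase C i))) (Ybos G A s).
Proof. by []. Qed.

Lemma Yferm_cons l b i p s : @Yferm C G eps l ((b, i, p) :: s) =
  nop (odd (size s)) (divderiv p (ferm b i)) (Yferm G eps l s).
Proof. by []. Qed.

Lemma Yferm_nil : Yferm G eps 0 [::] = @idfield C.
Proof. exact: Yexp0. Qed.

Lemma Ybos_nil A : Ybos G A [::] = A.
Proof. by []. Qed.

Lemma nop_divderiv_idfield sg p A B B' : divderiv p B = B' ->
  (forall n, linear (B' n)) -> truncated B' ->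
  nop sg A (nop false (divderiv p B) (@idfield C)) = nop sg A B'.
Proof. by move=> -> BL Bt; rewrite nop_idfield. Qed.

Lemma nop_divderiv0 sg A B : nop sg (divderiv 0 A) B = nop sg A B.
Proof. by rewrite divderiv0. Qed.

Lemma Ybasis_bos_ferm j b i :
  @Ybasis C G eps (0, (j, 0%N) +` mset0, [fset (b, i, 0%N)])%mset%fset =
  nop false (bos (hbase C j)) (ferm b i).
Proof.
rewrite (YbasisE 0 (sort1 _) (enum_mset1 _)) Ybos_cons Ybos_nil Yferm_cons Yferm_nil.
etransitivity; first exact: nop_divderiv0.
exact: (nop_divderiv_idfield _ _ (divderiv0 _) (fermL b i) (fermT b i)).
Qed.

Lemma Ybasis_ferm_ferm i p q A :
  divderiv q (ferm true i) = A -> (forall n, linear (A n)) -> truncated A ->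
  @Ybasis C G eps (0, mset0, (false, i, p) |` [fset (true, i, q)])%fset =
  nop true (divderiv p (ferm false i)) A.
Proof.
move=> qA AL At.
have lt : ((false, i, p) < (true, i, q) :> fmode)%O by [].
rewrite (YbasisE 0 (sort2 lt) (@enum_mset0 _)) Ybos_nil.
rewrite (Yferm_cons 0 false) (Yferm_cons 0 true) Yferm_nil.
exact: (nop_divderiv_idfield _ _ qA AL At).
Qed.

(** Which alternative holds depends on the enumeration of the multiset; the
    consequences drawn from it are symmetric in j and k. *)
Lemma Ybasis_bos_bos j k :
  let F := @Ybasis C G eps (0, (j, 0%N) +` ((k, 0%N) +` mset0), fset0)%mset%fset in
  F = nop false (bos (hbase C j)) (bos (hbase C k)) \/
  F = nop false (bos (hbase C k)) (bos (hbase C j)).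
Proof.
have s0 : sort <=%O (enum_fset (fset0 : {fset fmode})) = [::] by [].
case: (enum_mset2 (j, 0%N) (k, 0%N)) => e; [left|right];
  rewrite (YbasisE 0 s0 e) Ybos_cons Ybos_cons Ybos_nil Yferm_nil;
  (etransitivity; first exact: nop_divderiv0);
  exact: (nop_divderiv_idfield _ _ (divderiv0 _) (bosL _) (bosT _)).
Qed.
End Fields.

Section ModeSumLinear.
Variables (C : numFieldType) (V : lmodType C).
Lemma modesum_suml (sg : bool) (I : finType) (c : I -> C) (A : I -> int -> V -> V) A' B n K v :
  (forall n, linear (B n)) -> (forall n v, A' n v = \sum_i c i *: A i n v) ->
  modesum sg A' B n K v = \sum_i c i *: modesum sg (A i) B n K v.
Proof.
move=> BL A'E; rewrite /modesum.
under [RHS]eq_bigr do rewrite scalerDr 2!scaler_sumr scaler_sumr.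
rewrite big_split /= scaler_sumr; congr (_ + _).
  by rewrite exchange_big; apply: eq_bigr => j _; rewrite A'E.
rewrite exchange_big; apply: eq_bigr => j _.
rewrite A'E (lin_sum _ _ _ (BL _)) scaler_sumr; apply: eq_bigr => i _.
by rewrite (linZ (BL _)) !scalerA mulrC.
Qed.
End ModeSumLinear.

Section Brackets.
Variables (C : numFieldType) (G : 'M[int]_4).
Variable eps : lattice -> lattice -> int.
Hypothesis eps0 : forall l, eps 0 l = 1.
Local Notation V := (VNS C).
Local Notation bos := (@bos C G).
Local Notation ferm := (@ferm C).
Implicit Types (v w : V) (A B : int -> V -> V).

Let bosL x := @bos_linear C G x.
Let bosT x := @bos_truncated C G x.
Let fermL b i := @ferm_linear C b i.
Let fermT b i := @ferm_truncated C b i.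

Lemma nop_comm (sg : bool) A B X n (sA sB ca cb : C) (pa pb : int) w :
  (forall p, linear (A p)) -> (forall p, linear (B p)) -> linear X ->
  truncated A -> truncated B ->
  (forall p v, A p (X v) = sA *: X (A p v) + ((p == pa)%:R * ca) *: v) ->
  (forall p v, B p (X v) = sB *: X (B p v) + ((p == pb)%:R * cb) *: v) ->
  cb = 0 \/ (-1) ^+ sg * sA = 1 -> ca = 0 \/ sB = (-1) ^+ sg ->
  nop sg A B n (X w) = (sA * sB) *: X (nop sg A B n w) +
    cb *: A (n - 1 - pb) w + ((-1) ^+ sg * ca) *: B (n - 1 - pa) w.
Proof.
move=> AL BL XL At Bt AX BX hb ha.
have [K1 e1] := nopE sg n (X w) AL BL At Bt.
have [K2 e2] := nopE sg n w AL BL At Bt.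
pose K := maxn (maxn K1 K2) (`|n| + `|pa| + `|pb| + 1).+1.
have h1 : (K1 <= K)%N by rewrite !leq_max leqnn.
have h2 : (K2 <= K)%N by rewrite !leq_max leqnn orbT.
have h3 : (`|n| + `|pa| + `|pb| + 1 < K)%N by rewrite leq_max leqnn orbT.
rewrite (e1 K h1) (e2 K h2).
exact: (modesum_comm w AL BL XL AX BX hb ha h3).
Qed.

Lemma hform_linearl y : linear (fun x : 'rV[C]_4 => hform G x y : C^o).
Proof. by move=> c u v; rewrite /hform !mulmxDl -!scalemxAl !mxE. Qed.

Lemma bos_linearx n v : linear (fun x => bos x n v).
Proof.
move=> c x y; case: n => [[|p]|p].
- move: v; apply: (@eq_on_ket _ _ (bos (c *: x + y) 0)
    (fun v => c *: bos x 0 v + bos y 0 v)) => [||l m D].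
  + exact: bosL.
  + by apply: is_linear_add; [apply: is_linear_scale|]; exact: bosL.
  + rewrite (bos_zero G (c *: x + y)) (bos_zero G x) (bos_zero G y) scalerA -scalerDl.
    by rewrite (hform_linearl (hlat C l)).
- rewrite (bos_pos G (c *: x + y)) (bos_pos G x) (bos_pos G y) scaler_sumr -big_split.
  apply: eq_bigr => i _ /=; rewrite scalerA -scalerDl (hform_linearl (hbase C i)).
  by rewrite mulrDr mulrCA.
- rewrite (bos_neg G (c *: x + y)) (bos_neg G x) (bos_neg G y) scaler_sumr -big_split.
  by apply: eq_bigr => i _ /=; rewrite scalerA -scalerDl !mxE.
Qed.

Lemma bos_base x n v : bos x n v = \sum_j x 0 j *: bos (hbase C j) n v.
Proof.
rewrite {1}(row_sum_delta x) (lin_sum _ _ _ (bos_linearx n v)).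
by apply: eq_bigr => j _; rewrite (linZ (bos_linearx n v)).
Qed.

Lemma nop_suml (sg : bool) (I : finType) (c : I -> C) (A : I -> int -> V -> V) A' B n v :
  (forall i n, linear (A i n)) -> (forall i, truncated (A i)) ->
  (forall n, linear (A' n)) -> truncated A' ->
  (forall n, linear (B n)) -> truncated B ->
  (forall n v, A' n v = \sum_i c i *: A i n v) ->
  \sum_i c i *: nop sg (A i) B n v = nop sg A' B n v.
Proof.
move=> AL At A'L A't BL Bt A'E.
have [K0 e0] := nopE sg n v A'L BL A't Bt.
have /fin_all_exists [K1 e1] i := nopE sg n v (AL i) BL (At i) Bt.
pose K := (K0 + \sum_i K1 i)%N.
rewrite (e0 K) ?leq_addr // (modesum_suml _ _ _ _ BL A'E).
apply: eq_bigr => i _; rewrite (e1 i K) // /K (bigD1 i) //=.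
by rewrite addnCA leq_addr.
Qed.

Section Structure.
Variables hp hm : 2.-tuple 'rV[C]_4.

(** Vertex operators are linear in the state, and normally ordered products in
    their first factor, so the coordinates of the vectors h_i recombine. *)
Lemma tau_sum (h : 2.-tuple 'rV[C]_4) b n v :
  Y G eps (\sum_(i < 2) bos (tnth h i) (-1) (ferm b i (-1) (vac C))) n v =
  \sum_i nop false (bos (tnth h i)) (ferm b i) n v.
Proof.
rewrite (lin_sum _ _ _ (Y_linearl G eps n v)); apply: eq_bigr => i _.
have -> : bos (tnth h i) (-1) (ferm b i (-1) (vac C)) =
    \sum_j (tnth h i) 0 j *: ket 0 ((j, 0%N) +` mset0)%mset [fset (b, i, 0%N)]%fset.
  have -> : ferm b i (-1) (vac C) = ket 0 mset0 [fset (b, i, 0%N)]%fset.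
    by rewrite vacE (ferm_neg b i 0 _) upF_vac.
  exact: bos_neg_ket.
rewrite (lin_sum _ _ _ (Y_linearl G eps n v)).
rewrite -(@nop_suml false _ (fun j => (tnth h i) 0 j) (fun j => bos (hbase C j))
  (bos (tnth h i)) (ferm b i) n v (fun j => bosL (hbase C j)) (fun j => bosT (hbase C j))
  (bosL (tnth h i)) (bosT (tnth h i)) (fermL b i) (fermT b i) (bos_base (tnth h i))).
apply: eq_bigr => j _; rewrite (linZ (Y_linearl G eps n v)) Y_ket.
by rewrite (Ybasis_bos_ferm _ _ eps0).
Qed.

Lemma GplusE n v : Gplus G eps hp n v =
  \sum_i nop false (bos (tnth hp i)) (ferm false i) (n + 1) v.
Proof. exact: tau_sum. Qed.

Lemma GminusE n v : Gminus G eps hm n v =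
  \sum_i nop false (bos (tnth hm i)) (ferm true i) (n + 1) v.
Proof. exact: tau_sum. Qed.

Lemma JopE n v : Jop G eps n v =
  \sum_i nop true (ferm false i) (ferm true i) n v.
Proof.
rewrite /Jop /jcur (lin_sum _ _ _ (Y_linearl G eps n v)); apply: eq_bigr => i _.
have -> : ferm false i (-1) (ferm true i (-1) (vac C)) =
    ket 0 mset0 ((false, i, 0%N) |` [fset (true, i, 0%N)])%fset.
  rewrite vacE (ferm_neg true i 0 _) upF_vac (ferm_neg false i 0 _) upF_ket.
  by rewrite in_fset1 wedge_sign1 [X in X *: _]expr0 scale1r.
rewrite Y_ket (Ybasis_ferm_ferm _ eps0 0 (divderiv0 _) (fermL _ _) (fermT _ _)).
by rewrite nop_divderiv0.
Qed.
End Structure.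
End Brackets.

(** * Brackets of the N = 2 fields with the oscillators *)

Lemma scale_anticomm (C : numFieldType) (V : lmodType C) (c d : C) (u v : V) :
  c *: (-1 *: u + d *: v) = -1 *: (c *: u) + (c * d) *: v.
Proof. by rewrite scalerDr !scalerA mulrN1 mulN1r. Qed.

Lemma comm_terms0 (C : numFieldType) (V : lmodType C) (e : C) (x y z : V) :
  (1 * 1) *: x + 0 *: y + (e * 0) *: z = x.
Proof. by rewrite mulr0 !scale0r !addr0 mulr1 scale1r. Qed.

Lemma bracket_terms (C : numFieldType) (V : lmodType C) (m : int) (a b : C)
    (x y z : V) :
  (1 * 1) *: x + ((- m)%:~R * b) *: y + ((-1) ^+ false * ((- m)%:~R * a)) *: z =
  x - m%:~R *: (b *: y + a *: z).
Proof.
rewrite mul1r scale1r expr0 mul1r mulrNz !mulNr !scaleNr -addrA -opprD.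
by rewrite -!scalerA -scalerDr.
Qed.

Lemma fermion_terms (C : numFieldType) (V : lmodType C) (m : int) (c c' : C)
    (x y u t : V) :
  ((-1 * -1) *: x + c' *: ((- (m + 1))%:~R *: u) +
    ((-1) ^+ true * (m%:~R * c)) *: t) -
  ((-1 * -1) *: y + (m%:~R * c') *: u +
    ((-1) ^+ true * c) *: ((- (m + 1))%:~R *: t)) =
  x - y - ((2 * m + 1)%:~R * c') *: u - ((2 * m + 1)%:~R * c) *: t.
Proof.
rewrite mulrNN mulr1 !scale1r expr1 !scalerA !opprD -!scaleNr.
have reorder (a b d a' b' d' : V) :
    a + b + d + (a' + b' + d') = a + a' + (b + b') + (d + d').
  by rewrite addrACA [a + b + _]addrACA.
rewrite reorder -!scalerDl -[- y]scaleN1r scaleN1r.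
by congr (_ + _ *: _ + _ *: _); rewrite !(rmorphN, rmorphD, rmorphM) /= ?rmorph1; ring.
Qed.

Section Commutators.
Variables (C : numFieldType) (G : 'M[int]_4).
Variable eps : lattice -> lattice -> int.
Hypothesis eps0 : forall l, eps 0 l = 1.
Hypothesis GT : G^T = G.
Local Notation V := (VNS C).
Local Notation bos := (@bos C G).
Local Notation ferm := (@ferm C).
Implicit Types (v w : V) (A B : int -> V -> V).

Let bosL x := @bos_linear C G x.
Let bosT x := @bos_truncated C G x.
Let fermL b i := @ferm_linear C b i.
Let fermT b i := @ferm_truncated C b i.
Let dfermL b i := dfield_linear (fermL b i).
Let dfermT b i := dfield_truncated (fermT b i).

Lemma bos_bosX x y m p v : bos x p (bos y m v) = 1 *: bos y m (bos x p v) +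
  ((p == - m)%:R * ((- m)%:~R * hform G x y)) *: v.
Proof.
rewrite scale1r (bos_bos GT x y p m v).
rewrite (_ : (m == - p) = (p == - m)); last by lia.
by case: eqP => [->|_]; rewrite ?mul1r ?mul0r.
Qed.

Lemma bos_fermX x b i m p v :
  bos x p (ferm b i m v) = 1 *: ferm b i m (bos x p v) + ((p == 0)%:R * 0) *: v.
Proof. by rewrite mulr0 scale0r addr0 scale1r; exact: bos_ferm. Qed.

Lemma ferm_bosX x b i m p v :
  ferm b i p (bos x m v) = 1 *: bos x m (ferm b i p v) + ((p == 0)%:R * 0) *: v.
Proof. by rewrite mulr0 scale0r addr0 scale1r; symmetry; exact: bos_ferm. Qed.

Lemma ferm_fermX b i b' j m p v :
  ferm b i p (ferm b' j m v) = -1 *: ferm b' j m (ferm b i p v) +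
  ((p == - 1 - m)%:R * ((b' == ~~ b) && (i == j))%:R) *: v.
Proof.
rewrite scaleN1r (ferm_ferm b i p b' j m v) -natrM mulnb.
rewrite (_ : (m == - 1 - p) = (p == - 1 - m)); last by lia.
by rewrite andbA andbC.
Qed.

Lemma dferm_bosX x b i m p v : dfield (ferm b i) p (bos x m v) =
  1 *: bos x m (dfield (ferm b i) p v) + ((p == 0)%:R * 0) *: v.
Proof.
rewrite mulr0 scale0r addr0 scale1r /dfield (linZ (bosL x m)).
by rewrite (bos_ferm G x m b i (p - 1) v).
Qed.

Lemma dferm_fermX b i b' j m p v : dfield (ferm b i) p (ferm b' j m v) =
  -1 *: ferm b' j m (dfield (ferm b i) p v) +
  ((p == - m)%:R * (m%:~R * ((b' == ~~ b) && (i == j))%:R)) *: v.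
Proof.
have -> : (p == - m)%:R * (m%:~R * ((b' == ~~ b) && (i == j))%:R) =
    (- p)%:~R * ((p - 1 == - 1 - m)%:R * ((b' == ~~ b) && (i == j))%:R) :> C.
  rewrite (_ : (p - 1 == - 1 - m) = (p == - m)); last by lia.
  by case: eqP => [->|_]; rewrite ?mul0r ?mulr0 // opprK !mul1r.
rewrite /dfield (ferm_fermX b i b' j m (p - 1) v) (linZ (fermL b' j m)).
exact: scale_anticomm.
Qed.

Let one_sign : (-1) ^+ false * 1 = 1 :> C. Proof. by rewrite mul1r. Qed.
Let minus_sign : (-1) ^+ true * -1 = 1 :> C. Proof. by rewrite expr1 mulrNN mulr1. Qed.

Let even_sign : 1 = (-1) ^+ false :> C. Proof. by []. Qed.
Let odd_sign : -1 = (-1) ^+ true :> C. Proof. by []. Qed.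

Section GBrackets.
Variables (h : 2.-tuple 'rV[C]_4) (b : bool).

Let Gfield n v := \sum_i nop false (bos (tnth h i)) (ferm b i) (n + 1) v.

(** Both supercharges pair two bosonic fields with two fermionic ones: the field
    is G^+ for (h, b) = (hp, false) and G^- for (h, b) = (hm, true). *)
Lemma Gfield_bos x n m w : Gfield n (bos x m w) = bos x m (Gfield n w) -
  \sum_i (m%:~R * hform G (tnth h i) x) *: ferm b i (n + m) w.
Proof.
rewrite /Gfield (lin_sum _ _ _ (bosL x m)) -sumrB; apply: eq_bigr => i _.
rewrite (nop_comm (n + 1) w (bosL _) (fermL b i) (bosL x m) (bosT _) (fermT b i)
  (bos_bosX _ _ _) (ferm_bosX x b i m) (or_introl erefl) (or_intror even_sign)).
rewrite mul1r scale1r scale0r addr0 expr0 mul1r mulrNz mulNr scaleNr.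
by have -> : n + 1 - 1 - - m = n + m by lia.
Qed.

Lemma Gfield_ferm i n m w : Gfield n (ferm (~~ b) i m w) =
  - ferm (~~ b) i m (Gfield n w) + bos (tnth h i) (n + 1 + m) w.
Proof.
rewrite /Gfield (lin_sum _ _ _ (fermL (~~ b) i m)) -sumrN.
have -> : bos (tnth h i) (n + 1 + m) w =
    \sum_j (j == i)%:R *: bos (tnth h j) (n + 1 + m) w.
  rewrite (bigD1 i) //= eqxx scale1r big1 ?addr0 // => j /negPf ->.
  by rewrite scale0r.
rewrite -big_split; apply: eq_bigr => j _ /=.
rewrite (nop_comm (n + 1) w (bosL _) (fermL b j) (fermL _ i m) (bosT _) (fermT b j)
  (bos_fermX _ _ _ _) (ferm_fermX b j _ i m) (or_intror one_sign) (or_introl erefl)).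
rewrite mulr0 scale0r addr0 mul1r scaleN1r eqxx.
by have -> : n + 1 - 1 - (- 1 - m) = n + 1 + m by lia.
Qed.

Lemma Gfield_ferm_same i n m w : Gfield n (ferm b i m w) = - ferm b i m (Gfield n w).
Proof.
rewrite /Gfield (lin_sum _ _ _ (fermL b i m)) -sumrN; apply: eq_bigr => j _ /=.
rewrite (nop_comm (n + 1) w (bosL _) (fermL b j) (fermL _ i m) (bosT _) (fermT b j)
  (bos_fermX _ _ _ _) (ferm_fermX b j _ i m) (or_intror one_sign) (or_introl erefl)).
rewrite mulr0 scale0r addr0 mul1r scaleN1r (_ : (b == ~~ b) = false); last by case: (b).
by rewrite scale0r addr0.
Qed.
End GBrackets.

Lemma Jop_bos n x m w : Jop G eps n (bos x m w) = bos x m (Jop G eps n w).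
Proof.
rewrite !(JopE G eps0) (lin_sum _ _ _ (bosL x m)); apply: eq_bigr => j _.
rewrite (nop_comm n w (fermL _ j) (fermL _ j) (bosL x m) (fermT _ j) (fermT _ j)
  (ferm_bosX x _ j m) (ferm_bosX x _ j m) (or_introl erefl) (or_introl erefl)).
exact: comm_terms0.
Qed.

Lemma Jop_ferm n b i m w : Jop G eps n (ferm b i m w) =
  ferm b i m (Jop G eps n w) + (-1) ^+ b *: ferm b i (n + m) w.
Proof.
rewrite !(JopE G eps0) (lin_sum _ _ _ (fermL b i m)).
have -> : (-1) ^+ b *: ferm b i (n + m) w =
    \sum_j (j == i)%:R *: ((-1) ^+ b *: ferm b j (n + m) w).
  rewrite (bigD1 i) //= eqxx scale1r big1 ?addr0 // => j /negPf ->.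
  by rewrite scale0r.
rewrite -big_split; apply: eq_bigr => j _ /=.
rewrite (nop_comm n w (fermL _ j) (fermL _ j) (fermL b i m) (fermT _ j) (fermT _ j)
  (ferm_fermX _ j _ i m) (ferm_fermX _ j _ i m) (or_intror minus_sign)
  (or_intror odd_sign)).
rewrite mulrNN mulr1 scale1r -addrA.
have -> : n - 1 - (- 1 - m) = n + m by lia.
case: b => /=; rewrite ?scale0r ?mulr0 ?scale0r ?add0r ?addr0.
  by rewrite expr1 mulN1r scaleNr scaleN1r scalerN.
by rewrite scale1r.
Qed.

Lemma hform_basel x y : hform G x y = \sum_j x 0 j * hform G (hbase C j) y.
Proof.
by rewrite (hform_sym GT) hform_base; apply: eq_bigr => j _; rewrite (hform_sym GT) mulrC.
Qed.

(** The part of the Virasoro zero mode coming from e_j(-1) e_k(-1). *)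
Definition Qbos j k : V -> V :=
  @Ybasis C G eps (0, (j, 0%N) +` ((k, 0%N) +` mset0), fset0)%mset%fset 1.

Lemma nop_bos_bos x y z m w : nop false (bos x) (bos y) 1 (bos z m w) =
  bos z m (nop false (bos x) (bos y) 1 w) -
  m%:~R *: (hform G y z *: bos x m w + hform G x z *: bos y m w).
Proof.
have := nop_comm 1 w (bosL x) (bosL y) (bosL z m) (bosT x) (bosT y)
  (bos_bosX x z m) (bos_bosX y z m) (or_intror one_sign) (or_intror even_sign).
have -> : 1 - 1 - - m = m by lia.
by move=> ->; exact: bracket_terms.
Qed.

Lemma Qbos_bos j k x m w : Qbos j k (bos x m w) = bos x m (Qbos j k w) -
  m%:~R *: (hform G (hbase C k) x *: bos (hbase C j) m w +
            hform G (hbase C j) x *: bos (hbase C k) m w).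
Proof.
have [e|e] := Ybasis_bos_bos C G eps0 j k; rewrite /Qbos e; last rewrite [_ *: _ + _]addrC.
  exact: nop_bos_bos.
exact: nop_bos_bos.
Qed.

Lemma nop_bos_ferm x y b i m w : nop false (bos x) (bos y) 1 (ferm b i m w) =
  ferm b i m (nop false (bos x) (bos y) 1 w).
Proof.
have := nop_comm 1 w (bosL x) (bosL y) (fermL b i m) (bosT x) (bosT y)
  (bos_fermX x b i m) (bos_fermX y b i m) (or_introl erefl) (or_introl erefl).
by move=> ->; exact: comm_terms0.
Qed.

Lemma Qbos_ferm j k b i m w : Qbos j k (ferm b i m w) = ferm b i m (Qbos j k w).
Proof.
by have [e|e] := Ybasis_bos_bos C G eps0 j k; rewrite /Qbos e; exact: nop_bos_ferm.
Qed.

(** Twice the part of L_0 coming from the pair a_i, a_i^*. The minus sign comes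
    from putting a_i^*(-3/2) a_i(-1/2) in the order of the basis. *)
Definition Lferm i v : V :=
  nop true (dfield (ferm false i)) (ferm true i) 1 v -
  nop true (ferm false i) (dfield (ferm true i)) 1 v.

Let L1 i := nop true (dfield (ferm false i)) (ferm true i) 1.
Let L2 i := nop true (ferm false i) (dfield (ferm true i)) 1.

Lemma Lferm_bos i x m w : Lferm i (bos x m w) = bos x m (Lferm i w).
Proof.
rewrite /Lferm (linD (bosL x m)) (linN (bosL x m)).
have e1 : L1 i (bos x m w) = bos x m (L1 i w).
  have := nop_comm 1 w (dfermL _ i) (fermL _ i) (bosL x m) (dfermT _ i) (fermT _ i)
    (dferm_bosX x _ i m) (ferm_bosX x _ i m) (or_introl erefl) (or_introl erefl).
  by rewrite /L1 => ->; exact: comm_terms0.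
have e2 : L2 i (bos x m w) = bos x m (L2 i w).
  have := nop_comm 1 w (fermL _ i) (dfermL _ i) (bosL x m) (fermT _ i) (dfermT _ i)
    (ferm_bosX x _ i m) (dferm_bosX x _ i m) (or_introl erefl) (or_introl erefl).
  by rewrite /L2 => ->; exact: comm_terms0.
by rewrite -/(L1 i _) -/(L2 i _) e1 e2.
Qed.

Lemma Lferm_ferm i b j m w : Lferm i (ferm b j m w) =
  ferm b j m (Lferm i w) - ((2 * m + 1)%:~R * (i == j)%:R) *: ferm b j m w.
Proof.
rewrite /Lferm (linD (fermL b j m)) (linN (fermL b j m)).
have := nop_comm 1 w (dfermL _ i) (fermL _ i) (fermL b j m) (dfermT _ i) (fermT _ i)
  (dferm_fermX _ i _ j m) (ferm_fermX _ i _ j m) (or_intror minus_sign)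
  (or_intror odd_sign).
have := nop_comm 1 w (fermL _ i) (dfermL _ i) (fermL b j m) (fermT _ i) (dfermT _ i)
  (ferm_fermX _ i _ j m) (dferm_fermX _ i _ j m) (or_intror minus_sign)
  (or_intror odd_sign).
rewrite /dfield; have -> : 1 - 1 - (- 1 - m) = m + 1 by lia.
have -> : 1 - 1 - - m = m :> int by lia.
have -> : m + 1 - 1 = m :> int by lia.
move=> -> ->; rewrite fermion_terms.
have sub0Z (x y z : V) (c : C) : x - (c * 0) *: y - (c * 0) *: z = x.
  by rewrite mulr0 !scale0r !subr0.
have [<-|ij] := eqVneq i j.
  by case: b; rewrite [in X in X - _ - _ = _]/= mulr1 mulr0 scale0r subr0.
by rewrite !andbF mulr0n sub0Z mulr0 scale0r subr0.
Qed.
End Commutators.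

Lemma bilinear_split (C : numFieldType) (V : lmodType C) (a c t : 'I_4 -> C)
    (X : 'I_4 -> V) :
  \sum_k \sum_j (a j * c k) *: (t k *: X j + t j *: X k) =
  (\sum_k c k * t k) *: (\sum_j a j *: X j) + (\sum_j a j * t j) *: (\sum_k c k *: X k).
Proof.
have -> : (\sum_k c k * t k) *: (\sum_j a j *: X j) =
    \sum_k \sum_j (a j * c k) *: (t k *: X j).
  rewrite scaler_suml; apply: eq_bigr => k _; rewrite scaler_sumr.
  by apply: eq_bigr => j _; rewrite !scalerA; congr (_ *: _); ring.
have -> : (\sum_j a j * t j) *: (\sum_k c k *: X k) =
    \sum_k \sum_j (a j * c k) *: (t j *: X k).
  rewrite scaler_sumr; apply: eq_bigr => k _; rewrite scaler_suml.
  by apply: eq_bigr => j _; rewrite !scalerA; congr (_ *: _); ring.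
rewrite -big_split; apply: eq_bigr => k _; rewrite -big_split.
by apply: eq_bigr => j _; rewrite scalerDr.
Qed.

Lemma scale_eq (C : numFieldType) (V : lmodType C) (a b : C) (v : V) :
  a = b -> a *: v = b *: v.
Proof. by move=> ->. Qed.

Lemma scale_delta_sum (C : numFieldType) (V : lmodType C) (I : finType) (c : C)
    (i : I) (v : V) : c *: v = \sum_j (c * (j == i)%:R) *: v.
Proof.
rewrite -scaler_suml -mulr_sumr (bigD1 i) //= eqxx big1 ?addr0 ?mulr1 //.
by move=> j /negPf ->.
Qed.

Section ModeSumGround.
Variables (C : numFieldType) (V : lmodType C).
Variables (A B : int -> V -> V) (g : V).
Hypothesis AL : forall p, linear (A p).
Hypothesis BL : forall p, linear (B p).

(** The positive modes kill g, so that only the product of the two zero modes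
    can contribute. *)
Lemma modesum_ground (sg : bool) (n K : nat) (a b : C) :
  (forall p : nat, A p g = ((p == 0%N)%:R * a) *: g) ->
  (forall p : nat, B p g = ((p == 0%N)%:R * b) *: g) ->
  modesum sg A B n.+1 K.+1 g = ((n == 0%N)%:R * ((-1) ^+ sg * a * b)) *: g.
Proof.
move=> Ag Bg; rewrite /modesum big1 ?add0r => [|j _]; last first.
  rewrite (_ : n.+1%:Z + j%:Z = (n + j).+1%:Z); last by lia.
  by rewrite Bg mul0r scale0r (lin0 (AL _)).
rewrite big_nat_recl // big1 ?addr0 => [|j _]; last first.
  by rewrite Ag mul0r scale0r (lin0 (BL _)).
rewrite [X in B X](_ : _ = n%:Z); last by lia.
by rewrite Ag (linZ (BL _)) Bg !scalerA; congr (_ *: _); rewrite mul1r; ring.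
Qed.

Lemma modesum_ground0 (sg : bool) (n K : nat) :
  (forall p : nat, A p g = 0) -> (forall p : nat, B p g = 0) ->
  modesum sg A B n K g = 0.
Proof.
move=> Ag Bg; rewrite /modesum !big1 ?scaler0 ?addr0 // => j _.
  by rewrite Ag (lin0 (BL _)).
rewrite (_ : n%:Z + j%:Z = (n + j)%N%:Z); last by lia.
by rewrite Bg (lin0 (AL _)).
Qed.
End ModeSumGround.

Section Virasoro.
Variables (C : numFieldType) (G : 'M[int]_4).
Variable eps : lattice -> lattice -> int.
Hypothesis eps0 : forall l, eps 0 l = 1.
Hypothesis GT : G^T = G.
Local Notation V := (VNS C).
Local Notation bos := (@bos C G).
Local Notation ferm := (@ferm C).
Implicit Types (v w : V) (A B : int -> V -> V).

Let bosL x := @bos_linear C G x.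
Let bosT x := @bos_truncated C G x.
Let fermL b i := @ferm_linear C b i.
Let fermT b i := @ferm_truncated C b i.
Let dfermL b i := dfield_linear (fermL b i).
Let dfermT b i := dfield_truncated (fermT b i).

Variables hp hm : 2.-tuple 'rV[C]_4.
Local Notation Qbos := (@Qbos C G eps).
Local Notation Lop := (@Lop C G eps hp hm).

Lemma LopE v : Lop 0 v =
  \sum_i \sum_k \sum_j ((tnth hp i) 0 j * (tnth hm i) 0 k) *: Qbos j k v +
  2%:R^-1 *: \sum_i Lferm i v.
Proof.
have YL := Y_linearl G eps 1 v.
rewrite /Defs.Lop /omega (linD YL) (linZ YL) !(lin_sum _ _ _ YL).
congr (_ + _ *: _); apply: eq_bigr => i _.
  have -> : bos (tnth hp i) (-1) (bos (tnth hm i) (-1) (vac C)) =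
      \sum_k \sum_j ((tnth hp i) 0 j * (tnth hm i) 0 k) *:
        ket 0 ((j, 0%N) +` ((k, 0%N) +` mset0))%mset fset0.
    have -> : bos (tnth hm i) (-1) (vac C) =
        \sum_k (tnth hm i) 0 k *: ket 0 ((k, 0%N) +` mset0)%mset fset0.
      by rewrite vacE; exact: bos_neg_ket.
    rewrite (lin_sum _ _ _ (bosL _ _)); apply: eq_bigr => k _.
    rewrite (linZ (bosL _ _)) (bos_neg_ket G (tnth hp i) 0) scaler_sumr.
    by apply: eq_bigr => j _; rewrite scalerA mulrC.
  rewrite (lin_sum _ _ _ YL); apply: eq_bigr => k _.
  rewrite (lin_sum _ _ _ YL); apply: eq_bigr => j _.
  by rewrite (linZ YL) Y_ket.
rewrite (linD YL).
have -> : ferm false i (-2) (ferm true i (-1) (vac C)) =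
    ket 0 mset0 ((false, i, 1%N) |` [fset (true, i, 0%N)])%fset.
  rewrite vacE (ferm_neg true i 0 _) upF_vac (ferm_neg false i 1 _) upF_ket.
  by rewrite in_fset1 wedge_sign1 [X in X *: _]expr0 scale1r.
have -> : ferm true i (-2) (ferm false i (-1) (vac C)) =
    -1 *: ket 0 mset0 ((false, i, 0%N) |` [fset (true, i, 1%N)])%fset.
  rewrite vacE (ferm_neg false i 0 _) upF_vac (ferm_neg true i 1 _) upF_ket.
  by rewrite in_fset1 wedge_sign1 [X in X *: _]expr1 fsetUC.
rewrite (linZ YL) scaleN1r !Y_ket.
rewrite (Ybasis_ferm_ferm _ eps0 1 (divderiv0 _) (fermL _ _) (fermT _ _)).
rewrite (Ybasis_ferm_ferm _ eps0 0 (divderiv1 _) (dfermL _ _) (dfermT _ _)).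
have eA := congr1 (fun A => nop true A (ferm true i) 1 v) (divderiv1 (ferm false i)).
have eB := congr1 (fun A => nop true A (dfield (ferm true i)) 1 v)
  (divderiv0 (ferm false i)).
by rewrite [X in X - _]eA [X in _ - X]eB.
Qed.

Lemma Lop_bos x m w : Lop 0 (bos x m w) = bos x m (Lop 0 w) -
  m%:~R *: \sum_i (hform G (tnth hm i) x *: bos (tnth hp i) m w +
                   hform G (tnth hp i) x *: bos (tnth hm i) m w).
Proof.
rewrite !LopE (linD (bosL x m)) (linZ (bosL x m)) !(lin_sum _ _ _ (bosL x m)).
rewrite addrAC; congr (_ + _ *: _); last first.
  by apply: eq_bigr => i _; exact: Lferm_bos.
rewrite scaler_sumr -sumrB; apply: eq_bigr => i _.
rewrite (bos_base G (tnth hp i) m w) (bos_base G (tnth hm i) m w).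
rewrite (hform_basel GT (tnth hp i)) (hform_basel GT (tnth hm i)).
rewrite -bilinear_split (lin_sum _ _ _ (bosL x m)) scaler_sumr -sumrB.
apply: eq_bigr => k _; rewrite (lin_sum _ _ _ (bosL x m)) scaler_sumr -sumrB.
apply: eq_bigr => j _; rewrite (linZ (bosL x m)) (Qbos_bos eps0 GT j k x m w).
by rewrite scalerBr !scalerA [_ * m%:~R]mulrC.
Qed.

Lemma Lop_ferm b i m w : Lop 0 (ferm b i m w) = ferm b i m (Lop 0 w) -
  (2%:R^-1 * (2 * m + 1)%:~R) *: ferm b i m w.
Proof.
rewrite !LopE (linD (fermL b i m)) (linZ (fermL b i m)) !(lin_sum _ _ _ (fermL b i m)).
rewrite -addrA; congr (_ + _).
  apply: eq_bigr => j _; rewrite (lin_sum _ _ _ (fermL b i m)).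
  apply: eq_bigr => k _; rewrite (lin_sum _ _ _ (fermL b i m)).
  apply: eq_bigr => l _; rewrite (linZ (fermL b i m)).
  by rewrite (Qbos_ferm _ eps0 l k b i m w).
rewrite -scalerA -scalerBr; congr (_ *: _).
have -> : (2 * m + 1)%:~R *: ferm b i m w =
    \sum_j ((2 * m + 1)%:~R * (j == i)%:R) *: ferm b i m w.
  exact: scale_delta_sum.
rewrite -sumrB; apply: eq_bigr => j _; exact: Lferm_ferm.
Qed.

Section Ground.
Variable l : lattice.
Let g : V := ket l mset0 fset0.

Lemma bos_ground x (p : nat) : bos x p g = ((p == 0%N)%:R * hform G x (hlat C l)) *: g.
Proof.
case: p => [|p]; first by rewrite mul1r; exact: bos_zero.
rewrite (bos_pos G x p g) mul0r scale0r big1 // => i _.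
by rewrite dnB_ket mset0E scale0r scaler0.
Qed.

Lemma ferm_ground b i (p : nat) : ferm b i p g = 0.
Proof. by rewrite (ferm_pos b i p g) dnF_ket in_fset0. Qed.

Lemma dferm_ground b i (p : nat) : dfield (ferm b i) p g = 0.
Proof.
rewrite /dfield; case: p => [|p]; first by rewrite oppr0 scale0r.
by rewrite (_ : p.+1%:Z - 1 = p) ?ferm_ground ?scaler0 //; lia.
Qed.

Lemma nop_ground (sg : bool) A B (n : nat) (a b : C) :
  (forall p, linear (A p)) -> (forall p, linear (B p)) ->
  truncated A -> truncated B ->
  (forall p : nat, A p g = ((p == 0%N)%:R * a) *: g) ->
  (forall p : nat, B p g = ((p == 0%N)%:R * b) *: g) ->
  nop sg A B n.+1 g = ((n == 0%N)%:R * ((-1) ^+ sg * a * b)) *: g.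
Proof.
move=> AL BL At Bt Ag Bg.
have [K0 e] := nopE sg n.+1 g AL BL At Bt.
exact: etrans (e K0.+1 (leqnSn _)) (modesum_ground AL BL sg n K0 Ag Bg).
Qed.

Lemma nop_ground0 (sg : bool) A B (n : nat) :
  (forall p, linear (A p)) -> (forall p, linear (B p)) ->
  truncated A -> truncated B ->
  (forall p : nat, A p g = 0) -> (forall p : nat, B p g = 0) ->
  nop sg A B n g = 0.
Proof.
move=> AL BL At Bt Ag Bg.
have [K0 e] := nopE sg n g AL BL At Bt.
exact: etrans (e K0 (leqnn _)) (modesum_ground0 AL BL sg n K0 Ag Bg).
Qed.

Lemma Gplus_ground (n : nat) : Gplus G eps hp n g = 0.
Proof.
rewrite (GplusE G eps0) big1 // => i _; rewrite -PoszD addn1.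
rewrite (@nop_ground false _ _ n (hform G (tnth hp i) (hlat C l)) 0 (bosL _)
  (fermL _ _) (bosT _) (fermT _ _) (bos_ground _)) => [|p].
  by rewrite !mulr0 scale0r.
by rewrite mulr0 scale0r; exact: ferm_ground.
Qed.

Lemma Gminus_ground (n : nat) : Gminus G eps hm n g = 0.
Proof.
rewrite (GminusE G eps0) big1 // => i _; rewrite -PoszD addn1.
rewrite (@nop_ground false _ _ n (hform G (tnth hm i) (hlat C l)) 0 (bosL _)
  (fermL _ _) (bosT _) (fermT _ _) (bos_ground _)) => [|p].
  by rewrite !mulr0 scale0r.
by rewrite mulr0 scale0r; exact: ferm_ground.
Qed.

Lemma Jop_ground (n : nat) : Jop G eps n g = 0.
Proof.
rewrite (JopE G eps0) big1 // => i _.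
exact: (nop_ground0 true n (fermL _ _) (fermL _ _) (fermT _ _) (fermT _ _)
  (ferm_ground _ _) (ferm_ground _ _)).
Qed.

Lemma Qbos_ground j k : Qbos j k g =
  (hform G (hbase C j) (hlat C l) * hform G (hbase C k) (hlat C l)) *: g.
Proof.
have nbb x y : nop false (bos x) (bos y) 1 g =
    (hform G x (hlat C l) * hform G y (hlat C l)) *: g.
  rewrite (nop_ground false 0 (bosL x) (bosL y) (bosT x) (bosT y)
    (bos_ground x) (bos_ground y)).
  by rewrite expr0 !mul1r.
have [e|e] := Ybasis_bos_bos C G eps0 j k.
  exact: etrans (congr1 (fun F => F 1 g) e) (nbb _ _).
rewrite [X in _ = X *: _]mulrC.
exact: etrans (congr1 (fun F => F 1 g) e) (nbb _ _).
Qed.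

Lemma Lop_ground : Lop 0 g = (\sum_i hform G (tnth hp i) (hlat C l) *
  hform G (tnth hm i) (hlat C l)) *: g.
Proof.
rewrite LopE [X in _ + _ *: X]big1 ?scaler0 ?addr0 => [|i _]; last first.
  rewrite /Lferm (nop_ground0 true 1 (dfermL _ _) (fermL _ _) (dfermT _ _) (fermT _ _)
    (dferm_ground _ _) (ferm_ground _ _)).
  rewrite (nop_ground0 true 1 (fermL _ _) (dfermL _ _) (fermT _ _) (dfermT _ _)
    (ferm_ground _ _) (dferm_ground _ _)).
  exact: subr0.
rewrite scaler_suml; apply: eq_bigr => i _.
rewrite (hform_basel GT (tnth hp i)) (hform_basel GT (tnth hm i)).
rewrite mulr_sumr scaler_suml; apply: eq_bigr => k _.
rewrite mulr_suml scaler_suml; apply: eq_bigr => j _.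
rewrite Qbos_ground scalerA; apply: scale_eq; ring.
Qed.
End Ground.
End Virasoro.

(** * Exponentials of commuting operators *)

Section Exponential.
Variables (C : numFieldType) (W : lmodType C).
Variables (N : C) (B : nat -> W -> W) (v : W).
Hypothesis BL : forall k, linear (B k).

(** Course-of-values recursion: exp_table m holds the coefficients up to the
    m-th one. *)
Fixpoint exp_table (m : nat) : nat -> W :=
  if m is m'.+1 then fun i => if (i <= m')%N then exp_table m' i else
    (N / m'.+1%:R) *: \sum_(0 <= k < m'.+1) B k.+1 (exp_table m' (m' - k)%N)
  else fun => v.

(** The coefficients of exp(N sum_{k>0} B_k z^k / k) v, defined by the recursion
    i e_i = N sum_k B_k e_{i-k}, which avoids sums over products of operators.
    Integer indices with value 0 below 0 make every shift of an index legal. *)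
Definition expseq (i : int) : W := if i is Posz m then exp_table m m else 0.

Lemma exp_table_stable m i : (i <= m)%N -> exp_table m i = exp_table i i.
Proof.
elim: m => [|m IH]; first by rewrite leqn0 => /eqP->.
rewrite leq_eqVlt => /orP[/eqP->//|im] /=; rewrite ltnS in im.
by rewrite im IH.
Qed.

Lemma expseq_neg i : i < 0 -> expseq i = 0.
Proof. by case: i. Qed.

Lemma sum_truncate (F : nat -> W) K K' : (K <= K')%N ->
  (forall j, (K <= j)%N -> F j = 0) ->
  \sum_(0 <= j < K') F j = \sum_(0 <= j < K) F j.
Proof.
move=> KK' F0; rewrite (big_cat_nat _ KK') //=.
rewrite [X in _ + X]big_nat_cond [X in _ + X]big1 ?addr0 //.
by move=> j /andP[/andP[Kj _] _]; exact: F0.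
Qed.

Lemma expseq_rec (K : nat) (i : int) : i <= K%:Z ->
  i%:~R *: expseq i = N *: \sum_(0 <= k < K) B k.+1 (expseq (i - 1 - k%:Z)).
Proof.
case: i => [[|m]|m] iK.
- rewrite scale0r big1 ?scaler0 // => k _; rewrite expseq_neg ?(lin0 (BL _)) //.
  by lia.
- rewrite (@sum_truncate _ m.+1) ?ltz_nat //; last first.
    by move=> j mj; rewrite expseq_neg ?(lin0 (BL _)) //; lia.
  rewrite /expseq /= ltnn scalerA mulrC divfK ?pnatr_eq0 //; congr (_ *: _).
  apply: eq_big_nat => k /andP[_ km].
  rewrite exp_table_stable ?leq_subr // (_ : _ - _ - _ = (m - k)%N%:Z) //.
  by lia.
- rewrite expseq_neg // scaler0 big1 ?scaler0 // => k _.
  by rewrite expseq_neg ?(lin0 (BL _)) //; lia.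
Qed.

(** A sequence is determined by its initial value and its defect in the
    recursion. The identities between exponentials are all obtained by
    comparing defects. *)
Lemma expseq_unique (K : nat) (f g : int -> W) :
  (forall i, i < 0 -> f i = 0) -> (forall i, i < 0 -> g i = 0) -> f 0 = g 0 ->
  (forall i, i <= K%:Z ->
     i%:~R *: f i - N *: (\sum_(0 <= k < K) B k.+1 (f (i - 1 - k%:Z))) =
     i%:~R *: g i - N *: (\sum_(0 <= k < K) B k.+1 (g (i - 1 - k%:Z)))) ->
  forall i, i <= K%:Z -> f i = g i.
Proof.
move=> f0 g0 fg0 fgK; suff fgm m i : (i <= m%:Z) -> i <= K%:Z -> f i = g i.
  by move=> i; apply: (fgm `|i|%N); lia.
elim: m i => [|m IH] i im iK.
  have [i0|i0] := ltP i 0; first by rewrite f0 ?g0.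
  by have -> : i = 0 by lia.
have [i0|i0] := leP i m%:Z; first exact: IH.
have := fgK i iK.
have -> : \sum_(0 <= k < K) B k.+1 (f (i - 1 - k%:Z)) =
    \sum_(0 <= k < K) B k.+1 (g (i - 1 - k%:Z)).
  by apply: eq_bigr => k _; rewrite IH //; lia.
move/addIr/(congr1 (fun w => i%:~R^-1 *: w)).
by rewrite !scalerA mulVf ?scale1r // intr_eq0; lia.
Qed.

Lemma sum_shift (F : nat -> W) r K : (forall j, (K - r <= j)%N -> F j = 0) ->
  \sum_(0 <= k < K) (if (r <= k)%N then F (k - r)%N else 0) = \sum_(0 <= j < K) F j.
Proof.
move=> F0; have [rK|Kr] := leqP r K; last first.
  rewrite [RHS]big1 => [|j _]; last by apply: F0; lia.
  rewrite big_nat_cond big1 // => k /andP[/andP[_ kK] _].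
  by rewrite leqNgt (ltn_trans kK Kr).
rewrite [RHS](@sum_truncate _ (K - r)%N) ?leq_subr //.
rewrite (big_cat_nat _ rK) //= [X in X + _]big_nat_cond [X in X + _]big1 ?add0r; last first.
  by move=> k /andP[/andP[_ kr] _]; rewrite leqNgt kr.
rewrite -{1}(add0n r) big_addn; apply: eq_bigr => k _.
by rewrite leq_addl addnK.
Qed.
End Exponential.

Lemma eq_opp0 (C : numFieldType) (W : lmodType C) (w : W) : w = - w -> w = 0.
Proof.
move=> /eqP; rewrite -subr_eq0 opprK -mulr2n -scaler_nat scaler_eq0.
by rewrite pnatr_eq0 /= => /eqP.
Qed.

(** * Operators creating physical states *)

Lemma scale_eq0 (C : numFieldType) (V : lmodType C) (a : C) (v : V) :
  a = 0 -> a *: v = 0.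
Proof. by move=> ->; rewrite scale0r. Qed.

Section States.
Variables (C : numFieldType) (V : lmodType C).
Variables (Ap Am b c : nat -> V -> V).
Hypothesis ApL : forall k, linear (Ap k).
Hypothesis AmL : forall k, linear (Am k).
Hypothesis bL : forall k, linear (b k).
Hypothesis cL : forall k, linear (c k).
Hypothesis ApAp : forall i j v, Ap i (Ap j v) = Ap j (Ap i v).
Hypothesis AmAm : forall i j v, Am i (Am j v) = Am j (Am i v).
Hypothesis ApAm : forall i j v, Ap i (Am j v) = Am j (Ap i v).
Hypothesis Apb : forall i j v, Ap i (b j v) = b j (Ap i v).
Hypothesis Apc : forall i j v, Ap i (c j v) = c j (Ap i v).
Hypothesis Amb : forall i j v, Am i (b j v) = b j (Am i v).
Hypothesis Amc : forall i j v, Am i (c j v) = c j (Am i v).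
Hypothesis bb : forall i j v, b i (b j v) = - b j (b i v).
Hypothesis cc : forall i j v, c i (c j v) = - c j (c i v).
Hypothesis bc : forall i j v, b i (c j v) = - c j (b i v).

Variable T : V -> Prop.
Hypothesis T0 : T 0.
Hypothesis TD : forall a u v, T u -> T v -> T (a *: u + v).
Hypothesis TAp : forall k v, T v -> T (Ap k v).
Hypothesis TAm : forall k v, T v -> T (Am k v).
Hypothesis Tb : forall k v, T v -> T (b k v).
Hypothesis Tc : forall k v, T v -> T (c k v).

Variables kap kap' : C.
Hypothesis kapD : kap + kap' = -1.
Hypothesis Ap0 : forall v, T v -> Ap 0 v = kap *: v.
Hypothesis Am0 : forall v, T v -> Am 0 v = kap' *: v.

Let B k v := Ap k v + Am k v.

Let BL k : linear (B k).
Proof. by apply: is_linear_add. Qed.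

Variable n : nat.
Let N : C := n%:R.
Local Notation e := (expseq N B).

(** The coefficient of z^n in (N Ap(z) + N^2 z b(z) c(z)) e(z), where e(z) is the
    exponential attached to Ap + Am: a supersymmetric analogue of a DDF
    operator, whose fermionic bilinear term compensates the variation of the
    bosonic one. *)
Definition state_op (v : V) : V :=
  N *: (\sum_(0 <= k < n.+1) Ap k (e v (n%:Z - k%:Z))) +
  (N * N) *: (\sum_(0 <= i < n.+1) \sum_(0 <= j < n.+1)
    b i (c j (e v (n%:Z - 1 - i%:Z - j%:Z)))).

Let TZ a v : T v -> T (a *: v).
Proof. by move=> Tv; rewrite -[_ *: v]addr0; exact: TD. Qed.

Let TDD u v : T u -> T v -> T (u + v).
Proof. by move=> Tu Tv; rewrite -[u]scale1r; exact: TD. Qed.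

Let Tsum (F : nat -> V) K : (forall k, T (F k)) -> T (\sum_(0 <= k < K) F k).
Proof. by move=> TF; elim/big_ind: _ => // *; exact: TDD. Qed.

Let Te v i : T v -> T (e v i).
Proof.
move=> Tv; suff eP m : T (e v m%:Z) by case: i => // m; rewrite expseq_neg.
elim/ltn_ind: m => -[//|m] IH.
have := expseq_rec N v BL (lexx m.+1%:Z) => /(congr1 (fun w => m.+1%:R^-1 *: w)).
rewrite scalerA mulVf ?pnatr_eq0 // scale1r => ->; apply/TZ/TZ/Tsum => k.
suff Tk : T (e v (m.+1%:Z - 1 - k%:Z)) by apply: TDD; [exact: TAp | exact: TAm].
have [km|mk] := leqP k m; last by rewrite expseq_neg //; lia.
by rewrite (_ : _ - _ = (m - k)%N%:Z); [apply: IH; lia | lia].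
Qed.

Lemma state_opT v : T v -> T (state_op v).
Proof.
move=> Tv; apply: TDD; apply: TZ; apply: Tsum => k; first by apply/TAp/Te.
by apply: Tsum => j; apply/Tb/Tc/Te.
Qed.

Lemma state_opE v K : (n < K)%N -> state_op v =
  N *: (\sum_(0 <= k < K) Ap k (e v (n%:Z - k%:Z))) +
  (N * N) *: (\sum_(0 <= i < K) \sum_(0 <= j < K)
    b i (c j (e v (n%:Z - 1 - i%:Z - j%:Z)))).
Proof.
move=> nK; congr (_ *: _ + _ *: _).
  symmetry; apply: sum_truncate => // k kn.
  by rewrite expseq_neg ?(lin0 (ApL _)) //; lia.
symmetry; rewrite (@sum_truncate _ _ _ n.+1 K) // => [|i ni]; last first.
  by rewrite big1 // => j _; rewrite expseq_neg ?(lin0 (cL _)) ?(lin0 (bL _)) //; lia.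
apply: eq_bigr => i _; apply: sum_truncate => // j nj.
by rewrite expseq_neg ?(lin0 (cL _)) ?(lin0 (bL _)) //; lia.
Qed.

Section OddOperator.
Variables (D : V -> V) (x : nat -> V -> V) (r : nat).
Hypothesis DL : linear D.
Hypothesis xL : forall k, linear (x k).
Hypothesis Bx : forall i j v, B i (x j v) = x j (B i v).
Hypothesis DB : forall k w, T w -> D (B k w) =
  B k (D w) + (if (r < k)%N then k%:R *: x (k - r.+1)%N w else 0).

(** If D sends B_k to k x_{k-r-1}, then it sends e(z) to N z^{r+1} x(z) e(z): both
    sides have the same defect in the recursion. *)
Lemma odd_exp v K i : D v = 0 -> T v -> i <= K%:Z ->
  D (e v i) = N *: \sum_(0 <= j < K) x j (e v (i - r.+1%:Z - j%:Z)).
Proof.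
move=> Dv Tv; move: i; apply: (expseq_unique (N := N) (B := B)
  (f := fun i => D (e v i))
  (g := fun i => N *: \sum_(0 <= j < K) x j (e v (i - r.+1%:Z - j%:Z)))).
- by move=> i i0; rewrite expseq_neg ?(lin0 DL).
- move=> i i0; rewrite big1 ?scaler0 // => j _.
  by rewrite expseq_neg ?(lin0 (xL _)) //; lia.
- rewrite [LHS]Dv big1 ?scaler0 // => j _.
  by rewrite expseq_neg ?(lin0 (xL _)) //; lia.
move=> i iK; rewrite -(linZ DL) (expseq_rec N v BL iK) (linZ DL) (lin_sum _ _ _ DL).
rewrite (eq_bigr _ (fun k _ => DB k.+1 (Te _ Tv))) big_split /= scalerDr.
rewrite [X in X - _ = _]addrC addrK.
rewrite (eq_bigr (fun k => if (r <= k)%N then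
   (fun j => (j + r).+1%:R *: x j (e v (i - 1 - r%:Z - j%:Z))) (k - r)%N else 0));
   last first.
  move=> k _; rewrite ltnS; case: (leqP r k) => // rk; rewrite subnK //.
  by rewrite subSS (_ : i - 1 - r%:Z - _ = i - 1 - k%:Z) //; lia.
rewrite (sum_shift (F := fun j => (j + r).+1%:R *: x j (e v (i - 1 - r%:Z - j%:Z))));
  last by move=> j jK; rewrite expseq_neg ?(lin0 (xL _)) ?scaler0 //; lia.
have e1 j : i%:~R *: x j (e v (i - r.+1%:Z - j%:Z)) =
    N *: (\sum_(0 <= k < K) x j (B k.+1 (e v (i - r.+1%:Z - j%:Z - 1 - k%:Z)))) +
    (j + r).+1%:R *: x j (e v (i - 1 - r%:Z - j%:Z)).
  rewrite -(lin_sum _ _ _ (xL j)) -!(linZ (xL j)) -expseq_rec //; last by lia.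
  rewrite (_ : i - 1 - r%:Z - j%:Z = i - r.+1%:Z - j%:Z); last by lia.
  rewrite -(linD (xL j)) -scalerDl; congr (x j (_ *: _)).
  by rewrite pmulrn -rmorphD /=; congr _%:~R; lia.
have -> : i%:~R *: (N *: \sum_(0 <= j < K) x j (e v (i - r.+1%:Z - j%:Z))) =
    N *: \sum_(0 <= j < K) i%:~R *: x j (e v (i - r.+1%:Z - j%:Z)).
  by rewrite -scaler_sumr !scalerA mulrC.
rewrite (eq_bigr _ (fun j _ => e1 j)).
rewrite big_split /= scalerDr.
rewrite [RHS]addrAC -[LHS]add0r; congr (_ + _).
apply/esym/eqP; rewrite subr_eq0; apply/eqP; congr (_ *: _); rewrite -scaler_sumr exchange_big scaler_sumr.
apply: eq_bigr => k _; rewrite (linZ (BL _)) (lin_sum _ _ _ (BL _)).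
congr (_ *: _); apply: eq_bigr => j _; rewrite Bx.
by congr (x j (B _ (e v _))); lia.
Qed.
End OddOperator.

Let Bb i j v : B i (b j v) = b j (B i v).
Proof. by rewrite /B Apb Amb (linD (bL j)). Qed.

Let Bc i j v : B i (c j v) = c j (B i v).
Proof. by rewrite /B Apc Amc (linD (cL j)). Qed.

Let cb i j w : c j (b i w) = - b i (c j w).
Proof. by rewrite bc opprK. Qed.

Lemma antisym_sum K (F : nat -> nat -> V) : (forall i j, F i j = - F j i) ->
  \sum_(0 <= i < K) \sum_(0 <= j < K) F i j = 0.
Proof.
move=> Fanti; apply: eq_opp0; rewrite {1}exchange_big -sumrN.
by apply: eq_bigr => j _; rewrite -sumrN; apply: eq_bigr => i _.
Qed.

(** D turns e into N b e. In the bosonic term this produces Ap b e; in the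
    bilinear term D turns c into Ap, which produces the same with the opposite
    sign, while the part with two factors b vanishes by antisymmetry. *)
Lemma Gplus_state (D : V -> V) r v : linear D ->
  (forall k w, T w -> D (Ap k w) = Ap k (D w)) ->
  (forall k w, T w -> D (Am k w) = Am k (D w) +
     (if (r < k)%N then k%:R *: b (k - r.+1)%N w else 0)) ->
  (forall j w, T w -> D (b j w) = - b j (D w)) ->
  (forall j w, T w -> D (c j w) = - c j (D w) +
     (if (r <= j)%N then Ap (j - r)%N w else 0)) ->
  T v -> D v = 0 -> D (state_op v) = 0.
Proof.
move=> DL DAp DAm Db Dc Tv Dv.
have DB k w : T w -> D (B k w) =
    B k (D w) + (if (r < k)%N then k%:R *: b (k - r.+1)%N w else 0).
  by move=> Tw; rewrite (linD DL) DAp // DAm // addrA.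
pose K := (n + r).+1.
have De i : i <= K%:Z -> D (e v i) = N *: \sum_(0 <= j < K) b j (e v (i - r.+1%:Z - j%:Z)).
  exact: (odd_exp DL bL Bb DB Dv Tv).
rewrite (@state_opE v K) ?ltnS ?leq_addr // (linD DL) !(linZ DL) !(lin_sum _ _ _ DL).
pose S := \sum_(0 <= k < K) \sum_(0 <= j < K) b j (Ap k (e v (n%:Z - r.+1%:Z - j%:Z - k%:Z))).
have -> : \sum_(0 <= k < K) D (Ap k (e v (n%:Z - k%:Z))) = N *: S.
  rewrite scaler_sumr; apply: eq_bigr => k _; rewrite DAp; last exact: Te.
  rewrite De; last by lia.
  rewrite (linZ (ApL k)) (lin_sum _ _ _ (ApL k)); congr (_ *: _).
  apply: eq_bigr => j _; rewrite Apb; congr (b j (Ap k (e v _))); lia.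
suff -> : \sum_(0 <= i < K) D (\sum_(0 <= j < K) b i (c j (e v (n%:Z - 1 - i%:Z - j%:Z)))) = - S.
  by rewrite scalerN scalerA subrr.
have step i j : D (b i (c j (e v (n%:Z - 1 - i%:Z - j%:Z)))) =
    N *: (\sum_(0 <= l < K) b i (c j (b l (e v (n%:Z - 1 - i%:Z - j%:Z - r.+1%:Z - l%:Z))))) -
    (if (r <= j)%N then b i (Ap (j - r)%N (e v (n%:Z - 1 - i%:Z - r%:Z - (j - r)%N%:Z))) else 0).
  rewrite Db; last by apply/Tc/Te.
  rewrite Dc; last exact: Te.
  rewrite (linD (bL i)) (linN (bL i)) opprD opprK De; last by lia.
  rewrite (linZ (cL j)) (linZ (bL i)) (lin_sum _ _ _ (cL j)) (lin_sum _ _ _ (bL i)).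
  congr (_ - _); case: leqP => [rj|_]; last exact: lin0 (bL i).
  by congr (b i (Ap _ (e v _))); lia.
have stepi i : D (\sum_(0 <= j < K) b i (c j (e v (n%:Z - 1 - i%:Z - j%:Z)))) =
    N *: (\sum_(0 <= j < K) \sum_(0 <= l < K)
      b i (c j (b l (e v (n%:Z - 1 - i%:Z - j%:Z - r.+1%:Z - l%:Z))))) -
    \sum_(0 <= k < K) b i (Ap k (e v (n%:Z - r.+1%:Z - i%:Z - k%:Z))).
  rewrite (lin_sum _ _ _ DL) (eq_bigr _ (fun j _ => step i j)) sumrB scaler_sumr.
  congr (_ - _).
  rewrite (sum_shift (F := fun k => b i (Ap k (e v (n%:Z - 1 - i%:Z - r%:Z - k%:Z))))).
    by apply: eq_bigr => k _; congr (b i (Ap k (e v _))); lia.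
  move=> k kK; rewrite expseq_neg ?(lin0 (ApL _)) ?(lin0 (bL _)) //; lia.
rewrite (eq_bigr _ (fun i _ => stepi i)) sumrB -scaler_sumr.
rewrite [X in _ *: X](_ : _ = 0) ?scaler0 ?add0r; last first.
  rewrite exchange_big big1 // => j _; apply: antisym_sum => i l.
  rewrite !cb !(linN (bL _)) bb !opprK; congr (b l (b i (c j (e v _)))).
  by lia.
by rewrite /S exchange_big.
Qed.

(** D turns Ap and e into multiples of c and b into Am. The terms with two
    factors c cancel by antisymmetry, and the others combine to c_j times
    sum_k (Ap + Am)_k e. By the recursion the part k > 0 of this sum is a multiple
    of e, and the part k = 0 is the scalar kap + kap' = -1; the two add up to the
    opposite of the contribution of D on Ap. *)
Lemma Gminus_state (D : V -> V) r v : linear D ->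
  (forall k w, T w -> D (Am k w) = Am k (D w)) ->
  (forall k w, T w -> D (Ap k w) = Ap k (D w) +
     (if (r < k)%N then k%:R *: c (k - r.+1)%N w else 0)) ->
  (forall j w, T w -> D (c j w) = - c j (D w)) ->
  (forall j w, T w -> D (b j w) = - b j (D w) +
     (if (r <= j)%N then Am (j - r)%N w else 0)) ->
  T v -> D v = 0 -> D (state_op v) = 0.
Proof.
move=> DL DAm DAp Dc Db Tv Dv.
have DB k w : T w -> D (B k w) =
    B k (D w) + (if (r < k)%N then k%:R *: c (k - r.+1)%N w else 0).
  by move=> Tw; rewrite (linD DL) DAp // DAm // addrAC.
pose K := (n + r).+1.
have De i : i <= K%:Z -> D (e v i) = N *: \sum_(0 <= j < K) c j (e v (i - r.+1%:Z - j%:Z)).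
  exact: (odd_exp DL cL Bc DB Dv Tv).
rewrite (@state_opE v K) ?ltnS ?leq_addr // (linD DL) !(linZ DL) !(lin_sum _ _ _ DL).
pose M j := n%:Z - r.+1%:Z - j%:Z : int.
have -> : \sum_(0 <= k < K) D (Ap k (e v (n%:Z - k%:Z))) =
    N *: (\sum_(0 <= j < K) \sum_(0 <= k < K) c j (Ap k (e v (M j - k%:Z)))) +
    \sum_(0 <= j < K) (j + r.+1)%:R *: c j (e v (M j)).
  have step k : D (Ap k (e v (n%:Z - k%:Z))) =
      N *: (\sum_(0 <= j < K) c j (Ap k (e v (M j - k%:Z)))) +
      (if (r.+1 <= k)%N then
        (fun j => (j + r.+1)%:R *: c j (e v (M j))) (k - r.+1)%N else 0).
    rewrite DAp; last exact: Te.
    rewrite De; last by lia.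
    rewrite (linZ (ApL k)) (lin_sum _ _ _ (ApL k)); congr (_ *: _ + _).
      apply: eq_bigr => j _; rewrite Apc; congr (c j (Ap k (e v _))).
      by rewrite /M; lia.
    case: leqP => // rk; rewrite subnK //; congr (_ *: c _ (e v _)).
    by rewrite /M; lia.
  rewrite (eq_bigr _ (fun k _ => step k)) big_split /= -scaler_sumr exchange_big.
  congr (_ + _); rewrite (sum_shift (F := fun j => (j + r.+1)%:R *: c j (e v (M j)))) //.
  by move=> j jK; rewrite expseq_neg ?(lin0 (cL _)) ?scaler0 // /M; lia.
have step i j : D (b i (c j (e v (n%:Z - 1 - i%:Z - j%:Z)))) =
    N *: (\sum_(0 <= l < K) b i (c j (c l (e v (n%:Z - 1 - i%:Z - j%:Z - r.+1%:Z - l%:Z))))) +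
    (if (r <= i)%N then (fun k => c j (Am k (e v (M j - k%:Z)))) (i - r)%N else 0).
  rewrite Db; last by apply/Tc/Te.
  rewrite Dc; last exact: Te.
  rewrite (linN (bL i)) opprK De; last by lia.
  rewrite (linZ (cL j)) (linZ (bL i)) (lin_sum _ _ _ (cL j)) (lin_sum _ _ _ (bL i)).
  congr (_ + _); case: leqP => // ri; rewrite Amc.
  by congr (c j (Am _ (e v _))); rewrite /M; lia.
have stepj j : \sum_(0 <= i < K) D (b i (c j (e v (n%:Z - 1 - i%:Z - j%:Z)))) =
    N *: (\sum_(0 <= i < K) \sum_(0 <= l < K)
      b i (c j (c l (e v (n%:Z - 1 - i%:Z - j%:Z - r.+1%:Z - l%:Z))))) +
    \sum_(0 <= k < K) c j (Am k (e v (M j - k%:Z))).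
  rewrite (eq_bigr _ (fun i _ => step i j)) big_split /= -scaler_sumr; congr (_ + _).
  rewrite (sum_shift (F := fun k => c j (Am k (e v (M j - k%:Z))))) // => k kK.
  by rewrite expseq_neg ?(lin0 (AmL _)) ?(lin0 (cL _)) // /M; lia.
have -> : \sum_(0 <= i < K) D (\sum_(0 <= j < K) b i (c j (e v (n%:Z - 1 - i%:Z - j%:Z)))) =
    \sum_(0 <= j < K) \sum_(0 <= k < K) c j (Am k (e v (M j - k%:Z))).
  under eq_bigr do rewrite (lin_sum _ _ _ DL).
  rewrite exchange_big (eq_bigr _ (fun j _ => stepj j)) big_split /= -scaler_sumr.
  rewrite [X in _ *: X](_ : _ = 0) ?scaler0 ?add0r // exchange_big big1 // => i _.
  apply: antisym_sum => j l; rewrite cc (linN (bL _)); congr (- b i (c l (c j (e v _)))).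
  by lia.
set S1 := \sum_(0 <= j < K) _; set S2 := \sum_(0 <= j < K) _ *: _.
set S3 := \sum_(0 <= j < K) _.
have -> : N *: (N *: S1 + S2) + (N * N) *: S3 = N *: (N *: (S1 + S3) + S2).
  by rewrite -scalerA -scalerDr addrAC -scalerDr.
rewrite (_ : N *: (S1 + S3) + S2 = 0) ?scaler0 //.
rewrite /S1 /S2 /S3 -big_split /= scaler_sumr -big_split big1 //= => j _.
have -> : \sum_(0 <= k < K) c j (Ap k (e v (M j - k%:Z))) +
    \sum_(0 <= k < K) c j (Am k (e v (M j - k%:Z))) =
    c j (\sum_(0 <= k < K) B k (e v (M j - k%:Z))).
  rewrite -big_split (lin_sum _ _ _ (cL j)); apply: eq_bigr => k _.
  by rewrite /= -(linD (cL j)).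
rewrite -!(linZ (cL j)) -(linD (cL j)) (_ : _ + _ = 0) ?(lin0 (cL j)) //.
rewrite /K big_nat_recl // subr0 scalerDr.
have -> : \sum_(0 <= k < n + r) B k.+1 (e v (M j - k.+1%:Z)) =
    \sum_(0 <= k < n + r) B k.+1 (e v (M j - 1 - k%:Z)).
  by apply: eq_bigr => k _; congr (B _ (e v _)); lia.
rewrite -expseq_rec //; last by rewrite /M; lia.
rewrite /B Ap0 ?Am0; [|exact: Te..].
rewrite -scalerDl kapD scalerA -!scalerDl.
apply: scale_eq0; rewrite /N /M !pmulrn mulrN1 -rmorphN -!rmorphD /=.
by rewrite (_ : _ + _ = 0) //; lia.
Qed.

(** b and c carry opposite charges, and the sums over their indices are invariant
    under the shift by m. *)
Lemma current_state (D : V -> V) m v : linear D ->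
  (forall k w, T w -> D (Ap k w) = Ap k (D w)) ->
  (forall k w, T w -> D (Am k w) = Am k (D w)) ->
  (forall j w, T w -> D (b j w) = b j (D w) +
     (if (m <= j)%N then b (j - m)%N w else 0)) ->
  (forall j w, T w -> D (c j w) = c j (D w) -
     (if (m <= j)%N then c (j - m)%N w else 0)) ->
  T v -> D v = 0 -> D (state_op v) = 0.
Proof.
move=> DL DAp DAm Db Dc Tv Dv.
have De i : D (e v i) = 0.
  suff De' k : i <= k%:Z -> D (e v i) = 0 by apply: (De' `|i|%N); lia.
  move: i; apply: (expseq_unique (N := N) (B := B) (f := fun i => D (e v i))
    (g := fun=> 0)) => [i i0|//||i ik].
  - by rewrite expseq_neg // (lin0 DL).
  - exact: Dv.
  rewrite -(linZ DL) (expseq_rec N v BL ik) (linZ DL) (lin_sum _ _ _ DL).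
  rewrite [X in _ = _ - N *: X]big1 => [|l _]; last by rewrite (lin0 (BL _)).
  rewrite scaler0 scaler0 subr0; apply/eqP; rewrite subr_eq0; apply/eqP.
  congr (_ *: _); apply: eq_bigr => l _; rewrite /B (linD DL) DAp ?DAm //; exact: Te.
pose K := (n + m).+1.
rewrite (@state_opE v K) ?ltnS ?leq_addr // (linD DL) !(linZ DL) !(lin_sum _ _ _ DL).
rewrite big1 ?scaler0 ?add0r => [|k _]; last first.
  by rewrite DAp ?De ?(lin0 (ApL _)) //; exact: Te.
pose F i j := b i (c j (e v (n%:Z - 1 - m%:Z - i%:Z - j%:Z))).
have step i j : D (b i (c j (e v (n%:Z - 1 - i%:Z - j%:Z)))) =
    (if (m <= i)%N then F (i - m)%N j else 0) -
    (if (m <= j)%N then F i (j - m)%N else 0).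
  rewrite Db; last by apply/Tc/Te.
  rewrite Dc; last exact: Te.
  rewrite De (lin0 (cL j)) (linD (bL i)) (lin0 (bL i)) add0r (linN (bL i)) addrC.
  congr (_ - _).
    by case: leqP => // mi; rewrite /F; congr (b _ (c _ (e v _))); lia.
  case: leqP => // mj; last exact: lin0 (bL i).
  by rewrite /F; congr (b _ (c _ (e v _))); lia.
have F0 i j : (K - m <= i)%N || (K - m <= j)%N -> F i j = 0.
  by move=> ij; rewrite /F expseq_neg ?(lin0 (cL _)) ?(lin0 (bL _)) //; lia.
have sh1 j : \sum_(0 <= i < K) (if (m <= i)%N then F (i - m)%N j else 0) =
    \sum_(0 <= i < K) F i j.
  by apply: (sum_shift (F := F^~ j)) => i iK; rewrite F0 ?iK.
have sh2 i : \sum_(0 <= j < K) (if (m <= j)%N then F i (j - m)%N else 0) =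
    \sum_(0 <= j < K) F i j.
  by apply: (sum_shift (F := F i)) => j jK; rewrite F0 ?jK ?orbT.
rewrite [X in _ *: X](_ : _ = 0) ?scaler0 //.
rewrite (eq_bigr (fun i => \sum_(0 <= j < K) ((if (m <= i)%N then F (i - m)%N j else 0) -
    (if (m <= j)%N then F i (j - m)%N else 0)))) => [|i _]; last first.
  by rewrite (lin_sum _ _ _ DL); apply: eq_bigr => j _.
rewrite (eq_bigr _ (fun i _ => sumrB _ _ _ _)) sumrB (eq_bigr _ (fun i _ => sh2 i)).
by rewrite exchange_big (eq_bigr _ (fun j _ => sh1 j)) exchange_big subrr.
Qed.

Lemma energy_state (D : V -> V) v (lam : C) : linear D ->
  (forall k w, T w -> D (Ap k w) = Ap k (D w) + k%:R *: Ap k w) ->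
  (forall k w, T w -> D (Am k w) = Am k (D w) + k%:R *: Am k w) ->
  (forall j w, T w -> D (b j w) = b j (D w) + (j%:R + 2%:R^-1) *: b j w) ->
  (forall j w, T w -> D (c j w) = c j (D w) + (j%:R + 2%:R^-1) *: c j w) ->
  T v -> D v = lam *: v -> D (state_op v) = (lam + N) *: state_op v.
Proof.
move=> DL DAp DAm Db Dc Tv Dv.
have De i : D (e v i) = (lam + i%:~R) *: e v i.
  suff De' k : i <= k%:Z -> D (e v i) = (lam + i%:~R) *: e v i.
    by apply: (De' `|i|%N); lia.
  move: i; apply: (expseq_unique (N := N) (B := B) (f := fun i => D (e v i))
    (g := fun i => (lam + i%:~R) *: e v i)) => [i i0|i i0||i ik].
  - by rewrite expseq_neg // (lin0 DL).
  - by rewrite expseq_neg // scaler0.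
  - by rewrite addr0; exact: Dv.
  transitivity (N *: (\sum_(0 <= l < k) l.+1%:R *: B l.+1 (e v (i - 1 - l%:Z)))).
    rewrite -(linZ DL) (expseq_rec N v BL ik) (linZ DL) (lin_sum _ _ _ DL).
    rewrite -scalerBr -sumrB; congr (_ *: _); apply: eq_bigr => l _.
    rewrite /B (linD DL) DAp ?DAm; [|exact: Te..].
    by rewrite addrACA -scalerDr [X in X - _]addrC addrK.
  have -> : i%:~R *: ((lam + i%:~R) *: e v i) =
      N *: ((lam + i%:~R) *: \sum_(0 <= l < k) B l.+1 (e v (i - 1 - l%:Z))).
    rewrite [LHS]scalerA [X in X *: _ = _]mulrC -[LHS]scalerA (expseq_rec N v BL ik).
    by rewrite !scalerA mulrC.
  rewrite -scalerBr; congr (_ *: _); rewrite scaler_sumr -sumrB; apply: eq_bigr => l _.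
  rewrite (linZ (BL _)) -scalerBl; congr (_ *: _).
  by rewrite !rmorphB /= -pmulrn; ring.
rewrite /state_op (linD DL) !(linZ DL) !(lin_sum _ _ _ DL) scalerDr.
rewrite !scalerA ![(lam + N) * _]mulrC -!scalerA; congr (_ *: _ + _ *: (_ *: _)).
  rewrite scaler_sumr; apply: eq_bigr => k _.
  rewrite DAp; last exact: Te.
  rewrite De (linZ (ApL k)) -scalerDl; congr (_ *: _).
  by rewrite rmorphB /= -!pmulrn /N; ring.
rewrite scaler_sumr; apply: eq_bigr => i _.
rewrite (lin_sum _ _ _ DL) scaler_sumr; apply: eq_bigr => j _.
rewrite Db; last by apply/Tc/Te.
rewrite Dc; last exact: Te.
rewrite De !(linZ (cL j)) (linD (bL i)) !(linZ (bL i)) -!scalerDl; congr (_ *: _).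
rewrite !rmorphB /= -!pmulrn /N rmorph1.
have two : 2%:R^-1 + 2%:R^-1 = 1 :> C by field.
transitivity (lam + n%:R + (2%:R^-1 + 2%:R^-1 - 1)); first by ring.
by rewrite two subrr addr0.
Qed.
End States.

(** * Functionals vanishing on exact states *)

Section Functional.
Variables (C : numFieldType) (V : lmodType C) (u : {poly C}).
Variable Lam : V -> {poly C}.
Hypothesis LamL : linear Lam.
Variables hp2 hm2 a2 a2s : nat -> V -> V.
Hypothesis hp2L : forall k, linear (hp2 k).
Hypothesis hm2L : forall k, linear (hm2 k).
Hypothesis a2L : forall k, linear (a2 k).
Hypothesis a2sL : forall k, linear (a2s k).

Local Notation w_ s := (u^`N(s)).

(** The alternating signs and the choice of coefficients make the functional
    vanish on the images of the supercharges when g = 1. A general weight g is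
    needed because applying a creation operator multiplies the weight. Both sums
    are finite on a given vector, and K is a bound for them. *)
Definition Psi (K : nat) (g : {poly C}) (v : V) : C :=
  \sum_(0 <= k < K) (-1) ^+ k * (g * Lam (hp2 k.+1 v))`_k.+1 +
  \sum_(0 <= m < K) \sum_(0 <= s < K) (-1) ^+ m * (g * (w_ s * Lam (a2 s (a2s m v))))`_m.

Section Exactness.
Hypothesis a2_hp2 : forall s k w, a2 s (hp2 k w) = hp2 k (a2 s w).
Hypothesis a2_a2s : forall s m w, a2 s (a2s m w) = - a2s m (a2 s w).
Hypothesis a2_a2 : forall s t w, a2 s (a2 t w) = - a2 t (a2 s w).
Hypothesis a2s_hm2 : forall s k w, a2s s (hm2 k w) = hm2 k (a2s s w).
Hypothesis Lam_hp2 : forall w, Lam (hp2 0 w) = 0.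
Hypothesis Lam_deriv : forall w K, (forall s, (K <= s)%N -> hm2 s w = 0) ->
  \sum_(0 <= s < K) w_ s * Lam (hm2 s w) = (Lam w)^`().

Variables Gp Gm : V -> V.
Hypothesis GpL : linear Gp.
Hypothesis GmL : linear Gm.
Hypothesis Lam_Gp : forall w K, (forall s, (K <= s)%N -> a2 s w = 0) ->
  Lam (Gp w) = \sum_(0 <= s < K) w_ s * Lam (a2 s w).
Hypothesis hp2_Gp : forall k w, hp2 k (Gp w) = Gp (hp2 k w).
Hypothesis a2s_Gp : forall m w, a2s m (Gp w) = - Gp (a2s m w) + hp2 m w.
Hypothesis a2_Gp : forall s w, a2 s (Gp w) = - Gp (a2 s w).
Hypothesis Lam_Gm : forall w, Lam (Gm w) = 0.
Hypothesis hp2_Gm : forall k w, hp2 k.+1 (Gm w) = Gm (hp2 k.+1 w) + k.+1%:R *: a2s k w.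
Hypothesis a2s_Gm : forall m w, a2s m (Gm w) = - Gm (a2s m w).
Hypothesis a2_Gm : forall s w, a2 s (Gm w) = - Gm (a2 s w) + hm2 s w.

(** With F m the coefficient of index m built from a2 s (hp2 m w), the first sum
    is - F 1 - ... - F K and the second one is F 0 + ... + F (K - 1), where F 0
    and F K vanish. *)
Lemma Psi_Gp w K : (forall s, (K <= s)%N -> a2 s w = 0) ->
  (forall s, (K <= s)%N -> hp2 s w = 0) -> Psi K 1 (Gp w) = 0.
Proof.
move=> aK hK; rewrite /Psi.
pose F m := \sum_(0 <= s < K) (-1) ^+ m * (w_ s * Lam (a2 s (hp2 m w)))`_m.
have F0 : F 0%N = 0.
  by rewrite /F big1 // => s _; rewrite a2_hp2 Lam_hp2 mulr0 coef0 mulr0.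
have FK : F K = 0.
  rewrite /F big1 // => s _; rewrite hK // (lin0 (a2L s)) (lin0 LamL).
  by rewrite mulr0 coef0 mulr0.
have e1 k : (-1) ^+ k * (1 * Lam (hp2 k.+1 (Gp w)))`_k.+1 = - F k.+1.
  rewrite mul1r hp2_Gp (Lam_Gp (K := K)) => [|s Ks]; last first.
    by rewrite a2_hp2 aK // (lin0 (hp2L _)).
  rewrite coef_sum mulr_sumr -sumrN; apply: eq_bigr => s _.
  by rewrite exprS mulN1r mulNr opprK.
have e2 m : \sum_(0 <= s < K) (-1) ^+ m * (1 * (w_ s * Lam (a2 s (a2s m (Gp w)))))`_m = F m.
  pose H := \sum_(0 <= s < K) \sum_(0 <= t < K)
    w_ s * (w_ t * Lam (a2 t (a2 s (a2s m w)))).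
  have H0 : H = 0.
    apply: eq_opp0; rewrite {1}/H exchange_big -sumrN; apply: eq_bigr => s _.
    rewrite -sumrN; apply: eq_bigr => t _; rewrite a2_a2 (linN LamL).
    by rewrite !mulrN mulrCA.
  transitivity (F m + (-1) ^+ m * H`_m); last by rewrite H0 coef0 mulr0 addr0.
  rewrite /F /H coef_sum mulr_sumr -big_split; apply: eq_bigr => s _ /=.
  rewrite mul1r a2s_Gp (linD (a2L s)) (linN (a2L s)) a2_Gp opprK (linD LamL).
  rewrite (Lam_Gp (K := K)) => [|t Kt]; last first.
    by rewrite a2_a2 a2_a2s aK // (lin0 (a2sL _)) oppr0 (lin0 (a2L _)) oppr0.
  by rewrite mulrDr coefD mulrDr addrC mulr_sumr.
rewrite (eq_bigr _ (fun k _ => e1 k)) (eq_bigr _ (fun m _ => e2 m)) sumrN.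
have -> : \sum_(0 <= k < K) F k.+1 = \sum_(0 <= m < K.+1) F m.
  by rewrite big_nat_recl // F0 add0r.
by rewrite big_nat_recr //= FK addr0 addNr.
Qed.

(** The second sum contains the m-th coefficient of the derivative of Lam, that
    is m + 1 times the next coefficient of Lam, which is what the commutator of
    hp2 with Gm contributes to the first sum. *)
Lemma Psi_Gm w K : (forall m, (K <= m)%N -> a2s m w = 0) ->
  (forall s, (K <= s)%N -> hm2 s w = 0) -> Psi K 1 (Gm w) = 0.
Proof.
move=> aK hK; rewrite /Psi -big_split big1 //= => m _.
rewrite mul1r hp2_Gm (linD LamL) Lam_Gm add0r (linZ LamL) coefZ.
have -> : \sum_(0 <= s < K) (-1) ^+ m * (1 * (w_ s * Lam (a2 s (a2s m (Gm w)))))`_m =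
    - ((-1) ^+ m * (\sum_(0 <= s < K) w_ s * Lam (hm2 s (a2s m w)))`_m).
  rewrite coef_sum mulr_sumr -sumrN; apply: eq_bigr => s _.
  rewrite mul1r a2s_Gm (linN (a2L s)) a2_Gm opprD opprK (linD LamL) Lam_Gm add0r.
  by rewrite (linN LamL) mulrN coefN mulrN.
rewrite Lam_deriv => [|s Ks]; last by rewrite -a2s_hm2 hK // (lin0 (a2sL m)).
by rewrite coef_deriv mulr_natl subrr.
Qed.
End Exactness.

Section Evaluation.
Variables (Ap Am b c : nat -> V -> V) (n : nat) (kap kap' y : C).
Hypothesis ApL : forall k, linear (Ap k).
Hypothesis AmL : forall k, linear (Am k).
Hypothesis bL : forall k, linear (b k).
Hypothesis cL : forall k, linear (c k).
Hypothesis kapD : kap + kap' = -1.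
Hypothesis Lam_Ap0 : forall w, Lam (Ap 0%N w) = kap *: Lam w.
Hypothesis Lam_Ap : forall k w, Lam (Ap k.+1 w) = w_ k * Lam w.
Hypothesis Lam_Am : forall k w, Lam (Am k.+1 w) = 0.
Hypothesis Lam_b : forall j w, Lam (b j w) = 0.
Hypothesis Lam_c : forall j w, Lam (c j w) = 0.
Hypothesis hp2_Ap : forall k j w, hp2 k (Ap j w) = Ap j (hp2 k w).
Hypothesis hp2_Am : forall k j w,
  hp2 k (Am j w) = Am j (hp2 k w) + ((j == k)%:R * (k%:R * y)) *: w.
Hypothesis hp2_b : forall k j w, hp2 k (b j w) = b j (hp2 k w).
Hypothesis a2s_Ap : forall k j w, a2s k (Ap j w) = Ap j (a2s k w).
Hypothesis a2s_Am : forall k j w, a2s k (Am j w) = Am j (a2s k w).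
Hypothesis a2_Ap : forall k j w, a2 k (Ap j w) = Ap j (a2 k w).
Hypothesis a2_Am : forall k j w, a2 k (Am j w) = Am j (a2 k w).
Hypothesis a2s_b : forall m j w, a2s m (b j w) = - b j (a2s m w) + ((j == m)%:R * y) *: w.
Hypothesis a2_b : forall m j w, a2 m (b j w) = - b j (a2 m w).
Hypothesis a2_c : forall m j w, a2 m (c j w) = - c j (a2 m w) + (j == m)%:R *: w.

Let B k v := Ap k v + Am k v.
Let BL k : linear (B k).
Proof. by apply: is_linear_add. Qed.
Let N : C := n%:R.
Local Notation e := (expseq N B).

Definition shift_mul (k : nat) (p : {poly C}) : {poly C} :=
  if k is k'.+1 then w_ k' * p else p.
Let shift_mulL k : linear (shift_mul k).
Proof. by case: k => [|k] a p q //=; rewrite mulrDr scalerAr. Qed.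

(** The image of the exponential e(z) under Lam: Ap_k acts as multiplication by
    the divided derivative u^`N(k - 1) and Am_k as 0. *)
Definition schur (i : int) : {poly C} := expseq N shift_mul 1 i.
Local Notation S := schur.

Lemma schur_rec K i : i <= K%:Z ->
  i%:~R *: S i = N *: \sum_(0 <= k < K) w_ k * S (i - 1 - k%:Z).
Proof. exact: expseq_rec shift_mulL _ _. Qed.

Lemma schur_neg i : i < 0 -> S i = 0.
Proof. exact: expseq_neg. Qed.

Lemma exp_morph (Z : V -> {poly C}) v : linear Z ->
  (forall k w, Z (Ap k.+1 w) = w_ k * Z w) -> (forall k w, Z (Am k.+1 w) = 0) ->
  forall i, Z (e v i) = S i * Z v.
Proof.
move=> ZL ZAp ZAm i; suff H K : i <= K%:Z -> Z (e v i) = S i * Z v.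
  by apply: (H `|i|%N); lia.
move: i; apply: (expseq_unique (N := N) (B := shift_mul) (f := fun i => Z (e v i))
  (g := fun i => S i * Z v)) => [i i0|i i0||i iK].
- by rewrite expseq_neg // (lin0 ZL).
- by rewrite schur_neg // mul0r.
- by rewrite mul1r.
rewrite -(linZ ZL) (expseq_rec N v BL iK) (linZ ZL) (lin_sum _ _ _ ZL).
rewrite (eq_bigr (fun k => w_ k * Z (e v (i - 1 - k%:Z)))) => [|k _]; last first.
  by rewrite (linD ZL) ZAp ZAm addr0.
rewrite subrr scalerAl (schur_rec iK) -scalerAl mulr_suml -scalerBr -sumrB.
by rewrite big1 ?scaler0 // => k _ /=; rewrite mulrA subrr.
Qed.

(** hp2 commutes with e(z) up to its contraction with the modes of Am, which
    multiplies the series by a power of z. *)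
Lemma hp2_exp k v i : Lam (hp2 k.+1 (e v i)) =
  S i * Lam (hp2 k.+1 v) + (N * y) *: (S (i - k.+1%:Z) * Lam v).
Proof.
suff H K : i <= K%:Z -> (k < K)%N -> Lam (hp2 k.+1 (e v i)) =
  S i * Lam (hp2 k.+1 v) + (N * y) *: (S (i - k.+1%:Z) * Lam v).
  by apply: (H (`|i| + k).+1%N); lia.
move=> iK kK; move: i iK.
apply: (expseq_unique (N := N) (B := shift_mul) (f := fun i => Lam (hp2 k.+1 (e v i)))
  (g := fun i => S i * Lam (hp2 k.+1 v) + (N * y) *: (S (i - k.+1%:Z) * Lam v)))
  => [i i0|i i0||i iK].
- by rewrite expseq_neg // (lin0 (hp2L _)) (lin0 LamL).
- by rewrite !schur_neg ?mul0r ?scaler0 ?addr0 //; lia.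
- by rewrite mul1r schur_neg ?mul0r ?scaler0 ?addr0 //; lia.
have Lam_e j : Lam (e v j) = S j * Lam v by apply: exp_morph.
transitivity ((N * (k.+1%:R * y)) *: (S (i - k.+1%:Z) * Lam v)).
  rewrite -(linZ LamL) -(linZ (hp2L _)) (expseq_rec N v BL iK).
  rewrite (linZ (hp2L _)) (linZ LamL) (lin_sum _ _ _ (hp2L _)) (lin_sum _ _ _ LamL).
  rewrite -scalerBr -sumrB -scalerA; congr (_ *: _).
  rewrite -(sum_pick_nat (fun l => (k.+1%:R * y) *: (S (i - l.+1%:Z) * Lam v)) kK).
  apply: eq_bigr => l _ /=; rewrite (linD (hp2L _)) hp2_Ap hp2_Am.
  rewrite !(linD LamL) Lam_Ap Lam_Am (linZ LamL) add0r addrC addKr eqSS Lam_e.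
  by rewrite -!scalerA (_ : i - 1 - l%:Z = i - l.+1%:Z) //; lia.
have -> : i%:~R *: (S i * Lam (hp2 k.+1 v) + (N * y) *: (S (i - k.+1%:Z) * Lam v)) =
    N *: (\sum_(0 <= l < K) w_ l * (S (i - 1 - l%:Z) * Lam (hp2 k.+1 v))) +
    (N * y * i%:~R) *: (S (i - k.+1%:Z) * Lam v).
  rewrite scalerDr scalerAl (schur_rec iK) -scalerAl mulr_suml scalerA.
  congr (N *: _ + _ *: _); last by rewrite mulrC.
  by apply: eq_bigr => l _; rewrite mulrA.
have -> : \sum_(0 <= l < K) shift_mul l.+1 (S (i - 1 - l%:Z) * Lam (hp2 k.+1 v) +
      (N * y) *: (S (i - 1 - l%:Z - k.+1%:Z) * Lam v)) =
    \sum_(0 <= l < K) w_ l * (S (i - 1 - l%:Z) * Lam (hp2 k.+1 v)) +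
    (N * y) *: ((\sum_(0 <= l < K) w_ l * S (i - k.+1%:Z - 1 - l%:Z)) * Lam v).
  rewrite mulr_suml scaler_sumr -big_split; apply: eq_bigr => l _ /=.
  rewrite mulrDr -scalerAr mulrA mulrA; congr (_ + _ *: (_ * _ * _)).
  by congr (schur _); lia.
set Sg := (\sum_(0 <= l < K) w_ l * S (i - k.+1%:Z - 1 - l%:Z)).
rewrite [X in _ = _ - X]scalerDr opprD addrACA subrr add0r.
have -> : N *: ((N * y) *: (Sg * Lam v)) = (N * y) *: ((N *: Sg) * Lam v).
  by rewrite -scalerAl !scalerA mulrC.
rewrite -schur_rec; last by lia.
rewrite -scalerAl scalerA -scalerBl; congr (_ *: _).
by rewrite rmorphB /= -pmulrn; ring.
Qed.

Let P := state_op Ap Am b c n.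

Lemma state_bosonic (Z : V -> {poly C}) (w0 : C) w : linear Z ->
  (forall v, Z (Ap 0%N v) = w0 *: Z v) -> (forall k v, Z (Ap k.+1 v) = w_ k * Z v) ->
  (forall j v, Z (b j v) = 0) ->
  Z (P w) = (N * w0) *: Z (e w n) + N *: (\sum_(0 <= k < n) w_ k * Z (e w (n%:Z - 1 - k%:Z))).
Proof.
move=> ZL Z0 ZAp Zb; rewrite /P /state_op (linD ZL) !(linZ ZL) !(lin_sum _ _ _ ZL).
rewrite [X in _ + _ *: X = _]big1 => [|i _]; last first.
  by rewrite (lin_sum _ _ _ ZL) big1 // => j _.
rewrite scaler0 addr0 big_nat_recl // Z0 subr0 scalerDr scalerA; congr (_ + _ *: _).
apply: eq_bigr => k _; rewrite ZAp; congr (_ * Z (e w _)); lia.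
Qed.

Lemma Lam_state w : Lam (P w) = ((N * kap + N) *: S n) * Lam w.
Proof.
rewrite (state_bosonic w LamL Lam_Ap0 Lam_Ap Lam_b).
have Lam_e j : Lam (e w j) = S j * Lam w by apply: exp_morph.
rewrite (eq_bigr (fun k => w_ k * S (n%:Z - 1 - k%:Z) * Lam w)) => [|k _]; last first.
  by rewrite Lam_e mulrA.
rewrite Lam_e -mulr_suml scalerDl mulrDl scalerAl; congr (_ + _).
by rewrite scalerAl -schur_rec.
Qed.

Lemma hp2_state k w : Lam (hp2 k.+1 (P w)) =
  ((N * kap + N) *: S n) * Lam (hp2 k.+1 w) +
  (N * y * (N * kap + (n%:Z - k.+1%:Z)%:~R)) *: (S (n%:Z - k.+1%:Z) * Lam w).
Proof.
rewrite (state_bosonic (Z := fun v => Lam (hp2 k.+1 v)) (w0 := kap) w); first last.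
- by move=> j v; rewrite hp2_b Lam_b.
- by move=> j v; rewrite hp2_Ap Lam_Ap.
- by move=> v; rewrite hp2_Ap Lam_Ap0.
- exact: is_linear_comp.
rewrite (eq_bigr (fun j => w_ j * S (n%:Z - 1 - j%:Z) * Lam (hp2 k.+1 w) +
  (N * y) *: (w_ j * S (n%:Z - k.+1%:Z - 1 - j%:Z) * Lam w))) => [|j _]; last first.
  rewrite hp2_exp mulrDr mulrA -scalerAr mulrA; congr (_ + _ *: (_ * _ * _)).
  by congr (schur _); lia.
rewrite big_split /= -scaler_sumr -!mulr_suml.
rewrite [Lam (hp2 k.+1 (e w n%:Z))]hp2_exp.
have -> : N *: ((\sum_(0 <= j < n) w_ j * S (n%:Z - 1 - j%:Z)) * Lam (hp2 k.+1 w) +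
    (N * y) *: ((\sum_(0 <= j < n) w_ j * S (n%:Z - k.+1%:Z - 1 - j%:Z)) * Lam w)) =
    N *: (S n * Lam (hp2 k.+1 w)) +
    (N * y * (n%:Z - k.+1%:Z)%:~R) *: (S (n%:Z - k.+1%:Z) * Lam w).
  rewrite scalerDr scalerAl -schur_rec // -scalerAl; congr (_ + _).
  set Sg := \sum_(0 <= j < n) _.
  have -> : N *: ((N * y) *: (Sg * Lam w)) = (N * y) *: ((N *: Sg) * Lam w).
    by rewrite -scalerAl !scalerA mulrC.
  by rewrite -schur_rec -?scalerAl ?scalerA //; lia.
rewrite scalerDr addrACA -scalerDl scalerA -scalerDl -scalerAl.
by congr (_ + _ *: _); ring.
Qed.

Lemma a2_state s m w : Lam (a2 s (a2s m (P w))) =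
  ((N * kap + N) *: S n) * Lam (a2 s (a2s m w)) +
  (N * N * y) *: (S (n%:Z - 1 - m%:Z - s%:Z) * Lam w).
Proof.
pose Z v := Lam (a2 s (a2s m v)).
have ZL : linear Z by apply: (is_linear_comp LamL); exact: is_linear_comp.
have Z0 v : Z (Ap 0%N v) = kap *: Z v by rewrite /Z a2s_Ap a2_Ap Lam_Ap0.
have ZAp k v : Z (Ap k.+1 v) = w_ k * Z v by rewrite /Z a2s_Ap a2_Ap Lam_Ap.
have ZAm k v : Z (Am k.+1 v) = 0 by rewrite /Z a2s_Am a2_Am Lam_Am.
have Ze j : Z (e w j) = S j * Z w by apply: exp_morph.
have Lam_e j : Lam (e w j) = S j * Lam w by apply: exp_morph.
rewrite -![Lam (a2 s (a2s m _))]/(Z _) /P.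
pose K := (n + m + s).+1.
rewrite (state_opE Am ApL bL cL w (K := K)); last by rewrite /K; lia.
rewrite (linD ZL) !(linZ ZL) !(lin_sum _ _ _ ZL); congr (_ + _).
  rewrite big_nat_recl // Z0 subr0 Ze scalerDr scalerA.
  rewrite (eq_bigr (fun k => w_ k * S (n%:Z - 1 - k%:Z) * Z w)) => [|k _]; last first.
    by rewrite ZAp Ze mulrA; congr (_ * schur _ * _); lia.
  rewrite -mulr_suml scalerDl mulrDl scalerAl; congr (_ + _).
  by rewrite scalerAl -schur_rec // /K; lia.
have step i j : Z (b i (c j (e w (n%:Z - 1 - i%:Z - j%:Z)))) =
    (i == m)%:R *: ((j == s)%:R *: (y *: (S (n%:Z - 1 - i%:Z - j%:Z) * Lam w))).
  rewrite /Z a2s_b (linD (a2L s)) (linN (a2L s)) a2_b opprK (linD LamL) Lam_b add0r.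
  rewrite (linZ (a2L s)) a2_c (linZ LamL) (linD LamL) (linN LamL) Lam_c oppr0 add0r.
  by rewrite (linZ LamL) Lam_e !scalerA; congr (_ *: _); ring.
rewrite (eq_bigr (fun i => (i == m)%:R *: (\sum_(0 <= j < K)
   (j == s)%:R *: (y *: (S (n%:Z - 1 - i%:Z - j%:Z) * Lam w))))) => [|i _]; last first.
  by rewrite (lin_sum _ _ _ ZL) scaler_sumr; apply: eq_bigr => j _.
rewrite (sum_pick_nat (fun i => \sum_(0 <= j < K)
   (j == s)%:R *: (y *: (S (n%:Z - 1 - i%:Z - j%:Z) * Lam w)))); last by rewrite /K; lia.
rewrite (sum_pick_nat (fun j => y *: (S (n%:Z - 1 - m%:Z - j%:Z) * Lam w)));
  last by rewrite /K; lia.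
by rewrite scalerA.
Qed.

(** The contractions in the first sum carry the factors N kap + n - k, those in
    the second one n - k with opposite signs. The factors n - k cancel except at
    k = 0, and what is left besides is proportional to kap. *)
Lemma Psi_state K g w : (n < K)%N -> Psi K g (P w) =
  Psi K (g * ((N * kap + N) *: S n)) w +
  N * y * (N * (g * S n * Lam w)`_0 - N * kap *
    \sum_(0 <= k < K) (-1) ^+ k.+1 * (g * S (n%:Z - k.+1%:Z) * Lam w)`_k.+1).
Proof.
move=> nK; pose Tm m := (-1) ^+ m * (g * S (n%:Z - m%:Z) * Lam w)`_m.
pose g' := g * ((N * kap + N) *: S n).
have e1 k : (-1) ^+ k * (g * Lam (hp2 k.+1 (P w)))`_k.+1 =
    (-1) ^+ k * (g' * Lam (hp2 k.+1 w))`_k.+1 -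
    (N * y * (N * kap + (n%:Z - k.+1%:Z)%:~R)) * Tm k.+1.
  rewrite hp2_state mulrDr coefD mulrDr; congr (_ * _`_k.+1 + _); first by rewrite mulrA.
  by rewrite -scalerAr coefZ (mulrA g) /Tm exprS; move: (g * _ * _)`_k.+1 => x; ring.
have e2 m : \sum_(0 <= s < K) (-1) ^+ m * (g * (w_ s * Lam (a2 s (a2s m (P w)))))`_m =
    \sum_(0 <= s < K) (-1) ^+ m * (g' * (w_ s * Lam (a2 s (a2s m w))))`_m +
    N * y * (n%:Z - m%:Z)%:~R * Tm m.
  rewrite (eq_bigr (fun s => (-1) ^+ m * (g' * (w_ s * Lam (a2 s (a2s m w))))`_m +
     (N * y * (-1) ^+ m) * (N *: (g * (w_ s * S (n%:Z - m%:Z - 1 - s%:Z)) * Lam w))`_m)) => [|s _].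
    rewrite big_split; congr (_ + _).
    rewrite -mulr_sumr -coef_sum -scaler_sumr -mulr_suml -mulr_sumr.
    rewrite scalerAl scalerAr -schur_rec; last by lia.
    by rewrite -scalerAr -scalerAl coefZ /Tm; ring.
  rewrite a2_state mulrDr mulrDr coefD mulrDr; congr (_ * _`_m + _).
    by rewrite /g' -!mulrA; congr (g * _); rewrite mulrCA.
  rewrite (_ : n%:Z - 1 - m%:Z - s%:Z = n%:Z - m%:Z - 1 - s%:Z); last by lia.
  rewrite -!scalerAr !coefZ !mulrA; move: (_ * Lam w)`_m => x; ring.
rewrite /Psi (eq_bigr _ (fun k _ => e1 k)) (eq_bigr _ (fun m _ => e2 m)).
rewrite sumrB big_split /= addrACA; congr (_ + _).
have TK : Tm K = 0 by rewrite /Tm schur_neg ?mulr0 ?mul0r ?coef0 ?mulr0 //; lia.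
have -> : \sum_(0 <= m < K) N * y * (n%:Z - m%:Z)%:~R * Tm m =
    \sum_(0 <= m < K.+1) N * y * (n%:Z - m%:Z)%:~R * Tm m.
  by rewrite [RHS]big_nat_recr //= TK mulr0 addr0.
rewrite big_nat_recl // addrCA [X in _ + X = _]addrC -sumrB.
rewrite (eq_bigr (fun k => - (N * y * (N * kap)) * Tm k.+1)) => [|k _]; last by ring.
by rewrite -mulr_sumr {1}/Tm subr0 -pmulrn expr0 mul1r; ring.
Qed.
End Evaluation.
End Functional.

Section Iteration.
Variables (C : numFieldType) (V : lmodType C) (u : {poly C}).
Variables (P : nat -> V -> V) (Lam : V -> {poly C}) (psi : {poly C} -> V -> C).
Variables (kap y : C) (K : nat) (v0 : V).

Definition weight (n : nat) : {poly C} := n%:R *: schur u n n.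
Definition weights (s : seq nat) : {poly C} := \prod_(n <- s) weight n.

(** The part of the functional with a factor kap. That it does not involve kap
    otherwise is what allows kap to be chosen last. *)
Fixpoint correction (g : {poly C}) (s : seq nat) : C :=
  if s is n :: s' then
    correction (g * weight n) s' -
    n%:R * n%:R * \sum_(0 <= k < n) (-1) ^+ k.+1 *
      (g * schur u n (n%:Z - k.+1%:Z) * weights s')`_k.+1
  else 0.

Hypothesis psiZ : forall a g v, psi (a *: g) v = a * psi g v.
Hypothesis Lam_P : forall n w,
  Lam (P n w) = ((n%:R * kap + n%:R) *: schur u n n) * Lam w.
Hypothesis psi_P : forall n g w, (n < K)%N -> psi g (P n w) =
  psi (g * ((n%:R * kap + n%:R) *: schur u n n)) w +
  n%:R * y * (n%:R * (g * schur u n n * Lam w)`_0 - n%:R * kap *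
    \sum_(0 <= k < K) (-1) ^+ k.+1 * (g * schur u n (n%:Z - k.+1%:Z) * Lam w)`_k.+1).
Hypothesis Lam0 : Lam v0 = 1.
Hypothesis psi0 : forall g, psi g v0 = 0.

Lemma Lam_foldr s : Lam (foldr P v0 s) = (1 + kap) ^+ size s *: weights s.
Proof.
elim: s => [|n s IH]; first by rewrite /weights big_nil expr0 scale1r.
rewrite /= Lam_P IH /weights big_cons -scalerAr -!scalerAl !scalerA.
by congr (_ *: _); rewrite exprS; ring.
Qed.

(** Each operator multiplies the weight g by (1 + kap) n S_n, so by
    Psi_state every part n contributes n times the same leading term. The
    factor 1 + kap on the left accounts for the one operator that is hit by a
    contraction. *)
Lemma psi_foldr s g : all (ltn^~ K) s ->
  (1 + kap) * psi g (foldr P v0 s) = y * (1 + kap) ^+ size s *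
    ((\sum_(n <- s) n)%:R * (g * weights s)`_0 + kap * correction g s).
Proof.
elim: s g => [|n s IH] g /=; first by rewrite psi0 big_nil mul0r !mulr0 addr0 mulr0.
move=> /andP[nK sK]; rewrite (psi_P g _ nK) Lam_foldr.
have -> : (n%:R * kap + n%:R) *: schur u n n = (1 + kap) *: weight n.
  by rewrite /weight scalerA; congr (_ *: _); ring.
rewrite -scalerAr psiZ mulrDr IH //.
have coefT (p : {poly C}) m :
    (p * ((1 + kap) ^+ size s *: weights s))`_m = (1 + kap) ^+ size s * (p * weights s)`_m.
  by rewrite -scalerAr coefZ.
rewrite coefT (eq_bigr (fun k => (1 + kap) ^+ size s * ((-1) ^+ k.+1 *
   (g * schur u n (n%:Z - k.+1%:Z) * weights s)`_k.+1))) => [|k _]; last first.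
  by rewrite coefT mulrCA.
rewrite -mulr_sumr (@sum_truncate C C^o _ n K (ltnW nK)) => [|k nk]; last first.
  by rewrite schur_neg ?mulr0 ?mul0r ?coef0 ?mulr0 //; lia.
have -> : g * weights (n :: s) = g * weight n * weights s.
  by rewrite /weights big_cons mulrA.
have <- : n%:R * (g * schur u n n * weights s)`_0 = (g * weight n * weights s)`_0.
  by rewrite /weight -scalerAr -scalerAl coefZ.
rewrite big_cons natrD exprS; ring.
Qed.
End Iteration.

(** * Partitions, prescribed weights and generic parameters *)

Section SchurValues.
Variable C : numFieldType.

Lemma schur0 (u : {poly C}) n : schur u n 0%N = 1.
Proof. by []. Qed.

Lemma schur_coef0_rec (u : {poly C}) n m :
  m.+1%:R * (schur u n m.+1)`_0 =
    n%:R * \sum_(0 <= k < m.+1) u`_k * (schur u n (m - k)%N)`_0.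
Proof.
have /(congr1 (fun p : {poly C} => p`_0)) := schur_rec u n (lexx m.+1%:Z).
rewrite !coefZ => ->; congr (_ * _).
rewrite coef_sum; apply: eq_big_nat => k /andP[_ km].
rewrite coef0M coef_nderivn addn0 binn mulr1n; congr (_ * (schur u n _)`_0).
by lia.
Qed.

Lemma schur_coef0_ext (u u' : {poly C}) n m : (forall k, (k < m)%N -> u`_k = u'`_k) ->
  forall i, (i <= m)%N -> (schur u n i)`_0 = (schur u' n i)`_0.
Proof.
move=> uu'; elim/ltn_ind=> -[//|i] IH im; apply: (@mulfI C i.+1%:R).
  by rewrite pnatr_eq0.
rewrite !schur_coef0_rec; congr (_ * _); apply: eq_big_nat => k /andP[_ ki].
by rewrite uu' ?IH //; lia.
Qed.

(** n S_n(0) is n times the Taylor coefficient of index n - 1 of u, plus an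
    expression in the previous ones: the values are prescribed one by one. *)
Lemma exists_weights (a : nat -> C) M :
  exists u : {poly C}, forall n, (0 < n <= M)%N -> (weight u n)`_0 = a n.
Proof.
elim: M => [|M [u uP]]; first by exists 0 => -[].
pose r := \sum_(0 <= k < M) u`_k * (schur u M.+1 (M - k)%N)`_0.
exists (u + (M.+1%:R^-1 * a M.+1 - r - u`_M) *: 'X^M); set u' := u + _.
have uu' k : (k < M)%N -> u`_k = u'`_k.
  by move=> kM; rewrite coefD coefZ coefXn ltn_eqF // mulr0 addr0.
have u'M : u'`_M = M.+1%:R^-1 * a M.+1 - r.
  by rewrite coefD coefZ coefXn eqxx mulr1 addrC subrK.
move=> n /andP[n0]; rewrite leq_eqVlt => /orP[/eqP->|nM]; last first.
  rewrite -(uP n) ?n0 // /weight !coefZ; congr (_ * _); symmetry.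
  exact: schur_coef0_ext uu' _ _.
rewrite /weight coefZ schur_coef0_rec big_nat_recr // subnn schur0 coef1 mulr1.
rewrite u'M (eq_big_nat _ _ (F2 := fun k => u`_k * (schur u M.+1 (M - k)%N)`_0)) => [|k /andP[_ kM]].
  rewrite -[LHS]/(M.+1%:R * (r + (M.+1%:R^-1 * a M.+1 - r))).
  by rewrite [r + _]addrC subrK mulrA mulfV ?mul1r ?pnatr_eq0.
by rewrite -uu' // (schur_coef0_ext _ uu') ?leq_subr.
Qed.
End SchurValues.

Definition nth_prime (n : nat) : nat := iter n (fun m => s2val (prime_above m)) 2%N.

Lemma prime_nth_prime n : prime (nth_prime n).
Proof. by case: n => [|n] //=; case: prime_above. Qed.

Lemma nth_prime_inj : injective nth_prime.
Proof.
apply: (@incn_inj nth_prime) => m n; apply: leq_mono => {m n}.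
apply: homo_ltn => [? ? ?|n]; first exact: ltn_trans.
by rewrite /nth_prime /=; case: prime_above.
Qed.

Definition prime_code (s : seq nat) : nat := \prod_(n <- s) nth_prime n.

Lemma prime_code_gt0 s : (0 < prime_code s)%N.
Proof. by apply: prodn_gt0 => n; exact: prime_gt0 (prime_nth_prime n). Qed.

Lemma logn_prime_code n s : logn (nth_prime n) (prime_code s) = count_mem n s.
Proof.
elim: s => [|m s IH]; first by rewrite /prime_code big_nil logn1.
rewrite /prime_code big_cons -/(prime_code s) lognM ?prime_code_gt0 ?prime_gt0 ?prime_nth_prime //.
by rewrite IH logn_prime ?prime_nth_prime // (inj_eq nth_prime_inj) /= eq_sym.
Qed.

Lemma prime_code_inj s s' : prime_code s = prime_code s' -> perm_eq s s'.
Proof. by move=> ss'; apply/allP => n _ /=; rewrite -!logn_prime_code ss'. Qed.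

(** Dropping the zeros loses no information, since the number of entries is
    known; the prime code records the multiplicities of the parts. *)
Lemma partition_family M : exists2 f : 'I_(npart M) -> seq nat,
  injective (prime_code \o f) &
  forall i, all (fun n => 0 < n <= M)%N (f i) /\ (\sum_(n <- f i) n)%N = M.
Proof.
pose vals (t : M.-tuple 'I_M.+1) := [seq val x | x <- t].
exists (fun i => [seq n <- vals (enum_val i) | (0 < n)%N]); last first.
  move=> i; have := enum_valP i; rewrite inE => /andP[_ /eqP sM]; split.
    apply/allP => n; rewrite mem_filter => /andP[-> /mapP[x _ ->]] /=.
    by rewrite -ltnS ltn_ord.
  rewrite -[RHS]sM big_filter big_map big_mkcond; apply: eq_bigr => x _ /=.
  by case: posnP => [->|].
move=> i j /prime_code_inj ij; apply: enum_val_inj.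
have := enum_valP i; have := enum_valP j; rewrite !inE => /andP[jS _] /andP[iS _].
apply/val_inj/(inj_map val_inj)/(sorted_eq (leT := geq)) => //.
- by move=> ? ? ? /= ? /leq_trans; apply.
- by move=> ? ? /andP[*]; apply/eqP; rewrite eqn_leq; apply/andP.
(* The entries that the filter drops are zeros, as many as are missing. *)
have zeros (t : M.-tuple 'I_M.+1) : [seq n <- vals t | ~~ (0 < n)%N] =
    nseq (M - size [seq n <- vals t | (0 < n)%N]) 0%N.
  have -> : (M - size [seq n <- vals t | (0 < n)%N])%N =
      size [seq n <- vals t | ~~ (0 < n)%N].
    rewrite !size_filter -[in LHS](size_tuple t) -(size_map val) -(count_predC (leq 1)).
    by rewrite addKn.
  by apply/all_pred1P/allP => n; rewrite mem_filter -eqn0Ngt => /andP[].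
rewrite -(perm_filterC (leq 1) (vals (enum_val i))).
rewrite perm_sym -(perm_filterC (leq 1) (vals (enum_val j))) perm_sym.
by rewrite !(zeros) (perm_size ij) perm_cat2r.
Qed.

Section GenericDeterminant.
Variable C : numFieldType.

Lemma weights_coef0 (u : {poly C}) s :
  (weights u s)`_0 = \prod_(n <- s) (weight u n)`_0.
Proof. by apply: (big_morph (fun p : {poly C} => p`_0)) => [p q|]; rewrite ?coef0M ?coef1. Qed.

(** If the part n has weight nth_prime n ^+ i for the i-th polynomial, then the
    weight of a sequence is the i-th power of its prime code, and the matrix is
    a Vandermonde matrix with distinct nodes. *)
Lemma exists_independent_weights d (f : 'I_d -> seq nat) M :
  injective (prime_code \o f) -> (forall i, all (fun n => 0 < n <= M)%N (f i)) ->
  exists u : 'I_d -> {poly C}, \det (\matrix_(i, j) (weights (u i) (f j))`_0) != 0.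
Proof.
move=> f_inj fM.
have [u uP] := choice (fun i : 'I_d => exists_weights (fun n => (nth_prime n)%:R ^+ i : C) M).
exists u; pose x := \row_j (prime_code (f j))%:R : 'rV[C]_d.
rewrite (_ : (\matrix_(i, j) _) = Vandermonde d x); last first.
  apply/matrixP => i j; rewrite !mxE weights_coef0 /prime_code natr_prod -prodrXl.
  by apply: eq_big_seq => n /(allP (fM j)); exact: uP.
rewrite det_Vandermonde; apply/prodf_neq0 => i _; apply/prodf_neq0 => j ij.
rewrite !mxE subr_eq0 eqr_nat; apply: contraTneq ij => /f_inj ->.
by rewrite ltnn.
Qed.

Lemma exists_regular_value (p : {poly C}) : p != 0 -> exists a, p.[a] != 0.
Proof.
move=> p0; pose s := [seq n%:R | n <- iota 0 (size p)] : seq C.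
have : ~~ all (root p) s.
  apply/negP => /(max_poly_roots p0); rewrite size_map size_iota ltnn.
  by rewrite map_inj_uniq ?iota_uniq // => [/(_ isT)|m n /eqP] //; rewrite eqr_nat => /eqP.
by case/allPn => a _ pa; exists a.
Qed.

(** The determinant is a polynomial in kap with a nonzero constant term. *)
Lemma exists_regular_shift d (A B : 'M[C]_d) : \det A != 0 ->
  exists kap : C, [/\ kap != 0, 1 + kap != 0 & \det (A + kap *: B) != 0].
Proof.
move=> detA.
pose p := \det (map_mx polyC A + 'X *: map_mx polyC B) : {poly C}.
have pE a : p.[a] = \det (A + a *: B).
  rewrite -[LHS]/(horner_eval a p) -det_map_mx; congr (\det _).
  apply/matrixP => i j; rewrite !mxE -[LHS]/(((A i j)%:P + 'X * (B i j)%:P).[a]).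
  by rewrite !hornerE.
have [|a] := @exists_regular_value (p * 'X * ('X + 1)).
  rewrite !mulf_neq0 ?polyX_eq0 //.
    by apply: contra_neq detA => p0; rewrite -[A]addr0 -[0](scale0r B) -pE p0 horner0.
  by rewrite -(opprK 1) -polyCN polyXsubC_eq0.
rewrite !hornerE !mulf_eq0 !negb_or pE -andbA [a + 1]addrC => /and3P[? ? ?].
by exists a.
Qed.
End GenericDeterminant.

(** * Characters of Fock space *)

Lemma nderivn_deriv (R : comNzRingType) (p : {poly R}) k :
  (p^`N(k))^`() = k.+1%:R * p^`N(k.+1).
Proof.
apply/polyP => i; rewrite mulr_natl coefMn coef_deriv !coef_nderivn -!mulrnA.
rewrite addnS addSn; congr (_ *+ _).
by rewrite -[RHS]mulnC mul_bin_left mulnC; congr (_ * _)%N; lia.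
Qed.

Section LinearForms.
Variables (C : numFieldType) (W : lmodType C) (f : fock -> W).

(** The linear extension of f, with values in an arbitrary module. *)
Definition lform_ext (v : VNS C) : W := \sum_(k <- msupp v) v@_k *: f k.

Lemma lform_ext_ket l m D : lform_ext (ket l m D) = f (l, m, D).
Proof. by rewrite ket.unlock; exact: sum_ket. Qed.

Lemma lform_ext_linear : linear lform_ext.
Proof.
have E v (D : {fset fock}) : (msupp v `<=` D)%fset ->
    lform_ext v = \sum_(k <- D) v@_k *: f k.
  move=> vD; rewrite /lform_ext (big_fset_incl _ vD) // => k _ kv.
  by rewrite mcoeff_outdom // scale0r.
move=> a u v; pose D := (msupp u `|` msupp v `|` msupp (a *: u + v))%fset.
rewrite !(E _ D); first last.
- by apply/fsubsetP=> k; rewrite !inE => ->; rewrite orbT.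
- by apply/fsubsetP=> k; rewrite !inE => ->.
- by apply/fsubsetP=> k; rewrite !inE => ->; rewrite orbT.
rewrite scaler_sumr -big_split; apply: eq_bigr => k _ /=.
by rewrite mcoeffD mcoeffZ scalerDl scalerA.
Qed.
End LinearForms.

Definition chi_mode (C : numFieldType) (G : 'M[int]_4) (h : 'rV[C]_4) (u : {poly C})
  (a : bmode) : {poly C} := hform G (hbase C a.1) h *: u^`N(a.2).

Definition chi_basis (C : numFieldType) (G : 'M[int]_4) (alpha : lattice)
    (h : 'rV[C]_4) (u : {poly C}) (k : fock) : {poly C} :=
  let: (l, m, D) := k in
  if (l == alpha) && (D == fset0) then \prod_(a <- enum_mset m) chi_mode G h u a else 0.

(** On the sector of alpha, the algebra map from the symmetric algebra to
    polynomials that sends x(-k-1) to (x, h) u^`N(k); it kills the fermions and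
    all other sectors. *)
HB.lock Definition chi (C : numFieldType) (G : 'M[int]_4) (alpha : lattice)
    (h : 'rV[C]_4) (u : {poly C}) : VNS C -> {poly C} :=
  lform_ext (chi_basis G alpha h u).

Section Character.
Variables (C : numFieldType) (G : 'M[int]_4).
Hypothesis GT : G^T = G.
Local Notation V := (VNS C).
Local Notation bos := (@bos C G).
Local Notation ferm := (@ferm C).
Variables (alpha : lattice) (h : 'rV[C]_4) (u : {poly C}).
Local Notation w_ s := (u^`N(s)).
Local Notation chi := (chi G alpha h u).

Lemma chi_linear : linear chi.
Proof. by rewrite chi.unlock; exact: lform_ext_linear. Qed.

Lemma chi_ket l m D : chi (ket l m D) =
  if (l == alpha) && (D == fset0) then \prod_(a <- enum_mset m) chi_mode G h u a else 0.
Proof. by rewrite chi.unlock lform_ext_ket. Qed.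

Lemma chi_ground : chi (ket alpha mset0 fset0) = 1.
Proof. by rewrite chi_ket !eqxx big_mset0. Qed.

Lemma perm_msetD1 (a : bmode) (m : {mset bmode}%mset) :
  perm_eq (msetD (msetn 1 a) m) (a :: enum_mset m).
Proof.
apply/allP => b _ /=; rewrite !count_mem_mset msetE2 msetnE.
by rewrite [a == b]eq_sym; case: eqP.
Qed.

Lemma bos_hbase j k v : bos (hbase C j) (Negz k) v = upB (j, k) v.
Proof.
rewrite (bos_neg G (hbase C j) k v) (bigD1 j) //= big1 => [|i ij].
  by rewrite !mxE !eqxx scale1r addr0.
by rewrite !mxE (negPf ij) andbF scale0r.
Qed.

Lemma chi_upB a v : chi (upB a v) = chi_mode G h u a * chi v.
Proof.
move: v; apply: eq_on_ket.
- by apply: is_linear_comp; [exact: chi_linear | exact: upB_linear].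
- by move=> c v w; rewrite chi_linear mulrDr -scalerAr.
move=> l m D; rewrite upB_ket !chi_ket; case: andP => _; last by rewrite mulr0.
by rewrite (perm_big _ (perm_msetD1 a m)) big_cons.
Qed.

Lemma chi_upF s v : chi (upF s v) = 0.
Proof.
move: v; apply: (@eq_on_ket _ _ _ (fun=> 0)).
- by apply: is_linear_comp; [exact: chi_linear | exact: upF_linear].
- by move=> c v w; rewrite scaler0 addr0.
move=> l m D; rewrite upF_ket; case: ifP => _; first exact: lin0 chi_linear.
rewrite (linZ chi_linear) chi_ket (_ : (s |` D)%fset == fset0 = false) ?andbF ?scaler0 //.
by apply/negP => /eqP/fsetP/(_ s); rewrite !inE eqxx.
Qed.

Lemma chi_bos_neg x k v : chi (bos x (Negz k) v) = hform G x h *: (w_ k * chi v).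
Proof.
rewrite (bos_neg G x k v) (lin_sum _ _ _ chi_linear) (hform_basel GT x h) scaler_suml.
apply: eq_bigr => i _; rewrite (linZ chi_linear) chi_upB /chi_mode /=.
by rewrite -scalerAl scalerA.
Qed.

Lemma chi_bos0 x v : chi (bos x 0 v) = hform G x (hlat C alpha) *: chi v.
Proof.
move: v; apply: eq_on_ket.
- by apply: is_linear_comp; [exact: chi_linear | exact: bos_linear].
- by apply: is_linear_scale; exact: chi_linear.
move=> l m D; rewrite (bos_zero G x l m D) (linZ chi_linear) chi_ket.
by case: andP => [[/eqP-> _]|_]; rewrite ?scaler0.
Qed.

Lemma chi_ferm_neg b i k v : chi (ferm b i (Negz k) v) = 0.
Proof. by rewrite (ferm_neg b i k v) chi_upF. Qed.

Hypothesis h_alpha : hform G h (hlat C alpha) = 0.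

(** The positive modes of h act as derivations of the symmetric algebra, and
    k + 1 times u^`N(k + 1) is the derivative of u^`N(k). Both sides are thus
    derivations along chi that agree on the variables, and the zero mode of h
    vanishes because h is orthogonal to alpha. *)
Lemma chi_deriv w : exists K0, forall K, (K0 <= K)%N ->
  \sum_(0 <= s < K) w_ s * chi (bos h s%:Z w) = (chi w)^`().
Proof.
move: w; apply: ket_span => [|c l m D v [K0 vK]].
  exists 0%N => K _; rewrite (lin0 chi_linear) deriv0 big1 // => s _.
  by rewrite (lin0 (bos_linear G h _)) (lin0 chi_linear) mulr0.
suff [K1 kK] : exists K1, forall K, (K1 <= K)%N ->
    \sum_(0 <= s < K) w_ s * chi (bos h s%:Z (ket l m D)) = (chi (ket l m D))^`().
  exists (maxn K0 K1) => K; rewrite geq_max => /andP[K0K K1K].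
  rewrite (linD chi_linear) (linZ chi_linear) derivD derivZ -(vK K) // -(kK K) //.
  rewrite scaler_sumr -big_split; apply: eq_bigr => s _ /=.
  rewrite (linD (bos_linear G h _)) (linZ (bos_linear G h _)).
  by rewrite (linD chi_linear) (linZ chi_linear) mulrDr scalerAr.
have -> : m = seq_mset m by rewrite seq_mset_id.
elim: (enum_mset m) => [|a s [K1 IH]].
  exists 0%N => K _; rewrite chi_ket.
  rewrite [RHS](_ : _ = 0); last first.
    have -> : seq_mset [::] = mset0 :> {mset bmode}%mset by apply/msetP => b; rewrite mset_seqE mset0E.
    by case: ifP; rewrite ?big_mset0 ?derivC ?deriv0 // -polyC1 derivC.
  rewrite big1 // => -[|p] _; first by rewrite chi_bos0 h_alpha scale0r mulr0.
  rewrite (bos_pos G h p) (lin_sum _ _ _ chi_linear) big1 ?mulr0 // => i _.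
  by rewrite dnB_ket mset_seqE !scale0r ?scaler0 (lin0 chi_linear).
have -> : ket l (seq_mset (a :: s)) D = upB a (ket l (seq_mset s) D) :> V.
  rewrite upB_ket; congr (ket l _ D); apply/msetP => b.
  by rewrite msetE2 msetnE !mset_seqE /= eq_sym; case: eqP.
move: (ket l _ D) IH => {vK}v IH.
exists (maxn K1 a.2.+2) => K; rewrite geq_max => /andP[K1K aK].
have step p : w_ p * chi (bos h p%:Z (upB a v)) =
    chi_mode G h u a * (w_ p * chi (bos h p%:Z v)) +
    (p == a.2.+1)%:R *: (w_ p * ((p%:R * hform G (hbase C a.1) h) *: chi v)).
  case: a {aK} => j k; rewrite -(bos_hbase j k v) (bos_bos GT h (hbase C j)).
  rewrite (linD chi_linear) (linZ chi_linear) bos_hbase chi_upB mulrDr mulrCA.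
  congr (_ + _); rewrite -!scalerAr scalerA (hform_sym GT h); congr (_ *: _).
  by rewrite /= -pmulrn -mulrA; congr (_%:R * _); lia.
rewrite (eq_bigr _ (fun p _ => step p)) big_split /= -mulr_sumr.
rewrite (sum_pick_nat (fun p => w_ p *
  ((p%:R * hform G (hbase C a.1) h) *: chi v)) aK).
rewrite (IH K K1K).
have -> : (chi (upB a v))^`() = (chi_mode G h u a)^`() * chi v + chi_mode G h u a * (chi v)^`().
  by rewrite -derivM -chi_upB.
rewrite addrC; congr (_ + _).
rewrite /chi_mode derivZ nderivn_deriv -scalerAr -scalerAl -mulrA mulr_natl.
by rewrite [in RHS]mulr_natl -scalerMnl -scalerMnr.
Qed.
End Character.

Lemma lin_modesum (C : numFieldType) (V W : lmodType C) (Z : V -> W)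
    (A B : int -> V -> V) n K w F : linear Z ->
  (forall j : nat, Z (A (Negz j) (B (n + j%:Z) w)) = F j) ->
  (forall j : nat, Z (B (n - j%:Z - 1) (A j%:Z w)) = 0) ->
  Z (modesum false A B n K w) = \sum_(0 <= j < K) F j.
Proof.
move=> ZL ZA ZB; rewrite /modesum expr0 scale1r (linD ZL) !(lin_sum _ _ _ ZL).
by rewrite [X in _ + X]big1 ?addr0 => [|j _]; [apply: eq_bigr => j _ | ].
Qed.

Section CharacterFields.
Variables (C : numFieldType) (G : 'M[int]_4).
Hypothesis GT : G^T = G.
Local Notation V := (VNS C).
Local Notation bos := (@bos C G).
Local Notation ferm := (@ferm C).
Variables (alpha : lattice) (h : 'rV[C]_4) (u : {poly C}).
Local Notation w_ s := (u^`N(s)).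
Local Notation chi := (chi G alpha h u).

(** In the second sum of the normally ordered product a fermion is created last,
    and chi kills the result. *)
Lemma chi_nop x b i w : exists K0, forall K, (K0 <= K)%N ->
  chi (nop false (bos x) (ferm b i) 0 w) =
  \sum_(0 <= s < K) w_ s * (hform G x h *: chi (ferm b i s%:Z w)).
Proof.
have [K0 H] := nopE false 0 w (@bos_linear C G x) (@ferm_linear C b i)
  (@bos_truncated C G x) (@ferm_truncated C b i).
exists K0 => K KK; rewrite (H K KK).
apply: (@lin_modesum _ _ _ chi (bos x) (ferm b i) 0 K w
  (fun s => w_ s * (hform G x h *: chi (ferm b i s%:Z w))) (@chi_linear C G alpha h u))
  => s; last first.
  by rewrite (_ : 0 - s%:Z - 1 = Negz s) ?(chi_ferm_neg G alpha h u b i s) //; lia.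
rewrite (add0r s%:Z); apply: etrans (chi_bos_neg GT alpha h u x s _) _; exact: scalerAr.
Qed.

Variables (t : 2.-tuple 'rV[C]_4) (b : bool).
(** The annihilation operator that is left of the supercharge after its bosonic
    creation operators have been evaluated by chi. *)
Definition pairing (s : nat) (w : V) : V :=
  \sum_i hform G (tnth t i) h *: ferm b i s%:Z w.

Lemma chi_Gfield w K : (forall s, (K <= s)%N -> pairing s w = 0) ->
  chi (\sum_i nop false (bos (tnth t i)) (ferm b i) (-1 + 1) w) =
  \sum_(0 <= s < K) w_ s * chi (pairing s w).
Proof.
move=> wK; have chiL := @chi_linear C G alpha h u.
have [K0 K0P] := choice (fun i => chi_nop (tnth t i) b i w).
pose K1 := maxn (\max_i K0 i) K.
have KE : \sum_(0 <= s < K1) w_ s * chi (pairing s w) =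
    \sum_(0 <= s < K) w_ s * chi (pairing s w).
  apply: sum_truncate => [|s Ks]; first exact: leq_maxr.
  by rewrite (wK s Ks) (lin0 chiL) mulr0.
rewrite -KE addNr (lin_sum _ _ _ chiL).
have K0E i : chi (nop false (bos (tnth t i)) (ferm b i) 0 w) =
    \sum_(0 <= s < K1) w_ s * (hform G (tnth t i) h *: chi (ferm b i s%:Z w)).
  by apply: K0P; exact: leq_trans (leq_bigmax i) (leq_maxl _ _).
rewrite (eq_bigr _ (fun i _ => K0E i)).
rewrite exchange_big; apply: eq_bigr => s _.
rewrite /pairing (lin_sum _ _ _ chiL) mulr_sumr; apply: eq_bigr => i _.
by rewrite (linZ chiL).
Qed.
End CharacterFields.

(** * Oscillators along the isotropic planes *)

Lemma sum_anticommutator (C : numFieldType) (V : lmodType C) (I : finType)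
    (a c : I -> C) (z : I -> I -> C) (A B : I -> V -> V) v :
  (forall i, linear (A i)) -> (forall j, linear (B j)) ->
  (forall i j v, A i (B j v) = - B j (A i v) + z i j *: v) ->
  \sum_i a i *: A i (\sum_j c j *: B j v) =
  - (\sum_j c j *: B j (\sum_i a i *: A i v)) + (\sum_i \sum_j a i * c j * z i j) *: v.
Proof.
move=> AL BL AB.
have -> : \sum_j c j *: B j (\sum_i a i *: A i v) =
    \sum_i \sum_j (a i * c j) *: B j (A i v).
  rewrite exchange_big; apply: eq_bigr => j _.
  rewrite (lin_sum _ _ _ (BL j)) scaler_sumr; apply: eq_bigr => i _.
  by rewrite (linZ (BL j)) scalerA mulrC.
rewrite scaler_suml -sumrN -big_split; apply: eq_bigr => i _ /=.
rewrite (lin_sum _ _ _ (AL i)) scaler_sumr scaler_suml -sumrN -big_split.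
apply: eq_bigr => j _ /=.
by rewrite (linZ (AL i)) AB scalerA scalerDr scalerN scalerA.
Qed.

Section Combinations.
Variables (C : numFieldType) (G : 'M[int]_4).
Variable eps : lattice -> lattice -> int.
Hypothesis eps0 : forall l, eps 0 l = 1.
Hypothesis GT : G^T = G.
Local Notation V := (VNS C).
Local Notation bos := (@bos C G).
Local Notation ferm := (@ferm C).
Variables hp hm : 2.-tuple 'rV[C]_4.

Definition hcomb (t : 2.-tuple 'rV[C]_4) (x : 'I_2 -> C) : 'rV[C]_4 :=
  \sum_i x i *: tnth t i.

Definition fcomb (x : 'I_2 -> C) (b : bool) (n : int) (v : V) : V :=
  \sum_i x i *: ferm b i n v.

Lemma fcomb_linear x b n : linear (fcomb x b n).
Proof.
by apply: is_linear_sum => i; apply: is_linear_scale; exact: ferm_linear.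
Qed.

Lemma fcomb0 b n v : fcomb (fun=> 0) b n v = 0.
Proof. by rewrite /fcomb big1 // => i _; rewrite scale0r. Qed.

Lemma fcomb_ext x y b n v : x =1 y -> fcomb x b n v = fcomb y b n v.
Proof. by move=> xy; apply: eq_bigr => i _; rewrite xy. Qed.

Lemma fcomb_truncated x b v : exists K, forall n, (K <= n)%N -> fcomb x b n%:Z v = 0.
Proof.
have [K KP] := choice (fun i => ferm_truncated b i v).
exists (\max_i K i)%N => n Kn; rewrite /fcomb big1 // => i _.
by rewrite KP ?scaler0 //; exact: leq_trans (leq_bigmax i) Kn.
Qed.

Lemma bos_fcomb h n x b m v : bos h n (fcomb x b m v) = fcomb x b m (bos h n v).
Proof.
rewrite /fcomb (lin_sum _ _ _ (bos_linear G h n)); apply: eq_bigr => i _.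
by rewrite (linZ (bos_linear G h n)) (bos_ferm G h n b i m).
Qed.

Lemma fcomb_fcomb x b n y b' m v : fcomb x b n (fcomb y b' m v) =
  - fcomb y b' m (fcomb x b n v) +
  (((b' == ~~ b) && (m == -1 - n))%:R * \sum_i x i * y i) *: v.
Proof.
apply: etrans (@sum_anticommutator C V _ x y (fun i j =>
  [&& b' == ~~ b, i == j & m == - 1 - n]%:R) (fun i => ferm b i n)
  (fun j => ferm b' j m) v _ _ _) _ => [i|i|i j w|].
- exact: ferm_linear.
- exact: ferm_linear.
- exact: ferm_ferm.
congr (_ + _ *: v); rewrite mulr_sumr; apply: eq_bigr => i _.
rewrite (bigD1 i) //= eqxx big1 ?addr0 => [|j ji]; first by rewrite mulrC.
by rewrite [i == j]eq_sym (negPf ji) andbF mulr0.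
Qed.

Lemma bos_hcomb t x n v : bos (hcomb t x) n v = \sum_i x i *: bos (tnth t i) n v.
Proof.
have L := bos_linearx G n v.
by rewrite /hcomb (lin_sum _ _ _ L); apply: eq_bigr => i _; rewrite (linZ L).
Qed.

Lemma hform_combl t x y : hform G (hcomb t x) y = \sum_i x i * hform G (tnth t i) y.
Proof.
have L := hform_linearl G y.
by rewrite /hcomb (lin_sum _ _ _ L); apply: eq_bigr => i _; rewrite (linZ L).
Qed.

Lemma hform_combr t x y : hform G y (hcomb t x) = \sum_i x i * hform G y (tnth t i).
Proof.
rewrite (hform_sym GT) hform_combl; apply: eq_bigr => i _.
by rewrite (hform_sym GT).
Qed.

Section Fields.
Variables (t : 2.-tuple 'rV[C]_4) (b : bool).
Let Gfield n v := \sum_i nop false (bos (tnth t i)) (ferm b i) (n + 1) v.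
Let GfieldL n : linear (Gfield n).
Proof. by apply: is_linear_sum => i; exact: nop_linear. Qed.

Lemma Gfield_fcomb x n m w : Gfield n (fcomb x (~~ b) m w) =
  - fcomb x (~~ b) m (Gfield n w) + bos (hcomb t x) (n + 1 + m) w.
Proof.
rewrite bos_hcomb /fcomb (lin_sum _ _ _ (GfieldL n)) -sumrN -big_split.
apply: eq_bigr => i _ /=; rewrite (linZ (GfieldL n)).
rewrite -scalerN -scalerDr; apply: congr1; exact: Gfield_ferm.
Qed.

Lemma Gfield_fcomb_same x n m w : Gfield n (fcomb x b m w) = - fcomb x b m (Gfield n w).
Proof.
rewrite /fcomb (lin_sum _ _ _ (GfieldL n)) -sumrN.
apply: eq_bigr => i _ /=; rewrite (linZ (GfieldL n)) -scalerN; apply: congr1.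
exact: Gfield_ferm_same.
Qed.

Lemma Gfield_bos_comb x n m w : Gfield n (bos x m w) = bos x m (Gfield n w) -
  m%:~R *: fcomb (fun i => hform G (tnth t i) x) b (n + m) w.
Proof.
have -> : m%:~R *: fcomb (fun i => hform G (tnth t i) x) b (n + m) w =
    \sum_i (m%:~R * hform G (tnth t i) x) *: ferm b i (n + m) w.
  by rewrite scaler_sumr; apply: eq_bigr => i _; rewrite scalerA.
exact: Gfield_bos.
Qed.
End Fields.

Lemma Jop_fcomb x n b m w : Jop G eps n (fcomb x b m w) =
  fcomb x b m (Jop G eps n w) + (-1) ^+ b *: fcomb x b (n + m) w.
Proof.
have JL := @Jop_linear C G eps n.
rewrite /fcomb (lin_sum _ _ _ JL) scaler_sumr -big_split; apply: eq_bigr => i _ /=.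
by rewrite (linZ JL) (Jop_ferm G eps0 n b i m w) scalerDr !scalerA mulrC.
Qed.

Lemma Lop_fcomb x b m w : Lop G eps hp hm 0 (fcomb x b m w) =
  fcomb x b m (Lop G eps hp hm 0 w) - (2%:R^-1 * (2 * m + 1)%:~R) *: fcomb x b m w.
Proof.
have LL := @Lop_linear C G eps hp hm 0.
rewrite /fcomb (lin_sum _ _ _ LL) scaler_sumr -sumrN -big_split.
apply: eq_bigr => i _ /=.
rewrite (linZ LL) (Lop_ferm G eps0 hp hm b i m w) scalerDr scalerN !scalerA.
by rewrite [x i * _]mulrC.
Qed.
End Combinations.

(** * Physical states in one sector *)

Section Sectors.
Variables (C : numFieldType) (G : 'M[int]_4) (alpha : lattice).
Local Notation V := (VNS C).
Local Notation sector := (@sector C alpha).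

Lemma sector0 : sector 0.
Proof. by move=> k; rewrite msupp0 inE. Qed.

Lemma sector_lin a (u v : V) : sector u -> sector v -> sector (a *: u + v).
Proof.
move=> uS vS k; rewrite -mcoeff_neq0 mcoeffD mcoeffZ => kuv.
have [ku|ku] := boolP (k \in msupp u); first exact: uS.
have [kv|kv] := boolP (k \in msupp v); first exact: vS.
by move: kuv; rewrite (mcoeff_outdom ku) (mcoeff_outdom kv) mulr0 addr0 eqxx.
Qed.

Lemma sectorZ a (u : V) : sector u -> sector (a *: u).
Proof. by move=> uS; rewrite -[_ *: u]addr0; exact: sector_lin uS sector0. Qed.

Lemma sector_sum (I : Type) (r : seq I) (F : I -> V) :
  (forall i, sector (F i)) -> sector (\sum_(i <- r) F i).
Proof.
move=> FS; elim/big_ind: _ => [|u v uS vS|i _]; [exact: sector0| |exact: FS].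
by rewrite -[u]scale1r; exact: sector_lin uS vS.
Qed.

Lemma sector_if (b : bool) (u v : V) :
  sector u -> sector v -> sector (if b then u else v).
Proof. by case: b. Qed.

Lemma sector_mon l m D : l = alpha -> sector (<< (l, m, D) >> : V).
Proof. by move=> -> k; rewrite msuppU oner_eq0 inE => /eqP->. Qed.

Lemma sector_lext (f : fock -> V) v :
  (forall m D, sector (f (alpha, m, D))) -> sector v -> sector (lext f v).
Proof.
move=> fS vS; rewrite /lext big_seq; elim/big_ind: _ => [|x y xS yS|[[l m] D] kv].
- exact: sector0.
- by rewrite -[x]scale1r; exact: sector_lin xS yS.
by apply: sectorZ; rewrite (_ : l = alpha) //; exact: (vS _ kv).
Qed.

Lemma sector_bos x n v : sector v -> sector (bos G x n v).
Proof.
apply: sector_lext => m D; case: n => [[|p]|p].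
- by apply: sectorZ; exact: sector_mon.
- by apply: sector_sum => i; apply: sectorZ; exact: sector_mon.
by apply: sector_sum => i; apply: sectorZ; exact: sector_mon.
Qed.

Lemma sector_ferm b i n v : sector v -> sector (ferm b i n v).
Proof.
apply: sector_lext => m D; case: n => p.
  apply: sector_if sector0; apply: sectorZ; exact: sector_mon.
apply: sector_if sector0 _; apply: sectorZ; exact: sector_mon.
Qed.

Lemma sector_fcomb x b n v : sector v -> sector (fcomb x b n v).
Proof. by move=> vS; apply: sector_sum => i; apply: sectorZ; exact: sector_ferm. Qed.
End Sectors.

Section PhysicalStates.
Variables (C : numFieldType) (G : 'M[int]_4).
Variable eps : lattice -> lattice -> int.
Hypothesis eps0 : forall l, eps 0 l = 1.
Hypothesis GT : G^T = G.
Local Notation V := (VNS C).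
Local Notation bos := (@bos C G).
Variables hp hm : 2.-tuple 'rV[C]_4.
Hypothesis pp0 : forall i j, hform G (tnth hp i) (tnth hp j) = 0.
Hypothesis mm0 : forall i j, hform G (tnth hm i) (tnth hm j) = 0.
Hypothesis pm1 : forall i j, hform G (tnth hp i) (tnth hm j) = (i == j)%:R.
Variables (alpha : lattice) (f g : 'I_2 -> C) (kap kap' : C).
Hypothesis fg0 : \sum_i f i * g i = 0.
Hypothesis kapD : kap + kap' = -1.
Local Notation bp := (hcomb hp f).
Local Notation bm := (hcomb hm g).
Hypothesis bp_alpha : hform G bp (hlat C alpha) = kap.
Hypothesis bm_alpha : hform G bm (hlat C alpha) = kap'.

Definition bosP (k : nat) : V -> V := bos bp (- k%:Z).
Definition bosM (k : nat) : V -> V := bos bm (- k%:Z).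
Definition fermP (j : nat) : V -> V := fcomb g false (Negz j).
Definition fermM (j : nat) : V -> V := fcomb f true (Negz j).

Lemma hform_pp x i : hform G (tnth hp i) (hcomb hp x) = 0.
Proof. by rewrite (hform_combr GT) big1 // => j _; rewrite pp0 mulr0. Qed.

Lemma hform_mm x i : hform G (tnth hm i) (hcomb hm x) = 0.
Proof. by rewrite (hform_combr GT) big1 // => j _; rewrite mm0 mulr0. Qed.

Lemma hform_pm x i : hform G (tnth hp i) (hcomb hm x) = x i.
Proof.
rewrite (hform_combr GT) (bigD1 i) //= pm1 eqxx mulr1 big1 ?addr0 // => j ji.
by rewrite pm1 eq_sym (negPf ji) mulr0.
Qed.

Lemma hform_mp x i : hform G (tnth hm i) (hcomb hp x) = x i.
Proof.
rewrite (hform_combr GT) (bigD1 i) //= (hform_sym GT) pm1 eqxx mulr1 big1 ?addr0 // => j ji.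
by rewrite (hform_sym GT) pm1 (negPf ji) mulr0.
Qed.

Lemma hform_combpp x y : hform G (hcomb hp x) (hcomb hp y) = 0.
Proof. by rewrite hform_combl big1 // => i _; rewrite hform_pp mulr0. Qed.

Lemma hform_combmm x y : hform G (hcomb hm x) (hcomb hm y) = 0.
Proof. by rewrite hform_combl big1 // => i _; rewrite hform_mm mulr0. Qed.

Lemma hform_combpm x y : hform G (hcomb hp x) (hcomb hm y) = \sum_i x i * y i.
Proof. by rewrite hform_combl; apply: eq_bigr => i _; rewrite hform_pm. Qed.

Lemma bos_bos0 x y n m v : hform G x y = 0 -> bos x n (bos y m v) = bos y m (bos x n v).
Proof. by move=> xy; rewrite (bos_bos GT x y n m v) xy mulr0 scale0r addr0. Qed.

Lemma fcomb_fcomb0 x b n y b' m v : (b' == ~~ b) && (m == -1 - n) = false \/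
  \sum_i x i * y i = 0 ->
  fcomb x b n (fcomb y b' m v) = - fcomb y b' m (fcomb x b n v) :> V.
Proof. by rewrite fcomb_fcomb => -[->|->]; rewrite ?mul0r ?mulr0 scale0r addr0. Qed.

Let gf0 : \sum_i g i * f i = 0.
Proof. by rewrite -[RHS]fg0; apply: eq_bigr => i _; rewrite mulrC. Qed.

(** On these vectors the deformed oscillators have only creation modes: the
    annihilation modes act as 0 and the zero modes as scalars. Since all the
    modes supercommute, creation operators preserve this property, and the
    brackets of the N = 2 generators with them stay within creation operators. *)
Record transparent (v : V) : Prop := {
  transP : forall k : nat, (0 < k)%N -> bos bp k%:Z v = 0;
  transM : forall k : nat, (0 < k)%N -> bos bm k%:Z v = 0;
  transP0 : bos bp 0 v = kap *: v;
  transM0 : bos bm 0 v = kap' *: v;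
  transF : forall p : nat, fcomb g false p%:Z v = 0;
  transF' : forall p : nat, fcomb f true p%:Z v = 0;
  trans_sector : sector alpha v }.

Lemma transparent_lin a u v : transparent u -> transparent v -> transparent (a *: u + v).
Proof.
move=> [uP uM uP0 uM0 uF uF' uS] [vP vM vP0 vM0 vF vF' vS].
have e1 (x y c : C) (u' v' : V) : a *: (c *: u') + c *: v' = c *: (a *: u' + v').
  by rewrite scalerDr !scalerA mulrC.
split.
- by move=> k k0; rewrite bos_linear (uP k k0) (vP k k0) scaler0 addr0.
- by move=> k k0; rewrite bos_linear (uM k k0) (vM k k0) scaler0 addr0.
- by rewrite bos_linear uP0 vP0; exact: e1.
- by rewrite bos_linear uM0 vM0; exact: e1.
- by move=> p; rewrite fcomb_linear (uF p) (vF p) scaler0 addr0.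
- by move=> p; rewrite fcomb_linear (uF' p) (vF' p) scaler0 addr0.
exact: sector_lin.
Qed.

Lemma transparent0 : transparent 0.
Proof.
split=> [k _|k _|||p|p|]; rewrite ?scaler0.
- exact: lin0 (bos_linear G _ _).
- exact: lin0 (bos_linear G _ _).
- exact: lin0 (bos_linear G _ _).
- exact: lin0 (bos_linear G _ _).
- exact: lin0 (fcomb_linear _ _ _).
- exact: lin0 (fcomb_linear _ _ _).
exact: sector0.
Qed.

(** A single sign sg covers bosons, sg = 1, and fermions, sg = -1. *)
Lemma transparent_comm (X : V -> V) (sg : C) v : linear X ->
  (forall n w, bos bp n (X w) = X (bos bp n w)) ->
  (forall n w, bos bm n (X w) = X (bos bm n w)) ->
  (forall n w, fcomb g false n (X w) = sg *: X (fcomb g false n w)) ->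
  (forall n w, fcomb f true n (X w) = sg *: X (fcomb f true n w)) ->
  (sector alpha v -> sector alpha (X v)) ->
  transparent v -> transparent (X v).
Proof.
move=> XL XP XM XF XF' XS [vP vM vP0 vM0 vF vF' vS]; split.
- by move=> k k0; rewrite XP (vP k k0) (lin0 XL).
- by move=> k k0; rewrite XM (vM k k0) (lin0 XL).
- rewrite XP vP0; exact: (linZ XL kap v).
- rewrite XM vM0; exact: (linZ XL kap' v).
- by move=> p; rewrite XF (vF p) (lin0 XL) scaler0.
- by move=> p; rewrite XF' (vF' p) (lin0 XL) scaler0.
exact: XS.
Qed.

Lemma transparent_bosP k v : transparent v -> transparent (bosP k v).
Proof.
apply: (transparent_comm (sg := 1)) => [|n w|n w|n w|n w|]; rewrite ?scale1r.
- exact: bos_linear.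
- by apply: bos_bos0; exact: hform_combpp.
- by apply: bos_bos0; rewrite (hform_sym GT) hform_combpm.
- by symmetry; exact: bos_fcomb.
- by symmetry; exact: bos_fcomb.
exact: sector_bos.
Qed.

Lemma transparent_bosM k v : transparent v -> transparent (bosM k v).
Proof.
apply: (transparent_comm (sg := 1)) => [|n w|n w|n w|n w|]; rewrite ?scale1r.
- exact: bos_linear.
- by apply: bos_bos0; rewrite hform_combpm.
- by apply: bos_bos0; exact: hform_combmm.
- by symmetry; exact: bos_fcomb.
- by symmetry; exact: bos_fcomb.
exact: sector_bos.
Qed.

Lemma transparent_fermP k v : transparent v -> transparent (fermP k v).
Proof.
apply: (transparent_comm (sg := -1)) => [|n w|n w|n w|n w|]; rewrite ?scaleN1r.
- exact: fcomb_linear.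
- exact: bos_fcomb.
- exact: bos_fcomb.
- by apply: fcomb_fcomb0; left.
- by apply: fcomb_fcomb0; right.
exact: sector_fcomb.
Qed.

Lemma transparent_fermM k v : transparent v -> transparent (fermM k v).
Proof.
apply: (transparent_comm (sg := -1)) => [|n w|n w|n w|n w|]; rewrite ?scaleN1r.
- exact: fcomb_linear.
- exact: bos_fcomb.
- exact: bos_fcomb.
- by apply: fcomb_fcomb0; right.
- by apply: fcomb_fcomb0; left.
exact: sector_fcomb.
Qed.

Record physical (lam : C) (v : V) : Prop := {
  phys_trans : transparent v;
  phys_Gp : forall n : nat, Gplus G eps hp n v = 0;
  phys_Gm : forall n : nat, Gminus G eps hm n v = 0;
  phys_J : forall n : nat, Jop G eps n v = 0;
  phys_L : Lop G eps hp hm 0 v = lam *: v }.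

Definition state (n : nat) : V -> V := state_op bosP bosM fermP fermM n.

Let bosPL k : linear (bosP k). Proof. exact: bos_linear. Qed.
Let bosML k : linear (bosM k). Proof. exact: bos_linear. Qed.
Let fermPL k : linear (fermP k). Proof. exact: fcomb_linear. Qed.
Let fermML k : linear (fermM k). Proof. exact: fcomb_linear. Qed.

Lemma bosP_fermP i j v : bosP i (fermP j v) = fermP j (bosP i v).
Proof. exact: bos_fcomb. Qed.

Lemma bosP_fermM i j v : bosP i (fermM j v) = fermM j (bosP i v).
Proof. exact: bos_fcomb. Qed.

Lemma bosM_fermP i j v : bosM i (fermP j v) = fermP j (bosM i v).
Proof. exact: bos_fcomb. Qed.

Lemma bosM_fermM i j v : bosM i (fermM j v) = fermM j (bosM i v).
Proof. exact: bos_fcomb. Qed.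

Lemma fermP_fermP i j v : fermP i (fermP j v) = - fermP j (fermP i v).
Proof. by apply: fcomb_fcomb0; left. Qed.

Lemma fermM_fermM i j v : fermM i (fermM j v) = - fermM j (fermM i v).
Proof. by apply: fcomb_fcomb0; left. Qed.

Lemma fermP_fermM i j v : fermP i (fermM j v) = - fermM j (fermP i v).
Proof. by apply: fcomb_fcomb0; right. Qed.

Let GpE n v := @GplusE C G eps eps0 hp n v.
Let GmE n v := @GminusE C G eps eps0 hm n v.

Lemma Gplus_bos x (n : nat) k w : Gplus G eps hp n (bos x (- k%:Z) w) =
  bos x (- k%:Z) (Gplus G eps hp n w) +
  k%:R *: fcomb (fun i => hform G (tnth hp i) x) false (n%:Z - k%:Z) w.
Proof.
rewrite !GpE; apply: etrans (Gfield_bos_comb GT hp false x n (- k%:Z) w) _.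
by rewrite rmorphN /= -pmulrn scaleNr opprK.
Qed.

Lemma Gminus_bos x (n : nat) k w : Gminus G eps hm n (bos x (- k%:Z) w) =
  bos x (- k%:Z) (Gminus G eps hm n w) +
  k%:R *: fcomb (fun i => hform G (tnth hm i) x) true (n%:Z - k%:Z) w.
Proof.
rewrite !GmE; apply: etrans (Gfield_bos_comb GT hm true x n (- k%:Z) w) _.
by rewrite rmorphN /= -pmulrn scaleNr opprK.
Qed.

Lemma bosP_split (n j : nat) w : transparent w ->
  bos bp (n%:Z + 1 + Negz j) w = if (n <= j)%N then bosP (j - n)%N w else 0.
Proof.
move=> [wP _ _ _ _ _ _]; case: leqP => nj.
  by rewrite /bosP (_ : _ + Negz j = - (j - n)%N%:Z) //; lia.
by rewrite (_ : _ + Negz j = (n - j)%N%:Z) ?wP //; lia.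
Qed.

Lemma bosM_split (n j : nat) w : transparent w ->
  bos bm (n%:Z + 1 + Negz j) w = if (n <= j)%N then bosM (j - n)%N w else 0.
Proof.
move=> [_ wM _ _ _ _ _]; case: leqP => nj.
  by rewrite /bosM (_ : _ + Negz j = - (j - n)%N%:Z) //; lia.
by rewrite (_ : _ + Negz j = (n - j)%N%:Z) ?wM //; lia.
Qed.

Lemma fcomb_split x b (n j : nat) w : (forall p : nat, fcomb x b p%:Z w = 0) ->
  fcomb x b (n%:Z + Negz j) w =
    if (n <= j)%N then fcomb x b (Negz (j - n)%N) w else 0 :> V.
Proof.
move=> wF; case: leqP => nj; first by rewrite (_ : _ + Negz j = Negz (j - n)%N) //; lia.
by rewrite (_ : _ + Negz j = (n - j.+1)%N%:Z) ?wF //; lia.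
Qed.

Lemma fcomb_mode x b (n k : nat) w : (forall p : nat, fcomb x b p%:Z w = 0) ->
  k%:R *: fcomb x b (n%:Z - k%:Z) w =
    if (n < k)%N then k%:R *: fcomb x b (Negz (k - n.+1)%N) w else 0 :> V.
Proof.
move=> wF; case: k => [|k]; first exact: scale0r.
have e : n%:Z - k.+1%:Z = n%:Z + Negz k by lia.
rewrite e (fcomb_split n k wF) ltnS subSS; case: leqP => _; first exact: erefl.
exact: scaler0.
Qed.

Let stT n v : transparent v -> transparent (state n v).
Proof.
exact: (state_opT bosPL bosML transparent0 transparent_lin transparent_bosP
  transparent_bosM transparent_fermP transparent_fermM).
Qed.

Lemma Gplus_physical n (m : nat) v : transparent v ->
  Gplus G eps hp m v = 0 -> Gplus G eps hp m (state n v) = 0.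
Proof.
apply: (Gplus_state bosPL bosML fermPL fermML bosP_fermP bosM_fermP fermP_fermP
  fermP_fermM transparent0 transparent_lin transparent_bosP transparent_bosM
  transparent_fermM) => [|k w Tw|k w Tw|j w Tw|j w Tw].
- exact: Gplus_linear.
- rewrite /bosP Gplus_bos (fcomb_ext false _ w (hform_pp f)) fcomb0 scaler0.
  exact: addr0.
- apply: etrans (Gplus_bos bm m k w) _; rewrite (fcomb_ext false _ w (hform_pm g)).
  exact: (congr1 (fun z => bosM k (Gplus G eps hp m w) + z) (fcomb_mode m k (transF Tw))).
- by rewrite !GpE; exact: Gfield_fcomb_same.
by rewrite !GpE /fermM -bosP_split //; exact: Gfield_fcomb.
Qed.

Lemma Gminus_physical n (m : nat) v : transparent v ->
  Gminus G eps hm m v = 0 -> Gminus G eps hm m (state n v) = 0.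
Proof.
apply: (Gminus_state bosPL bosML fermPL fermML bosP_fermM bosM_fermM fermM_fermM
  transparent0 transparent_lin transparent_bosP transparent_bosM
  transparent_fermM kapD) => [w Tw|w Tw||k w Tw|k w Tw|j w Tw|j w Tw].
- exact: transP0 Tw.
- exact: transM0 Tw.
- exact: Gminus_linear.
- rewrite /bosM Gminus_bos (fcomb_ext true _ w (hform_mm g)) fcomb0 scaler0.
  exact: addr0.
- apply: etrans (Gminus_bos bp m k w) _; rewrite (fcomb_ext true _ w (hform_mp f)).
  exact: (congr1 (fun z => bosP k (Gminus G eps hm m w) + z) (fcomb_mode m k (transF' Tw))).
- by rewrite !GmE; exact: Gfield_fcomb_same.
by rewrite !GmE /fermP -bosM_split //; exact: Gfield_fcomb.
Qed.

Lemma Jop_physical n (m : nat) v : transparent v ->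
  Jop G eps m v = 0 -> Jop G eps m (state n v) = 0.
Proof.
apply: (current_state bosPL bosML fermPL fermML
  transparent0 transparent_lin transparent_bosP transparent_bosM
  transparent_fermM) => [|k w Tw|k w Tw|j w Tw|j w Tw].
- exact: Jop_linear.
- exact: Jop_bos.
- exact: Jop_bos.
- apply: etrans (Jop_fcomb G eps0 g m false (Negz j) w) _.
  rewrite expr0 scale1r (fcomb_split m j (transF Tw)); exact: erefl.
apply: etrans (Jop_fcomb G eps0 f m true (Negz j) w) _.
rewrite expr1 scaleN1r (fcomb_split m j (transF' Tw)); exact: erefl.
Qed.

Lemma Lop_physical n v lam : transparent v -> Lop G eps hp hm 0 v = lam *: v ->
  Lop G eps hp hm 0 (state n v) = (lam + n%:R) *: state n v.
Proof.
have half j : - (2%:R^-1 * (2 * Negz j + 1)%:~R) = j%:R + 2%:R^-1 :> C.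
  rewrite NegzE rmorphD rmorphM rmorphN /= -pmulrn -natr1.
  by field.
apply: (energy_state bosPL bosML fermPL fermML
  transparent0 transparent_lin transparent_bosP transparent_bosM
  transparent_fermM) => [|k w Tw|k w Tw|j w Tw|j w Tw].
- exact: Lop_linear.
- rewrite /bosP (Lop_bos eps0 GT hp hm bp (- k%:Z) w) rmorphN scaleNr opprK /= -pmulrn.
  congr (_ + _ *: _); rewrite (bos_hcomb G hp f); apply: eq_bigr => i _.
  by rewrite hform_mp hform_pp scale0r addr0.
- rewrite /bosM (Lop_bos eps0 GT hp hm bm (- k%:Z) w) rmorphN scaleNr opprK /= -pmulrn.
  congr (_ + _ *: _); rewrite (bos_hcomb G hm g); apply: eq_bigr => i _.
  by rewrite hform_pm hform_mm scale0r add0r.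
- by rewrite /fermP (Lop_fcomb G eps0 hp hm g false (Negz j) w) -scaleNr half.
by rewrite /fermM (Lop_fcomb G eps0 hp hm f true (Negz j) w) -scaleNr half.
Qed.

Lemma physical_state n lam v : physical lam v -> physical (lam + n%:R) (state n v).
Proof.
move=> [Tv vGp vGm vJ vL]; split.
- exact: stT.
- by move=> m; exact: (Gplus_physical n Tv (vGp m)).
- by move=> m; exact: (Gminus_physical n Tv (vGm m)).
- by move=> m; exact: (Jop_physical n Tv (vJ m)).
exact: (Lop_physical n Tv vL).
Qed.

Lemma physical_ground : physical (\sum_i hform G (tnth hp i) (hlat C alpha) *
  hform G (tnth hm i) (hlat C alpha)) (ket alpha mset0 fset0).
Proof.
split.
- split=> [k k0|k k0|||p|p|].
  + by rewrite bos_ground eqn0Ngt k0 mul0r scale0r.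
  + by rewrite bos_ground eqn0Ngt k0 mul0r scale0r.
  + by rewrite bos_ground mul1r bp_alpha.
  + by rewrite bos_ground mul1r bm_alpha.
  + by rewrite /fcomb big1 // => i _; rewrite ferm_ground scaler0.
  + by rewrite /fcomb big1 // => i _; rewrite ferm_ground scaler0.
  by rewrite ket.unlock; exact: sector_mon.
- by move=> m; exact: Gplus_ground.
- by move=> m; exact: Gminus_ground.
- by move=> m; exact: Jop_ground.
exact: Lop_ground.
Qed.

Lemma physical_states s : physical (\sum_i hform G (tnth hp i) (hlat C alpha) *
    hform G (tnth hm i) (hlat C alpha) + (\sum_(n <- s) n)%:R)
  (foldr state (ket alpha mset0 fset0) s).
Proof.
elim: s => [|n s IH]; first by rewrite big_nil addr0; exact: physical_ground.
by rewrite big_cons addnC natrD addrA; exact: physical_state.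
Qed.

Lemma physical_P00 v : physical 0 v -> P00_ G eps hp hm alpha v.
Proof.
move=> [Tv vGp vGm vJ vL]; split; last exact: trans_sector Tv.
split=> [||[//|n] _]; first by rewrite vL scale0r.
  exact: vJ 0%N.
by rewrite (_ : n.+1%:Z - 1 = n) ?vGp ?vGm ?vJ //; lia.
Qed.
End PhysicalStates.

(** * The obstruction to exactness *)

Lemma neg_swap (V : zmodType) (x y z : V) : x = - y + z -> y = - x + z.
Proof. by move=> ->; rewrite opprD opprK subrK. Qed.

Lemma sub_swap (C : numFieldType) (V : lmodType C) (m : nat) (x y z : V) :
  x = y - m%:Z%:~R *: z -> y = x + m%:R *: z.
Proof. by move=> ->; rewrite subrK. Qed.

Lemma neg_swap0 (V : zmodType) (x y : V) : x = - y -> y = - x.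
Proof. by move=> ->; rewrite opprK. Qed.

Section PsiLinear.
Variables (C : numFieldType) (V : lmodType C) (u : {poly C}).
Variables (Lam : V -> {poly C}) (hp2 a2 a2s : nat -> V -> V).
Hypothesis LamL : linear Lam.
Hypothesis hp2L : forall k, linear (hp2 k).
Hypothesis a2L : forall k, linear (a2 k).
Hypothesis a2sL : forall k, linear (a2s k).
Local Notation psi := (Psi u Lam hp2 a2 a2s).

Lemma Psi_comb K g a v w : psi K g (a *: v + w) = a * psi K g v + psi K g w.
Proof.
rewrite /Psi mulrDr !mulr_sumr addrACA -!big_split /=.
apply: eq_bigr => m _; congr (_ + _).
  by rewrite hp2L LamL mulrDr coefD -scalerAr coefZ mulrDr mulrCA.
rewrite mulr_sumr -big_split; apply: eq_bigr => s _ /=.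
by rewrite a2sL a2L LamL !mulrDr coefD -!scalerAr coefZ mulrDr mulrCA.
Qed.

Lemma Psi_add K g v w : psi K g (v + w) = psi K g v + psi K g w.
Proof. by rewrite -[v in LHS]scale1r Psi_comb mul1r. Qed.

Lemma Psi_sum K g d (c : 'I_d -> C) (v : 'I_d -> V) :
  psi K g (\sum_i c i *: v i) = \sum_i c i * psi K g (v i).
Proof.
elim/big_rec2: _ => [|i x w _ <-]; last exact: Psi_comb.
by have := Psi_comb K g (-1) 0 0; rewrite scaler0 addr0 mulN1r addNr.
Qed.

Lemma Psi_scale K a g v : psi K (a *: g) v = a * psi K g v.
Proof.
rewrite /Psi mulrDr !mulr_sumr; congr (_ + _); apply: eq_bigr => m _.
  by rewrite -scalerAl coefZ mulrCA.
by rewrite mulr_sumr; apply: eq_bigr => s _; rewrite -scalerAl coefZ mulrCA.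
Qed.
End PsiLinear.

Section Obstruction.
Variables (C : numFieldType) (G : 'M[int]_4).
Variable eps : lattice -> lattice -> int.
Hypothesis eps0 : forall l, eps 0 l = 1.
Hypothesis GT : G^T = G.
Local Notation V := (VNS C).
Local Notation bos := (@bos C G).
Variables hp hm : 2.-tuple 'rV[C]_4.
Hypothesis pp0 : forall i j, hform G (tnth hp i) (tnth hp j) = 0.
Hypothesis mm0 : forall i j, hform G (tnth hm i) (tnth hm j) = 0.
Hypothesis pm1 : forall i j, hform G (tnth hp i) (tnth hm j) = (i == j)%:R.
Variables (alpha : lattice) (r s : 'I_2 -> C) (u : {poly C}).
Local Notation h2p := (hcomb hp r).
Local Notation h2m := (hcomb hm s).
Hypothesis h2p_alpha : hform G h2p (hlat C alpha) = 0.
Hypothesis h2m_alpha : hform G h2m (hlat C alpha) = 0.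

Local Notation Lam := (chi G alpha h2m u).
Definition bosr (k : nat) : V -> V := bos h2p k%:Z.
Definition boss (k : nat) : V -> V := bos h2m k%:Z.
Definition ferms (k : nat) : V -> V := fcomb s false k%:Z.
Definition fermr (k : nat) : V -> V := fcomb r true k%:Z.
(** Psi for the oscillators along h^+ and h^-, which are orthogonal to alpha and
    dual to each other. *)
Definition obstruction (K : nat) (g : {poly C}) (v : V) : C :=
  Psi u Lam bosr ferms fermr K g v.

Let LamL : linear Lam. Proof. exact: chi_linear. Qed.
Let bosrL k : linear (bosr k). Proof. exact: bos_linear. Qed.
Let fermsL k : linear (ferms k). Proof. exact: fcomb_linear. Qed.
Let fermrL k : linear (fermr k). Proof. exact: fcomb_linear. Qed.
Let GpE n v := @GplusE C G eps eps0 hp n v.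
Let GmE n v := @GminusE C G eps eps0 hm n v.
Let ferms_bosr k l w : ferms k (bosr l w) = bosr l (ferms k w).
Proof. by symmetry; exact: bos_fcomb. Qed.

Let ferms_fermr k l w : ferms k (fermr l w) = - fermr l (ferms k w).
Proof. by apply: fcomb_fcomb0; left; apply/negbTE; rewrite negb_and; apply/orP; right; lia. Qed.

Let ferms_ferms k l w : ferms k (ferms l w) = - ferms l (ferms k w).
Proof. by apply: fcomb_fcomb0; left. Qed.

Let fermr_boss k l w : fermr k (boss l w) = boss l (fermr k w).
Proof. by symmetry; exact: bos_fcomb. Qed.

Let Lam_bosr0 w : Lam (bosr 0 w) = 0.
Proof. by rewrite /bosr (chi_bos0 G alpha h2m u h2p w) h2p_alpha scale0r. Qed.

Let pairing_ferms k w : pairing G h2m hp false k w = ferms k w.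
Proof. exact: fcomb_ext (hform_pm GT pm1 s). Qed.

Let Lam_Gplus w K : (forall k, (K <= k)%N -> ferms k w = 0) ->
  Lam (Gplus G eps hp (-1) w) = \sum_(0 <= k < K) u^`N(k) * Lam (ferms k w).
Proof.
move=> wK; rewrite GpE.
rewrite (chi_Gfield GT alpha (h := h2m) u (t := hp) (b := false) (w := w) (K := K)) => [|k Kk]; last first.
  by rewrite pairing_ferms; exact: wK.
by apply: eq_bigr => k _; rewrite pairing_ferms.
Qed.

Let Lam_Gminus w : Lam (Gminus G eps hm (-1) w) = 0.
Proof.
have w0 k : (0 <= k)%N -> pairing G h2m hm true k w = 0.
  by move=> _; exact: etrans (fcomb_ext _ _ _ (hform_mm GT mm0 s)) (fcomb0 _ _ _).
have := chi_Gfield GT alpha u w0; rewrite -GmE => ->.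
exact: big_geq.
Qed.

Let Lam_boss w K : (forall k, (K <= k)%N -> boss k w = 0) ->
  \sum_(0 <= k < K) u^`N(k) * Lam (boss k w) = (Lam w)^`().
Proof.
move=> wK; have [K0 /(_ (maxn K K0) (leq_maxr _ _)) <-] := chi_deriv GT u h2m_alpha w.
symmetry; apply: sum_truncate => [|k Kk]; first exact: leq_maxl.
have := wK k Kk; rewrite /boss => ->.
by rewrite (lin0 LamL) mulr0.
Qed.

Let bosr_Gplus k w : bosr k (Gplus G eps hp (-1) w) = Gplus G eps hp (-1) (bosr k w).
Proof.
symmetry; rewrite !GpE; apply: etrans (Gfield_bos_comb GT hp false h2p (-1) k w) _.
rewrite (fcomb_ext _ _ _ (hform_pp GT pp0 r)) fcomb0 scaler0; exact: subr0.
Qed.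

Let fermr_Gplus k w : fermr k (Gplus G eps hp (-1) w) =
  - Gplus G eps hp (-1) (fermr k w) + bosr k w.
Proof.
apply: neg_swap; rewrite (GpE (-1) (fermr k w)) (GpE (-1) w).
have := Gfield_fcomb G hp false r (-1) k w; rewrite (_ : -1 + 1 + k%:Z = k%:Z) //; lia.
Qed.

Let ferms_Gplus k w : ferms k (Gplus G eps hp (-1) w) =
  - Gplus G eps hp (-1) (ferms k w).
Proof.
apply: neg_swap0; rewrite (GpE (-1) (ferms k w)) (GpE (-1) w).
exact: (Gfield_fcomb_same G hp false s (-1) k w).
Qed.

Let bosr_Gminus k w : bosr k.+1 (Gminus G eps hm (-1) w) =
  Gminus G eps hm (-1) (bosr k.+1 w) + k.+1%:R *: fermr k w.
Proof.
apply: sub_swap; rewrite (GmE (-1) (bosr k.+1 w)) (GmE (-1) w).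
apply: etrans (Gfield_bos_comb GT hm true h2p (-1) k.+1 w) _.
rewrite (fcomb_ext _ _ _ (hform_mp GT pm1 r)) (_ : -1 + k.+1%:Z = k%:Z); last by lia.
exact: erefl.
Qed.

Let fermr_Gminus k w : fermr k (Gminus G eps hm (-1) w) =
  - Gminus G eps hm (-1) (fermr k w).
Proof.
apply: neg_swap0; rewrite (GmE (-1) (fermr k w)) (GmE (-1) w).
exact: (Gfield_fcomb_same G hm true r (-1) k w).
Qed.

Let ferms_Gminus k w : ferms k (Gminus G eps hm (-1) w) =
  - Gminus G eps hm (-1) (ferms k w) + boss k w.
Proof.
apply: neg_swap; rewrite (GmE (-1) (ferms k w)) (GmE (-1) w).
have := Gfield_fcomb G hm true s (-1) k w; rewrite (_ : -1 + 1 + k%:Z = k%:Z) //; lia.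
Qed.

(** The bound K0 is needed because x and z are arbitrary vectors, on which the
    annihilation modes vanish only from some index on. *)
Lemma obstruction_exact x z : exists K0, forall K, (K0 <= K)%N ->
  obstruction K 1 (Gplus G eps hp (-1) x + Gminus G eps hm (-1) z) = 0.
Proof.
have [K1 bosrx] := bos_truncated G h2p x.
have [K2 fermsx] := fcomb_truncated s false x.
have [K3 bossz] := bos_truncated G h2m z.
have [K4 fermrz] := fcomb_truncated r true z.
exists (maxn (maxn K1 K2) (maxn K3 K4)) => K.
rewrite !geq_max => /andP[/andP[K1K K2K] /andP[K3K K4K]].
have xE := Psi_Gp LamL bosrL fermsL fermrL ferms_bosr ferms_fermr ferms_ferms
  Lam_bosr0 Lam_Gplus bosr_Gplus fermr_Gplus ferms_Gplus
  (fun k Kk => fermsx k (leq_trans K2K Kk)) (fun k Kk => bosrx k (leq_trans K1K Kk)).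
have zE := Psi_Gm LamL fermsL fermrL fermr_boss Lam_boss Lam_Gminus bosr_Gminus
  fermr_Gminus ferms_Gminus (fun k Kk => fermrz k (leq_trans K4K Kk))
  (fun k Kk => bossz k (leq_trans K3K Kk)).
apply: etrans (Psi_add u LamL bosrL fermsL fermrL K 1 _ _) _.
exact: etrans (congr2 +%R xE zE) (addr0 _).
Qed.

Lemma obstruction_sum K gg d (c : 'I_d -> C) (v : 'I_d -> V) :
  obstruction K gg (\sum_i c i *: v i) = \sum_i c i * obstruction K gg (v i).
Proof. exact: (Psi_sum u LamL bosrL fermsL fermrL). Qed.

Section Evaluate.
Variables (f g : 'I_2 -> C) (kap y : C).
Hypothesis bp_alpha : hform G (hcomb hp f) (hlat C alpha) = kap.
Hypothesis fs1 : \sum_i f i * s i = 1.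
Hypothesis rg : \sum_i r i * g i = y.
Hypothesis fg0 : \sum_i f i * g i = 0.
Local Notation bosP := (bosP G hp f).
Local Notation bosM := (bosM G hm g).
Local Notation fermP := (fermP g).
Local Notation fermM := (fermM f).

Let bosPL k : linear (bosP k). Proof. exact: bos_linear. Qed.
Let bosML k : linear (bosM k). Proof. exact: bos_linear. Qed.
Let fermPL k : linear (fermP k). Proof. exact: fcomb_linear. Qed.
Let fermML k : linear (fermM k). Proof. exact: fcomb_linear. Qed.

Let Lam_bosP0 w : Lam (bosP 0 w) = kap *: Lam w.
Proof. by apply: etrans (chi_bos0 G alpha h2m u _ w) _; rewrite bp_alpha. Qed.

Let Lam_bosP k w : Lam (bosP k.+1 w) = u^`N(k) * Lam w.
Proof.
apply: etrans (chi_bos_neg GT alpha h2m u _ k w) _.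
by rewrite (hform_combpm GT pm1) fs1 scale1r.
Qed.

Let Lam_bosM k w : Lam (bosM k.+1 w) = 0.
Proof.
apply: etrans (chi_bos_neg GT alpha h2m u _ k w) _.
by rewrite (hform_combmm GT mm0) scale0r.
Qed.

Let Lam_fcomb x b k w : Lam (fcomb x b (Negz k) w) = 0.
Proof.
rewrite /fcomb (lin_sum _ _ _ LamL) big1 // => i _.
by rewrite (linZ LamL) (chi_ferm_neg G alpha h2m u b i k w) scaler0.
Qed.

Let bosr_bosP k j w : bosr k (bosP j w) = bosP j (bosr k w).
Proof. exact: (bos_bos0 GT _ _ _ (hform_combpp GT pp0 r f)). Qed.

Let bosr_bosM k j w : bosr k (bosM j w) =
  bosM j (bosr k w) + ((j == k)%:R * (k%:R * y)) *: w.
Proof.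
apply: etrans (bos_bos GT h2p (hcomb hm g) k%:Z (- j%:Z) w) _.
rewrite (hform_combpm GT pm1) rg eqr_opp -mulrA -pmulrn; exact: erefl.
Qed.

Let bosr_fermP k j w : bosr k (fermP j w) = fermP j (bosr k w).
Proof. exact: bos_fcomb. Qed.

Let fermr_bosP k j w : fermr k (bosP j w) = bosP j (fermr k w).
Proof. symmetry; exact: bos_fcomb. Qed.

Let fermr_bosM k j w : fermr k (bosM j w) = bosM j (fermr k w).
Proof. symmetry; exact: bos_fcomb. Qed.

Let ferms_bosP k j w : ferms k (bosP j w) = bosP j (ferms k w).
Proof. symmetry; exact: bos_fcomb. Qed.

Let ferms_bosM k j w : ferms k (bosM j w) = bosM j (ferms k w).
Proof. symmetry; exact: bos_fcomb. Qed.

Let opposite_mode k j : (Negz j == -1 - k%:Z) = (j == k).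
Proof. by apply/eqP/eqP; lia. Qed.

Let fermr_fermP k j w : fermr k (fermP j w) =
  - fermP j (fermr k w) + ((j == k)%:R * y) *: w.
Proof.
apply: etrans (fcomb_fcomb r true k%:Z g false (Negz j) w) _.
rewrite rg opposite_mode; exact: erefl.
Qed.

Let ferms_fermP k j w : ferms k (fermP j w) = - fermP j (ferms k w).
Proof. by apply: fcomb_fcomb0; left. Qed.

Let ferms_fermM k j w : ferms k (fermM j w) =
  - fermM j (ferms k w) + (j == k)%:R *: w.
Proof.
apply: etrans (fcomb_fcomb s false k%:Z f true (Negz j) w) _.
have -> : \sum_i s i * f i = 1 by rewrite -fs1; apply: eq_bigr => i _; rewrite mulrC.
rewrite opposite_mode mulr1; exact: erefl.
Qed.

Lemma obstruction_states K gg t : all (ltn^~ K) t ->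
  (1 + kap) * obstruction K gg (foldr (state G hp hm f g) (ket alpha mset0 fset0) t) =
  y * (1 + kap) ^+ size t *
    ((\sum_(n <- t) n)%:R * (gg * weights u t)`_0 + kap * correction u gg t).
Proof.
apply: (psi_foldr (Lam := Lam) (psi := obstruction K)).
- by move=> a p v; exact: Psi_scale.
- exact: (fun n => Lam_state LamL fermM n bosPL bosML Lam_bosP0 Lam_bosP Lam_bosM
    (fun j => Lam_fcomb g false j)).
- move=> n p w; exact: (Psi_state LamL bosrL fermsL fermrL bosPL bosML fermPL fermML
    Lam_bosP0 Lam_bosP Lam_bosM (fun j => Lam_fcomb g false j)
    (fun j => Lam_fcomb f true j) bosr_bosP bosr_bosM bosr_fermP fermr_bosP fermr_bosM
    ferms_bosP ferms_bosM fermr_fermP ferms_fermP ferms_fermM).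
- exact: chi_ground.
move=> p; rewrite /obstruction /Psi big1 ?add0r => [|k _]; last first.
  by rewrite /bosr bos_ground mul0r scale0r (lin0 LamL) mulr0 coef0 mulr0.
rewrite big1 // => m _; rewrite big1 // => k _.
rewrite /fermr /fcomb big1 => [|i _]; last by rewrite ferm_ground scaler0.
by rewrite (lin0 (fermsL k)) (lin0 LamL) !mulr0 coef0 mulr0.
Qed.
End Evaluate.
End Obstruction.

(** * Linear independence modulo exact states *)

Section QuotientFamilies.
Variables (K : fieldType) (V : lmodType K) (W : {pred V}).
Hypothesis Wsub : submod_closed W.
Local Notation pi := (lquot_pi Wsub).

Lemma lquot_pi0 : pi 0 = 0.
Proof. by apply: (addrI (pi 0)); rewrite -lquot_piD !addr0. Qed.

Lemma lquot_pi_sum d (c : 'I_d -> K) (v : 'I_d -> V) :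
  \sum_i c i *: pi (v i) = pi (\sum_i c i *: v i).
Proof.
rewrite (big_morph pi (lquot_piD Wsub) lquot_pi0).
by apply: eq_bigr => i _; exact: lquot_piZ.
Qed.

Lemma lquot_lin_indep d (v : 'I_d -> V) :
  (forall c : 'I_d -> K, \sum_i c i *: v i \in W -> forall i, c i = 0) ->
  lin_indep (fun i => pi (v i)).
Proof.
move=> v_free c; rewrite lquot_pi_sum -lquot_pi0 => /eqP.
by rewrite lquot_pi_eq subr0; exact: v_free.
Qed.
End QuotientFamilies.

Section Dimension.
Variables (C : numFieldType) (G : 'M[int]_4).
Variable eps : lattice -> lattice -> int.
Local Notation V := (VNS C).
Variables hp hm : 2.-tuple 'rV[C]_4.

Lemma dim_ge_Ptilde alpha d (v : 'I_d -> V) :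
  (forall i, P00_ G eps hp hm alpha (v i)) ->
  (forall (c : 'I_d -> C) x z,
    \sum_i c i *: v i = Gplus G eps hp (-1) x + Gminus G eps hm (-1) z ->
    forall i, c i = 0) ->
  dim_ge (Ptilde00_ (G := G) (eps := eps) (hp := hp) (hm := hm) alpha) d.
Proof.
move=> vP v_free; exists (fun i => Pproj G eps hp hm (v i)).
  by move=> i; exists (v i).
apply: lquot_lin_indep => c /asboolP[[_ [x _ <-] [_ [z _ <-] xz]] _].
by apply: v_free; symmetry; exact: xz.
Qed.

Hypothesis eps0 : forall l, eps 0 l = 1.
Hypothesis GT : G^T = G.
Hypothesis pp0 : forall i j, hform G (tnth hp i) (tnth hp j) = 0.
Hypothesis mm0 : forall i j, hform G (tnth hm i) (tnth hm j) = 0.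
Hypothesis pm1 : forall i j, hform G (tnth hp i) (tnth hm j) = (i == j)%:R.
Variable alpha : lattice.
Let p i := hform G (tnth hp i) (hlat C alpha).
Let q i := hform G (tnth hm i) (hlat C alpha).

(** For h = 0 every bosonic creation operator is evaluated to 0. *)
Lemma chi0_exact x z :
  chi G alpha 0 0 (Gplus G eps hp (-1) x + Gminus G eps hm (-1) z) = 0.
Proof.
have pair0 t b k w : (0 <= k)%N -> pairing G (0 : 'rV[C]_4) t b k w = 0.
  move=> _; rewrite /pairing big1 // => i _.
  by rewrite /hform trmx0 mulmx0 mxE scale0r.
have xE := chi_Gfield GT alpha 0 (pair0 hp false ^~ x).
have zE := chi_Gfield GT alpha 0 (pair0 hm true ^~ z).
rewrite (GplusE G eps0 hp (-1) x) (GminusE G eps0 hm (-1) z).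
apply: etrans (linD (chi_linear G alpha 0 0) _ _) _.
have none F : \sum_(0 <= k < 0) F k = 0 :> {poly C} by rewrite big_geq.
exact: etrans (congr2 +%R (etrans xE (none _)) (etrans zE (none _))) (addr0 _).
Qed.

(** By chi0_exact no nonzero multiple of e^alpha is exact; P^{0,0} contains
    e^alpha because L_0 acts on it by the sum of the products p i * q i. *)
Lemma dim_ge_light : \sum_i p i * q i = 0 -> forall d, (d <= 1)%N ->
  dim_ge (Ptilde00_ (G := G) (eps := eps) (hp := hp) (hm := hm) alpha) d.
Proof.
move=> pq0 d d1; apply: (@dim_ge_Ptilde alpha d (fun=> ket alpha mset0 fset0)).
  have zero t : hform G (hcomb t (fun=> 0)) (hlat C alpha) = 0.
    by rewrite hform_combl big1 // => j _; rewrite mul0r.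
  have := @physical_ground C G eps eps0 GT hp hm alpha _ _ _ _ (zero hp) (zero hm).
  by rewrite -[\sum_i _]/(\sum_i p i * q i) pq0 => /physical_P00.
move=> c x z cE i.
have -> : c i = (\sum_j c j *: (1 : {poly C}))`_0.
  rewrite coef_sum (bigD1 i) //= coefZ coef1 mulr1 big1 ?addr0 // => j /negP[].
  by apply/eqP/val_inj; have /= := ltn_ord i; have /= := ltn_ord j; lia.
have chiL := @chi_linear C G alpha 0 0.
rewrite (eq_bigr (fun j => chi G alpha 0 0 (c j *: ket alpha mset0 fset0))) => [|j _].
  by rewrite -(lin_sum _ _ _ chiL) cE chi0_exact coef0.
by rewrite (linZ chiL) chi_ground.
Qed.

(** Each functional gives one linear equation on the coefficients of an exact
    combination of the states; together their matrix is a regular value of the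
    pencil N A + kap B, so the coefficients vanish. *)
Lemma dim_ge_npart N : (0 < N)%N -> \sum_i p i * q i = - N%:R ->
  dim_ge (Ptilde00_ (G := G) (eps := eps) (hp := hp) (hm := hm) alpha) (npart N).
Proof.
move=> N0; have nN0 : N%:R != 0 :> C by rewrite pnatr_eq0 -lt0n.
have sum2 F : \sum_(i < 2) F i = F 0 + F 1 :> C.
  by rewrite !big_ord_recl big_ord0 addr0; congr (_ + F _); apply/val_inj.
rewrite sum2 => pqN.
(* r and s pair to 1 with each other and to 0 with p and q respectively; f and
   g deform them so that they pair to kap with p and to kap' with q, and y is
   the scale of g for which f and g stay orthogonal. *)
pose r (i : 'I_2) := if i == 0 then p 1 else - p 0.
pose s (i : 'I_2) := (if i == 0 then - q 1 else q 0) / N%:R.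
have [t t_inj tP] := partition_family N.
have tN i : all (fun n => 0 < n <= N)%N (t i) by case: (tP i).
have [u detA] := exists_independent_weights C t_inj tN.
set A := (\matrix_(i, j) _) in detA.
pose B := \matrix_(i, j) correction (u i) 1 (t j) : 'M[C]_(npart N).
have [|kap [kap0 tau0 detM]] := @exists_regular_shift C _ (N%:R *: A) B.
  by rewrite detZ mulf_neq0 ?expf_neq0.
pose kap' := -1 - kap; pose y := kap * kap' / N%:R.
have y0 : y != 0.
  rewrite !mulf_neq0 ?invr_neq0 // /kap' -opprD oppr_eq0; exact: tau0.
pose f i := r i - kap / N%:R * q i.
pose g i := y * s i - kap' / N%:R * p i.
have r0 : r 0 = p 1 by []. have r1 : r 1 = - p 0 by [].
have s0 : s 0 = - q 1 / N%:R by []. have s1 : s 1 = q 0 / N%:R by [].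
have combp F : hform G (hcomb hp F) (hlat C alpha) = F 0 * p 0 + F 1 * p 1.
  by rewrite hform_combl sum2.
have combm F : hform G (hcomb hm F) (hlat C alpha) = F 0 * q 0 + F 1 * q 1.
  by rewrite hform_combl sum2.
have h2p_alpha : hform G (hcomb hp r) (hlat C alpha) = 0.
  by rewrite combp r0 r1; ring.
have h2m_alpha : hform G (hcomb hm s) (hlat C alpha) = 0.
  by rewrite combm s0 s1; ring.
have bp_alpha : hform G (hcomb hp f) (hlat C alpha) = kap.
  rewrite combp /f r0 r1; transitivity (- (kap / N%:R) * (p 0 * q 0 + p 1 * q 1)).
    by ring.
  by rewrite pqN; field.
have bm_alpha : hform G (hcomb hm g) (hlat C alpha) = kap'.
  rewrite combm /g s0 s1; transitivity (- (kap' / N%:R) * (p 0 * q 0 + p 1 * q 1)).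
    by ring.
  by rewrite pqN; field.
have rs1 : r 0 * s 0 + r 1 * s 1 = 1.
  rewrite r0 r1 s0 s1; transitivity (- (p 0 * q 0 + p 1 * q 1) / N%:R); first by ring.
  by rewrite pqN; field.
have qs0 : q 0 * s 0 + q 1 * s 1 = 0 by rewrite s0 s1; ring.
have pr0 : r 0 * p 0 + r 1 * p 1 = 0 by rewrite r0 r1; ring.
have fs1 : \sum_i f i * s i = 1.
  rewrite sum2 /f; transitivity ((r 0 * s 0 + r 1 * s 1) -
    kap / N%:R * (q 0 * s 0 + q 1 * s 1)); first by ring.
  by rewrite rs1 qs0; ring.
have rg : \sum_i r i * g i = y.
  rewrite sum2 /g; transitivity (y * (r 0 * s 0 + r 1 * s 1) -
    kap' / N%:R * (r 0 * p 0 + r 1 * p 1)); first by ring.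
  by rewrite rs1 pr0; ring.
have fg0 : \sum_i f i * g i = 0.
  rewrite sum2 /f /g; transitivity (y * (r 0 * s 0 + r 1 * s 1) -
    kap' / N%:R * (r 0 * p 0 + r 1 * p 1) - kap / N%:R * y * (q 0 * s 0 + q 1 * s 1) +
    kap / N%:R * (kap' / N%:R) * (p 0 * q 0 + p 1 * q 1)); first by ring.
  by rewrite rs1 pr0 qs0 pqN /y; field.
have kapD : kap + kap' = -1 by rewrite /kap'; ring.
pose v i := foldr (state G hp hm f g) (ket alpha mset0 fset0) (t i).
apply: (@dim_ge_Ptilde alpha _ v) => [i|c x z cE].
  have := physical_states eps0 GT pp0 mm0 pm1 fg0 kapD bp_alpha bm_alpha (t i).
  by rewrite (proj2 (tP i)) sum2 [X in X + _]pqN addNr => /physical_P00.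
have key i : \sum_j (N%:R *: A + kap *: B) i j * (c j * (1 + kap) ^+ size (t j)) = 0.
  have [K0 exK] := obstruction_exact eps0 GT pp0 mm0 pm1 (u i) h2p_alpha h2m_alpha x z.
  have {exK} := exK (maxn K0 N.+1) (leq_maxl _ _); set K := maxn _ _.
  rewrite -cE obstruction_sum => /(congr1 (fun a => (1 + kap) * a)).
  rewrite mulr0 mulr_sumr => yE; apply: (mulfI y0); rewrite mulr0 mulr_sumr -{}[RHS]yE.
  apply: eq_bigr => j _; rewrite [RHS]mulrCA.
  have tK : all (ltn^~ K) (t j).
    by apply: sub_all (tN j) => n /andP[_ nN]; exact: (@leq_trans N.+1 n.+1 _ nN (leq_maxr K0 N.+1)).
  have := obstruction_states GT pp0 mm0 pm1 (u i) bp_alpha fs1 rg 1 tK.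
  rewrite -[foldr _ _ _]/(v j) => ->.
  by rewrite (proj2 (tP j)) mul1r !mxE; ring.
pose M := N%:R *: A + kap *: B; pose d := \col_j (c j * (1 + kap) ^+ size (t j)).
have Md : M *m d = 0.
  apply/colP => i; rewrite !mxE -[RHS](key i); apply: eq_bigr => j _.
  by rewrite [d _ _]mxE.
have Mu : M \in unitmx by rewrite unitmxE unitfE.
have d0 : d = 0 by rewrite -[d](mulKmx Mu) Md mulmx0.
move=> j; have /colP/(_ j) := d0; rewrite !mxE => /eqP.
by rewrite mulf_eq0 expf_eq0 (negPf tau0) andbF orbF => /eqP.
Qed.
End Dimension.

(** * From the real lattice to complex Fock space *)

Lemma npart0_le1 : (npart 0 <= 1)%N.
Proof.
have [f f_inj fP] := partition_family 0; rewrite -[npart 0]card_ord.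
apply/card_le1P => i _ j; rewrite inE; apply/idP/eqP => // _.
apply: f_inj; congr prime_code; rewrite /=.
have nil k : f k = [::].
  by case: (f k) (fP k) => [|[|n] s] // [].
by rewrite !nil.
Qed.

Section BaseChange.
Variables (R : realType) (G : 'M[int]_4).

Lemma hform_complex (x y : 'rV[R]_4) :
  hform G (map_mx (real_complex R) x) (map_mx (real_complex R) y) =
  real_complex R (hform G x y).
Proof.
have GC : map_mx intr G = map_mx (real_complex R) (map_mx intr G).
  by apply/matrixP => i j; rewrite !mxE rmorph_int.
by rewrite /hform map_trmx GC -!map_mxM mxE.
Qed.

Lemma hlat_complex l : hlat R[i] l = map_mx (real_complex R) (hlat R l).
Proof. by apply/matrixP => i j; rewrite !mxE rmorph_int. Qed.

Lemma hform_hlat l m : hform G (hlat R l) (hlat R m) = (lform G l m)%:~R.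
Proof. by rewrite /hform /hlat /lform map_trmx -!map_mxM mxE. Qed.

Lemma basis_hcomb (L : {vspace 'rV[R]_4}) (t : 2.-tuple 'rV[R]_4) v :
  basis_of L t -> v \in L -> v = hcomb t (fun i => coord t i v).
Proof.
move=> tB vL; rewrite {1}(coord_basis tB vL).
by apply: eq_bigr => i _; rewrite (tnth_nth 0).
Qed.

Variables (Lplus Lminus : {vspace 'rV[R]_4}) (hp hm : 2.-tuple 'rV[R]_4).
Hypothesis GE : even_lattice G.
Hypothesis Lfull : (Lplus + Lminus)%VS = fullv.
Hypothesis hpB : basis_of Lplus hp.
Hypothesis hmB : basis_of Lminus hm.
Hypothesis pp0 : forall i j, hform G (tnth hp i) (tnth hp j) = 0.
Hypothesis mm0 : forall i j, hform G (tnth hm i) (tnth hm j) = 0.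
Hypothesis pm1 : forall i j, hform G (tnth hp i) (tnth hm j) = (i == j)%:R.

(** Pairing with one basis reads off the coordinates of l with respect to the
    other one, and by isotropy (l, l) is twice the product of these
    coordinates. *)
Lemma half_norm l :
  \sum_i hform G (tnth hp i) (hlat R l) * hform G (tnth hm i) (hlat R l) =
  (lform G l l %/ 2)%Z%:~R.
Proof.
have [GT even] := GE; set v := hlat R l.
have /memv_addP[v1 v1L [v2 v2L vE]] : v \in (Lplus + Lminus)%VS by rewrite Lfull memvf.
have {}vE : v = hcomb hp (coord hp ^~ v1) + hcomb hm (coord hm ^~ v2).
  by rewrite -(basis_hcomb hpB v1L) -(basis_hcomb hmB v2L).
set x := coord hp ^~ v1 in vE; set y := coord hm ^~ v2 in vE.
have hformDr a b c : hform G a (b + c) = hform G a b + hform G a c :> R.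
  by rewrite /hform linearD mulmxDr mxE.
have pE i : hform G (tnth hp i) v = y i.
  by rewrite vE hformDr (hform_pp GT pp0) (hform_pm GT pm1) add0r.
have qE i : hform G (tnth hm i) v = x i.
  by rewrite vE hformDr (hform_mm GT mm0) (hform_mp GT pm1) addr0.
have vv : hform G v v = 2%:R * \sum_i y i * x i.
  rewrite {2}vE hformDr !(hform_combr GT) mulr2n mulrDl mul1r; congr (_ + _).
    by apply: eq_bigr => i _; rewrite (hform_sym GT) pE mulrC.
  by apply: eq_bigr => i _; rewrite (hform_sym GT) qE.
rewrite (eq_bigr (fun i => y i * x i)) => [|i _]; last by rewrite pE qE.
apply: (@mulfI R 2%:R); first by rewrite pnatr_eq0.
rewrite -vv hform_hlat -[in LHS](divzK (even l)).
by rewrite rmorphM /= mulrC.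
Qed.
End BaseChange.

Theorem corollary7p15 (R : realType) (G : 'M[int]_4)
    (eps : 'rV[int]_4 -> 'rV[int]_4 -> int)
    (Lplus Lminus : {vspace 'rV[R]_4}) (hplus hminus : 2.-tuple 'rV[R]_4)
    (alpha : 'rV[int]_4) :
  even_lattice G -> signature22 R G -> cocycle G eps ->
  isotropic G Lplus -> isotropic G Lminus ->
  \dim Lplus = 2%N -> \dim Lminus = 2%N ->
  (Lplus + Lminus)%VS = fullv -> directv (Lplus + Lminus) ->
  basis_of Lplus hplus -> basis_of Lminus hminus ->
  (forall i j : 'I_2, hform G (tnth hplus i) (tnth hminus j) = (i == j)%:R) ->
  dim_ge (Ptilde00_ (C := R[i]) (G := G) (eps := eps)
            (hp := [tuple of map (map_mx (real_complex R)) hplus])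
            (hm := [tuple of map (map_mx (real_complex R)) hminus]) alpha)
         (part (- (lform G alpha alpha %/ 2)%Z)).
Proof.
move=> GE _ epsC isoP isoM _ _ Lfull _ hpB hmB pm1.
have pp0 i j : hform G (tnth hplus i) (tnth hplus j) = 0.
  by apply: isoP; apply: (basis_mem hpB); exact: mem_tnth.
have mm0 i j : hform G (tnth hminus i) (tnth hminus j) = 0.
  by apply: isoM; apply: (basis_mem hmB); exact: mem_tnth.
have [GT _] := GE; have eps0 l : eps 0 l = 1 by case: (eps_zero epsC l).
set hp := [tuple of _]; set hm := [tuple of map _ hminus].
have hpE i : tnth hp i = map_mx (real_complex R) (tnth hplus i) by rewrite tnth_map.
have hmE i : tnth hm i = map_mx (real_complex R) (tnth hminus i) by rewrite tnth_map.
have pp0C i j : hform G (tnth hp i) (tnth hp j) = 0.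
  by rewrite !hpE hform_complex pp0 rmorph0.
have mm0C i j : hform G (tnth hm i) (tnth hm j) = 0.
  by rewrite !hmE hform_complex mm0 rmorph0.
have pm1C i j : hform G (tnth hp i) (tnth hm j) = (i == j)%:R.
  by rewrite hpE hmE hform_complex pm1 rmorph_nat.
have norm : \sum_i hform G (tnth hp i) (hlat R[i] alpha) *
    hform G (tnth hm i) (hlat R[i] alpha) = (lform G alpha alpha %/ 2)%Z%:~R.
  rewrite -(rmorph_int (real_complex R)) -(half_norm GE Lfull hpB hmB pp0 mm0 pm1).
  rewrite rmorph_sum; apply: eq_bigr => i _.
  by rewrite rmorphM hpE hmE hlat_complex !hform_complex.
case nE: (- (lform G alpha alpha %/ 2)%Z) => [[|n]|n] /=.
- apply: dim_ge_light => //; last exact: npart0_le1.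
  by rewrite norm; move/eqP: nE; rewrite oppr_eq0 => /eqP ->.
- apply: dim_ge_npart => //.
  by rewrite norm -[(_ %/ _)%Z]opprK nE rmorphN.
by exists (fun=> 0) => [[]|c _ []].
Qed.
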